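(* Let $n\ge 2$ and let $\mathfrak{g}$ be a Frobenius seaweed subalgebra of $\mathfrak{sl}(n)$ (over $\mathbb{C}$). Let $\hat F\in\mathfrak{g}$ be a principal element of $\mathfrak{g}$. Then the spectrum of $\mathrm{ad}\,\hat F:\mathfrak{g}\to\mathfrak{g}$ consists of an unbroken set of integers centered at one half; that is, the set of eigenvalues of $\mathrm{ad}\,\hat F$ equals $\{1-\lambda,2-\lambda,\dots,\lambda-1,\lambda\}$ for some positive integer $\lambda$. Moreover, the dimensions of the associated eigenspaces form a symmetric distribution about one half: if $d_l$ denotes the dimension of the eigenspace of $\mathrm{ad}\,\hat F$ for the eigenvalue $l$ (with $d_l=0$ if $l$ is not an eigenvalue), then $d_l=d_{1-l}$ for every integer $l$.
   Context: All Lie algebras are over $\mathbb{C}$; $\mathfrak{sl}(n)$ is the Lie algebra of $n\times n$ matrices of trace zero. A seaweed (or biparabolic) subalgebra of $\mathfrak{sl}(n)$ is a subalgebra of the form $\mathfrak{p}\cap\mathfrak{p}'$ where $\mathfrak{p},\mathfrak{p}'$ are parabolic subalgebras of $\mathfrak{sl}(n)$ with $\mathfrak{p}+\mathfrak{p}'=\mathfrak{sl}(n)$. For a Lie algebra $\mathfrak{g}$ and $F\in\mathfrak{g}^*$, the Kirillov form is the skew-symmetric bilinear form $B_F(x,y)=F([x,y])$. The index of $\mathfrak{g}$ is $\min_{F\in\mathfrak{g}^*}\dim\ker B_F$. The algebra $\mathfrak{g}$ is Frobenius if its index is $0$; equivalently, there is $F\in\mathfrak{g}^*$ (called a Frobenius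 functional) with $B_F$ non-degenerate. For a Frobenius functional $F$, the map $\mathfrak{g}\to\mathfrak{g}^*$, $x\mapsto F([x,-])$, is an isomorphism, and the inverse image $\hat F$ of $F$ under this map is called a principal element of $\mathfrak{g}$; it is the unique element of $\mathfrak{g}$ with $F([\hat F,-])=F$. The spectrum of $\mathrm{ad}\,\hat F$ is known to be independent of the choice of the Frobenius functional $F$ and is called the spectrum of $\mathfrak{g}$. A set of integers is unbroken if it consists of consecutive integers. *)

(* Defs.v *)
(* The complex numbers are R[i] for a realType R. *)
From HB Require Import structures.
From mathcomp Require Import all_boot all_order all_algebra.
From mathcomp Require Import boolp reals complex.

Set Implicit Arguments.
Unset Strict Implicit.
Unset Printing Implicit Defensive.

Import GRing.Theory.

Local Open Scope ring_scope.

Section MatrixLie.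
Variables (K : fieldType) (n : nat).
Implicit Types (A B : 'M[K]_n) (U V W : {vspace 'M[K]_n}).

Definition lie_br A B : 'M[K]_n := A *m B - B *m A.

Definition sl : {vspace 'M[K]_n} := lker (linfun (mxtrace : 'M[K]_n -> K^o)).

Lemma mem_sl A : (A \in sl) = (\tr A == 0).
Proof. by rewrite memv_ker lfunE. Qed.

Definition lie_closed U : Prop :=
  forall A B, A \in U -> B \in U -> lie_br A B \in U.

(* The span [U, V] of all the brackets; taking the brackets of basis vectors
   is enough, by lie_brv_subP. *)
Definition lie_brv U V : {vspace 'M[K]_n} :=
  <<[seq lie_br A B | A <- vbasis U, B <- vbasis V]>>%VS.

Fact lie_br_is_linear A : linear (lie_br A).
Proof.
move=> a B C; rewrite /lie_br mulmxDr mulmxDl -scalemxAr -scalemxAl.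
by rewrite opprD addrACA scalerBr.
Qed.
HB.instance Definition _ A :=
  GRing.isLinear.Build K 'M[K]_n 'M[K]_n *:%R (lie_br A) (lie_br_is_linear A).

Lemma lie_brC A B : lie_br A B = - lie_br B A.
Proof. by rewrite /lie_br opprB. Qed.

Lemma lie_brv_subP U V W :
  (forall A B, A \in U -> B \in V -> lie_br A B \in W) <->
  (lie_brv U V <= W)%VS.
Proof.
split=> [UVW|/subvP UVW A B UA VB].
  apply/span_subvP => _ /allpairsP[[A B] [/= /vbasis_mem UA /vbasis_mem VB ->]].
  exact: UVW.
rewrite (coord_vbasis VB) linear_sum memv_suml // => j _.
rewrite linearZ /= memvZ // lie_brC memvN (coord_vbasis UA) linear_sum memv_suml //.
move=> i _; rewrite linearZ /= memvZ // lie_brC memvN UVW // memv_span //.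
by apply/allpairsP; exists ((vbasis U)`_i, (vbasis V)`_j);
  rewrite !mem_nth ?size_tuple.
Qed.

Definition lie_solvable U : Prop :=
  exists k, iter k (fun V => lie_brv V V) U = 0%VS.

Definition sl_subalgebra U : Prop := lie_closed U /\ (U <= sl)%VS.

(* Borel subalgebra: maximal solvable subalgebra. *)
Definition sl_borel U : Prop :=
  [/\ sl_subalgebra U, lie_solvable U &
      forall V, sl_subalgebra V -> lie_solvable V -> (U <= V)%VS -> V = U].

Definition sl_parabolic U : Prop :=
  sl_subalgebra U /\ exists2 V, sl_borel V & (V <= U)%VS.

Definition sl_seaweed U : Prop :=
  exists P P', [/\ sl_parabolic P, sl_parabolic P',
                   (P + P')%VS = sl & U = (P :&: P')%VS].

End MatrixLie.

(* The Lie algebra carried by a subspace g of matrices closed under the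
   bracket.  The projection vsproj g only retypes the bracket: see val_sub_br. *)
Section SubLie.
Variables (K : fieldType) (n : nat) (g : {vspace 'M[K]_n}).
Implicit Types (x y : subvs_of g).

Definition sub_br x y : subvs_of g := vsproj g (lie_br (vsval x) (vsval y)).

Lemma val_sub_br x y :
  lie_closed g -> vsval (sub_br x y) = lie_br (vsval x) (vsval y).
Proof. by move=> gP; rewrite vsprojK // gP // subvsP. Qed.

Fact sub_br_is_linear x : linear (sub_br x).
Proof. by move=> a y z; rewrite /sub_br !linearP. Qed.
HB.instance Definition _ x :=
  GRing.isLinear.Build K (subvs_of g) (subvs_of g) *:%R (sub_br x)
    (sub_br_is_linear x).

Lemma sub_brC x y : sub_br x y = - sub_br y x.
Proof. by rewrite /sub_br lie_brC linearN. Qed.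

Definition ad x : 'End(subvs_of g) := linfun (sub_br x).

Lemma adE x y : ad x y = sub_br x y.
Proof. exact: lfunE. Qed.

Implicit Types F : 'Hom(subvs_of g, K^o).

Definition kirillov F x y : K := F (sub_br x y).

Definition kirillov_fun F x : 'Hom(subvs_of g, K^o) := (F \o ad x)%VF.

Fact kirillov_fun_is_linear F : linear (kirillov_fun F).
Proof.
move=> a x y; apply/lfunP => z.
rewrite !lfunE /= !lfunE /= !comp_lfunE !adE.
by rewrite sub_brC linearP opprD -scalerN -!sub_brC linearP.
Qed.
HB.instance Definition _ F :=
  GRing.isLinear.Build K (subvs_of g) 'Hom(subvs_of g, K^o) *:%R
    (kirillov_fun F) (kirillov_fun_is_linear F).

(* The map g -> g^*, x |-> F([x, -]). *)
Definition kirillov_map F : 'Hom(subvs_of g, 'Hom(subvs_of g, K^o)) :=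
  linfun (kirillov_fun F).

Lemma kirillov_mapE F x y : kirillov_map F x y = kirillov F x y.
Proof. by rewrite lfunE /= comp_lfunE adE. Qed.

Definition kirillov_ker F : {vspace subvs_of g} := lker (kirillov_map F).

Lemma kirillov_kerP F x :
  reflect (forall y, kirillov F x y = 0) (x \in kirillov_ker F).
Proof.
rewrite memv_ker; apply: (iffP eqP) => [Fx0 y|Fx0].
  by rewrite -kirillov_mapE Fx0 lfunE.
by apply/lfunP => y; rewrite kirillov_mapE Fx0 lfunE.
Qed.

Fact index_subproof : exists k, `[< exists F, \dim (kirillov_ker F) = k >].
Proof. by exists (\dim (kirillov_ker 0)); apply/asboolP; exists 0. Qed.

Definition lie_index : nat := ex_minn index_subproof.

Definition frobenius : Prop := lie_index = 0%N.

Definition frobenius_functional F : Prop := kirillov_ker F = 0%VS.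

Definition principal x : Prop :=
  exists2 F, frobenius_functional F & kirillov_map F x = F.

End SubLie.

(* Main.v *)
(* By Lie's theorem and the Bruhat decomposition, a seaweed is conjugate to the
   trace-zero part of an algebra of matrices [u] with [u i j = 0] unless
   [p i <= p j] and [q j <= q i], and a functional is [u |-> \tr (f *m u)].
   The argument is an induction on the index set, for an arbitrary Frobenius [f].
   Let [U] be the [q]-minimal block, assumed to lie in the [p]-minimal block (up
   to transposition), and [E] the rest of that block.  Conjugation brings the
   corner [phi] of [f] with rows [U] and columns [E] to a form that is invertible
   from [V] to [W] and zero elsewhere; nondegeneracy forces [V = U] or [W = E].
   Deleting [V] leaves a smaller Frobenius seaweed with principal element [y],
   from which the principal element [x] is recovered modulo the ideal of
   matrices with rows [E] and columns [U].  The spectrum of [ad x] is that of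
   [ad y] together with the numbers [c - w] and [1 - (c - w)], for [c] and [w]
   eigenvalues of the diagonal blocks of [x] at [E] and [U]; a stronger statement
   about the eigenvalues of diagonal blocks shows that the union is unbroken.
   The symmetry of the multiplicities comes from
   [B([x, u], v) + B(u, [x, v]) = B(u, v)] for the Kirillov form [B]. *)
From HB Require Import structures.
Require Import Defs.
From mathcomp Require Import all_boot all_order all_algebra.
From mathcomp Require Import boolp reals complex.
From mathcomp Require Import fingroup perm zify ring.

Set Implicit Arguments.
Unset Strict Implicit.
Unset Printing Implicit Defensive.

Import Order.TTheory GRing.Theory Num.Theory.
Import passmx.
Local Open Scope ring_scope.

(** * Diagonal blocks *)

Section Corner.
Variables (K : fieldType) (n : nat).
Implicit Types (S T J : {set 'I_n}) (u v x y : 'M[K]_n) (z c : K).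

(** The scalars [c *: pr K J] are kept in the algebra, so a principal element is determined only up
    to a scalar: block eigenvalues are known only relative to an unspecified base point [z0], while
    the spectrum of [ad x] has none. The shift by one arises as follows: for [m] with rows in [E]
    and columns in [U], [[pr U, m] = - m], while [f [x, m] = f m]. Hence [x + pr U] is orthogonal to
    the ideal of such [m], and this orthogonal consists of the lifts of the smaller seaweed plus the
    ideal. So the block of [x] at [U] is a copy of the block of [y] at [T = C :|: W], lowered by
    one. The obstacle is that the spectrum of [ad y] says nothing about the differences [c - w].
    What saves the induction is that the eigenvalues at [W] occur at [E] and, lowered by one, at
    [U]: the differences contain 1, their reflections contain 0, and 0 is in the spectrum of [ad y].
    It remains to see that the differences form an interval, which is what the intervals on blocks
    and the links between blocks in [half] are for. *)

Definition pr S : 'M[K]_n := diag_mx (\row_i (i \in S)%:R).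

Lemma pr_mulE S m (u : 'M[K]_(n, m)) i j :
  (pr S *m u) i j = if i \in S then u i j else 0.
Proof.
rewrite mul_diag_mx !mxE.
by case: (i \in S); rewrite ?mul1r ?mul0r.
Qed.

Lemma mul_prE S m (u : 'M[K]_(m, n)) i j :
  (u *m pr S) i j = if j \in S then u i j else 0.
Proof.
rewrite mul_mx_diag !mxE.
by case: (j \in S); rewrite ?mulr1 ?mulr0.
Qed.

Lemma prE S i j : pr S i j = ((i == j) && (i \in S))%:R.
Proof.
by rewrite -[pr S]mulmx1 pr_mulE !mxE; case: (i \in S); rewrite ?andbT ?andbF.
Qed.

Lemma pr_pr S T : pr S *m pr T = pr (S :&: T).
Proof.
apply/matrixP=> i j; rewrite pr_mulE !prE inE.
by case: (i \in S); rewrite ?andbF.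
Qed.

Lemma pr_id S : pr S *m pr S = pr S.
Proof. by rewrite pr_pr setIid. Qed.

Lemma pr_sub S T : S \subset T -> pr S *m pr T = pr S.
Proof. by move=> /setIidPl sST; rewrite pr_pr sST. Qed.

Lemma pr_sub' S T : S \subset T -> pr T *m pr S = pr S.
Proof. by move=> /setIidPr sST; rewrite pr_pr sST. Qed.

Lemma pr0 : pr set0 = 0.
Proof. by apply/matrixP=> i j; rewrite prE !inE andbF mxE. Qed.

Lemma prT : pr setT = 1%:M.
Proof. by apply/matrixP=> i j; rewrite prE !inE andbT mxE. Qed.

Lemma pr_disj S T : [disjoint S & T] -> pr S *m pr T = 0.
Proof. by rewrite -setI_eq0 pr_pr => /eqP->; rewrite pr0. Qed.

Lemma pr_setU S T : [disjoint S & T] -> pr (S :|: T) = pr S + pr T.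
Proof.
move=> dST; apply/matrixP=> i j; rewrite [RHS]mxE !prE inE.
case: (i == j) => /=; last by rewrite addr0.
have := disjointFr dST; case: (boolP (i \in S)) => [iS /(_ _ iS) -> | _ _] /=.
  by rewrite addr0.
by rewrite add0r.
Qed.

Lemma pr_setD S T : S \subset T -> pr (T :\: S) = pr T - pr S.
Proof.
move=> sST; rewrite -[in RHS](setID T S) pr_setU ?(setIidPr sST).
  by rewrite addrAC subrr add0r.
by rewrite -setI_eq0 setIDA setDIl setDv set0I.
Qed.

Lemma pr_setC S : pr (~: S) = 1%:M - pr S.
Proof.
rewrite -prT -(setUCr S) pr_setU; last by rewrite -setI_eq0 setICr.
by rewrite addrAC subrr add0r.
Qed.

Lemma tr_pr S : (pr S)^T = pr S.
Proof. by rewrite /pr tr_diag_mx. Qed.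

Lemma pr_eq0 S : (pr S == 0) = (S == set0).
Proof.
apply/eqP/eqP => [S0|->]; last exact: pr0.
apply/setP=> i; move/matrixP/(_ i i): S0; rewrite prE eqxx !inE mxE /=.
by case: (i \in S) => // /eqP; rewrite oner_eq0.
Qed.

Lemma pr_rows S m (u : 'M[K]_(n, m)) :
  (forall i j, u i j != 0 -> i \in S) -> pr S *m u = u.
Proof.
move=> h; apply/matrixP=> i j; rewrite pr_mulE; case: ifPn => // iS.
by case: (eqVneq (u i j) 0) => // /h; rewrite (negPf iS).
Qed.

Lemma pr_cols S m (u : 'M[K]_(m, n)) :
  (forall i j, u i j != 0 -> j \in S) -> u *m pr S = u.
Proof.
move=> h; apply/matrixP=> i j; rewrite mul_prE; case: ifPn => // iS.
by case: (eqVneq (u i j) 0) => // /h; rewrite (negPf iS).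
Qed.

Lemma pr_row_sub S T u :
  (forall i j, i \in S -> u i j != 0 -> j \in T) ->
  pr S *m u *m pr T = pr S *m u.
Proof.
move=> h; apply: pr_cols => i j; rewrite pr_mulE.
by case: ifP => [iS /(h _ _ iS)|]; rewrite ?eqxx.
Qed.

Lemma pr_col_sub S T u :
  (forall i j, j \in T -> u i j != 0 -> i \in S) ->
  pr S *m u *m pr T = u *m pr T.
Proof.
move=> h; rewrite -mulmxA; apply: pr_rows => i j; rewrite mul_prE.
by case: ifP => [iS /(h _ _ iS)|]; rewrite ?eqxx.
Qed.

Lemma pr_block0 S T u :
  (forall i j, i \in S -> j \in T -> u i j != 0 -> false) ->
  pr S *m u *m pr T = 0.
Proof.
move=> h; apply/matrixP=> i j; rewrite mul_prE pr_mulE mxE.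
case: ifP => // jT; case: ifP => // iS.
by case: (eqVneq (u i j) 0) => // /(h _ _ iS jT).
Qed.

Lemma corner_sup S T u i j : pr S *m u *m pr T = u -> u i j != 0 ->
  i \in S /\ j \in T.
Proof.
move=> uE; rewrite -uE mul_prE pr_mulE.
by case: (j \in T); case: (i \in S); rewrite ?eqxx.
Qed.

(* [z] is an eigenvalue of the diagonal block of [x] at [S]; the second summand
   only makes the matrix invertible outside of the block. *)
Definition bspec x S z :=
  pr S *m (x - z%:M) *m pr S + pr (~: S) \notin unitmx.

Lemma bspecE x y S z :
  pr S *m x *m pr S = pr S *m y *m pr S -> bspec x S z = bspec y S z.
Proof. by rewrite /bspec !mulmxBr !mulmxBl => ->. Qed.

Lemma not_unitmxP m (u : 'M[K]_m) :
  u \notin unitmx <-> exists2 v : 'rV_m, v != 0 & v *m u = 0.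
Proof.
rewrite unitmxE unitfE negbK; split=> [/det0P //|h]; exact/det0P.
Qed.

Lemma bspec_left x S z : bspec x S z <->
  exists v : 'rV[K]_n, [/\ v != 0, v *m pr S = v & v *m x *m pr S = z *: v].
Proof.
rewrite /bspec not_unitmxP; split=> [[v v0 vS]|[v [v0 vS vx]]].
  have vS0 : v *m pr (~: S) = 0.
    have /(congr1 (mulmx^~ (pr (~: S)))) := vS.
    rewrite mulmxDr mulmxDl mul0mx -!mulmxA (pr_disj (S := S)) ?pr_id; last first.
      by rewrite -setI_eq0 setICr.
    by rewrite !mulmx0 add0r.
  have vSv : v *m pr S = v.
    by move: vS0; rewrite pr_setC mulmxBr mulmx1 => /eqP; rewrite subr_eq0 => /eqP.
  exists v; split=> //; move: vS.
  rewrite mulmxDr vS0 addr0 !mulmxA vSv mulmxBr mulmxBl mul_mx_scalar -scalemxAl vSv.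
  by move/eqP; rewrite subr_eq0 => /eqP.
exists v => //; rewrite mulmxDr !mulmxA vS mulmxBr mulmxBl mul_mx_scalar.
rewrite -scalemxAl vS vx subrr add0r pr_setC mulmxBr mulmx1 vS subrr //.
Qed.

Lemma bspec_tr x S z : bspec x^T S z = bspec x S z.
Proof.
rewrite /bspec -[in RHS]unitmx_tr.
suff -> : (pr S *m (x - z%:M) *m pr S + pr (~: S))^T =
  pr S *m (x^T - z%:M) *m pr S + pr (~: S) by [].
by rewrite linearD /= !trmx_mul !tr_pr mulmxA linearB /= tr_scalar_mx.
Qed.

Lemma bspecN x S z : bspec (- x) S z = bspec x S (- z).
Proof.
apply/idP/idP => /bspec_left[v [v0 vS vx]]; apply/bspec_left; exists v; split=> //.
  by rewrite scaleNr -vx mulmxN mulNmx opprK.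
by rewrite mulmxN mulNmx vx scaleNr opprK.
Qed.

Lemma bspec_right x S z : bspec x S z <->
  exists v : 'cV[K]_n, [/\ v != 0, pr S *m v = v & pr S *m x *m v = z *: v].
Proof.
rewrite -bspec_tr bspec_left; split=> -[v [v0 vS vx]];
  exists v^T; rewrite ?trmx_eq0; split=> //.
- by rewrite -tr_pr -trmx_mul vS.
- by rewrite -tr_pr -[x]trmxK -mulmxA -!trmx_mul vx linearZ.
- by rewrite -[pr S]tr_pr -trmx_mul vS.
- by rewrite -[pr S]tr_pr -!trmx_mul mulmxA vx linearZ.
Qed.

Lemma bspec0 x z : bspec x set0 z = false.
Proof. by rewrite /bspec pr0 !mul0mx add0r setC0 prT unitmx1. Qed.

(** The block at [S :|: T] is triangular. A right eigenvector projects to one at [T] unless it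
    already lives at [S]; conversely, an eigenvector at [S] is extended by zero as a column, and one
    at [T] as a row. *)
Lemma bspec_setU x S T z : [disjoint S & T] -> pr T *m x *m pr S = 0 ->
  bspec x (S :|: T) z = bspec x S z || bspec x T z.
Proof.
move=> dST xTS; have sS : S \subset S :|: T by apply: subsetUl.
have sT : T \subset S :|: T by apply: subsetUr.
apply/idP/orP.
  move=> /bspec_right[v [v0 vS vx]].
  have [vT|vT] := eqVneq (pr T *m v) 0.
    left; apply/bspec_right; exists v; split=> //.
      by rewrite -{2}vS pr_setU // mulmxDl vT addr0.
    by rewrite -(pr_sub sS) -!mulmxA !(mulmxA _ x) vx -scalemxAr -{2}vS pr_setU // mulmxDl vT addr0.
  right; apply/bspec_right; exists (pr T *m v); split=> //.
    by rewrite mulmxA pr_id.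
  have -> : pr T *m x *m (pr T *m v) = pr T *m x *m v.
    by rewrite -{2}vS pr_setU // mulmxDl mulmxDr !mulmxA xTS mul0mx add0r.
  by rewrite -(pr_sub sT) -!mulmxA !(mulmxA _ x) vx -scalemxAr mulmxA pr_sub.
case=> [/bspec_right|/bspec_left] [v [v0 vS vx]].
  apply/bspec_right; exists v; split=> //.
    by rewrite -vS mulmxA pr_sub'.
  by rewrite pr_setU // !mulmxDl vx -vS !mulmxA xTS mul0mx addr0.
apply/bspec_left; exists v; split=> //.
  by rewrite -vS -mulmxA pr_sub.
by rewrite pr_setU // mulmxDr vx -{1}vS -!mulmxA (mulmxA (pr T)) xTS mulmx0 add0r.
Qed.

(** The matrix [a] embeds the space of [S] into that of [T], with left inverse [b], and intertwines
    the two blocks up to the scalar [c]; so it carries right eigenvectors to right eigenvectors. *)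
Lemma bspec_transfer x y S T (a b : 'M[K]_n) z c :
  b *m a *m pr S = pr S -> pr T *m a *m pr S = a *m pr S ->
  pr T *m y *m a *m pr S = a *m pr S *m x *m pr S + c *: (a *m pr S) ->
  bspec x S z -> bspec y T (z + c).
Proof.
move=> ba aT hy /bspec_right[v [v0 vS vx]]; apply/bspec_right.
exists (a *m v); split.
- apply/eqP => av0; case/eqP: v0.
  by rewrite -vS -ba -!mulmxA vS av0 mulmx0.
- by rewrite -vS !mulmxA aT.
rewrite -{1}vS !mulmxA hy mulmxDl -!mulmxA vS !(mulmxA (pr S)) vx.
by rewrite -scalemxAl -scalemxAr -mulmxA vS scalerDl.
Qed.

(** The product of a right eigenvector at [S] and a left eigenvector at [T]. It serves as an
    eigenvector of the commutator with [x] for [e - w]. *)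
Lemma bspec_rank1 x S T e w : bspec x S e -> bspec x T w ->
  exists u, [/\ u != 0, pr S *m u *m pr T = u, pr S *m x *m u = e *: u &
                u *m x *m pr T = w *: u].
Proof.
move=> /bspec_right[v [v0 vS vx]] /bspec_left[l [l0 lS lx]].
exists (v *m l); split.
- apply/eqP => vl0; case/negP: l0; apply/eqP/matrixP => i j; rewrite ord1 mxE.
  move: v0 => /cV0Pn[k vk]; move/matrixP/(_ k j): vl0.
  rewrite !mxE big_ord1 => /eqP; rewrite mulf_eq0 (negPf vk) /= => /eqP //.
- by rewrite mulmxA vS -mulmxA lS.
- by rewrite mulmxA vx -scalemxAl.
- by rewrite -!mulmxA (mulmxA l) lx -!scalemxAr.
Qed.

End Corner.

(** * Linear functionals, eigenvectors and column reduction *)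

Lemma mxtr_formP (K : fieldType) (n : nat) (h : 'M[K]_n -> K) :
  linear (h : _ -> K^o) ->
  exists m : 'M[K]_n, forall u, h u = \tr (m *m u).
Proof.
move=> hl.
pose H := GRing.isLinear.Build K 'M[K]_n K^o *:%R h hl.
pose h' : {linear 'M[K]_n -> K^o} := HB.pack h H.
exists (\matrix_(i, j) h (delta_mx j i)) => u.
rewrite /mxtrace; under eq_bigr => i _ do rewrite mxE.
rewrite exchange_big /= {1}(matrix_sum_delta u) -[h]/(h' : _ -> _) linear_sum.
apply: eq_bigr => i _; rewrite linear_sum; apply: eq_bigr => j _.
by rewrite linearZ /= mxE mulrC.
Qed.

(* Subspaces are presented as the fixed points of a projection [pi]. *)
Lemma fixed_surj (K : fieldType) (V : vectType K) (pi h : 'End(V)) :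
  (forall v, pi (pi v) = pi v) ->
  (forall v, pi v = v -> pi (h v) = h v) ->
  (forall v, pi v = v -> h v = 0 -> v = 0) ->
  forall w, pi w = w -> exists2 v, pi v = v & h v = w.
Proof.
move=> piK hpi hinj w piw; pose W := limg pi.
have memW v : v \in W -> pi v = v by case/memv_imgP => a _ ->.
have Wmem v : pi v = v -> v \in W by move<-; rewrite memv_img ?memvf.
have hW : (h @: W <= W)%VS.
  apply/subvP => _ /memv_imgP[v /memW pv ->]; apply: Wmem; exact: hpi.
have hk : (W :&: lker h = 0)%VS.
  apply/eqP; rewrite -subv0; apply/subvP => v.
  by rewrite memv_cap memv0 memv_ker => /andP[/memW pv /eqP hv]; rewrite (hinj v).
have eW : (h @: W = W)%VS.
  by apply/eqP; rewrite eqEdim hW (limg_dim_eq hk) leqnn.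
by have := Wmem _ piw; rewrite -eW => /memv_imgP[v /memW pv ->]; exists v.
Qed.

Lemma fixed_factor (K : fieldType) (V W : vectType K)
    (pi : 'End(V)) (h : 'Hom(V, K^o)) (g : 'Hom(V, W)) :
  (forall v, pi (pi v) = pi v) ->
  (forall v, pi v = v -> g v = 0 -> h v = 0) ->
  exists m : 'Hom(W, K^o), forall v, pi v = v -> h v = m (g v).
Proof.
move=> piK gh; pose g' := (g \o pi)%VF.
exists (h \o pi \o g'^-1)%VF => v piv; rewrite !comp_lfunE /=.
have /limg_lfunVK : g v \in limg g'.
  by rewrite -{1}piv -[g (pi v)](comp_lfunE g pi) memv_img ?memvf.
rewrite !comp_lfunE /= => e.
apply/eqP; rewrite -subr_eq0 -linearB /=; apply/eqP; apply: gh.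
  by rewrite linearB /= piv piK.
by rewrite linearB /= e subrr.
Qed.

(** By Cayley-Hamilton, applying the linear factors of the characteristic polynomial to [u] one
    after the other ends in zero; the last nonzero vector still satisfies [P] and is an
    eigenvector. *)
Lemma stable_eigen (K : closedFieldType) (m n : nat) (P : 'M[K]_(m, n) -> Prop)
    (y : 'M_n) u : P u -> u != 0 -> (forall w r, P w -> P (w *m (y - r%:M))) ->
  exists w r, [/\ P w, w != 0 & w *m y = r *: w].
Proof.
case: n P y u => [|n] P y u Pu u0 Pstep; first by rewrite thinmx0 eqxx in u0.
have := congr1 (mulmx u) (Cayley_Hamilton y); rewrite mulmx0.
have [rs ->] := closed_field_poly_normal (char_poly y).
rewrite (monicP (char_poly_monic _)) scale1r.
elim: rs u u0 Pu => [|r rs IH] u u0 Pu.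
  by rewrite big_nil rmorph1 mulmx1 => /eqP; rewrite (negPf u0).
rewrite big_cons rmorphM /= rmorphB /= horner_mx_X horner_mx_C mulmxA => hrs.
have [uY|uY] := eqVneq (u *m (y - r%:M)) 0; last exact: (IH _ uY (Pstep _ _ Pu)).
exists u, r; split=> //; move/eqP: uY.
by rewrite mulmxBr mul_mx_scalar subr_eq0 => /eqP.
Qed.

Definition sylvester_eq (K : fieldType) (n : nat) (x : 'M[K]_n) S T z u :=
  pr K S *m u *m pr K T = u /\
  pr K S *m x *m u - u *m (x *m pr K T) = z *: u.

Lemma sylvester_eq_step (K : fieldType) (n : nat) (x : 'M[K]_n) S T z u r :
  sylvester_eq x S T z u -> sylvester_eq x S T z (u *m (x *m pr K T - r%:M)).
Proof.
move=> [uST ux].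
have Su : pr K S *m u = u by rewrite -uST !mulmxA pr_id.
have uT : u *m pr K T = u by rewrite -uST -!mulmxA pr_id.
have YT : x *m pr K T *m pr K T = x *m pr K T by rewrite -mulmxA pr_id.
rewrite /sylvester_eq; move: (x *m pr K T) YT ux => Y YT ux.
split.
  rewrite mulmxBr mul_mx_scalar !mulmxBr mulmxBl -!scalemxAr -scalemxAl !mulmxA Su.
  by rewrite -[u *m Y *m _]mulmxA YT uT.
have cY : (Y - r%:M) *m Y = Y *m (Y - r%:M).
  by rewrite mulmxBl mulmxBr mul_scalar_mx mul_mx_scalar.
by rewrite -[u *m _ *m Y]mulmxA cY !mulmxA -mulmxBl ux -scalemxAl.
Qed.

Lemma sylvester_spec (K : numClosedFieldType) (n : nat) (x : 'M[K]_n) S T z u :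
  u != 0 -> pr K S *m u *m pr K T = u ->
  pr K S *m x *m u - u *m x *m pr K T = z *: u ->
  exists e w, [/\ bspec x S e, bspec x T w & z = e - w].
Proof.
move=> u0 uST ux.
have {uST ux} hu : sylvester_eq x S T z u by split; rewrite ?mulmxA.
have [v [r [[vST vx] v0 vY]]] : exists v r,
    [/\ sylvester_eq x S T z v, v != 0 & v *m (x *m pr K T) = r *: v].
  by apply: (stable_eigen hu u0) => w r; apply: sylvester_eq_step.
have vx' : pr K S *m x *m v = (z + r) *: v.
  by rewrite scalerDl -vY -vx subrK.
have /matrix0Pn[i [j vij]] := v0.
exists (z + r), r; split; last by rewrite addrK.
- apply/bspec_right; exists (col j v); split.
  + by apply/cV0Pn; exists i; rewrite mxE.
  + by rewrite colE mulmxA -{1}vST !mulmxA pr_id vST.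
  + by rewrite colE mulmxA vx' scalemxAl.
apply/bspec_left; exists (row i v); split.
- by apply/rV0Pn; exists j; rewrite mxE.
- by rewrite -row_mul -{1}vST -mulmxA pr_id vST.
- by rewrite -!row_mul -mulmxA vY linearZ.
Qed.

Lemma left_inverse_on (K : fieldType) (n : nat) (S : {set 'I_n}) (u : 'M[K]_n) :
  (forall v : 'cV_n, pr K S *m v = v -> u *m v = 0 -> v = 0) -> u *m pr K S = u ->
  exists th, th *m u = pr K S.
Proof.
move=> hu uS; suff /submxP[th ->] : (pr K S <= u)%MS by exists th.
rewrite submxE; apply/eqP/matrixP => i j; rewrite [RHS]mxE.
have := hu (pr K S *m col j (cokermx u)).
rewrite (mulmxA (pr K S)) pr_id (mulmxA u) uS => /(_ erefl) h.
have /h/matrixP/(_ i 0) : u *m col j (cokermx u) = 0.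
  by rewrite colE (mulmxA u) mulmx_coker mul0mx.
by rewrite colE (mulmxA (pr K S)) -colE mxE [RHS]mxE.
Qed.

Lemma chain_mul (K : fieldType) (n : nat) (r : rel 'I_n) (u v : 'M[K]_n) :
  transitive r -> (forall i j, u i j != 0 -> r i j) ->
  (forall i j, v i j != 0 -> r i j) ->
  forall i j, (u *m v) i j != 0 -> r i j.
Proof.
move=> tr hu hv i j; apply: contraNT => nr; rewrite mxE big1 // => k _.
have [->|uik] := eqVneq (u i k) 0; first by rewrite mul0r.
have [->|vkj] := eqVneq (v k j) 0; first by rewrite mulr0.
by case/negP: nr; apply: tr (hu _ _ uik) (hv _ _ vkj).
Qed.

(* Column operations respecting the order [q] bring [phi] to a matrix with zero
   columns in [S] and linearly independent columns in [E :\: S]. *)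
Lemma column_reduction (K : fieldType) (n : nat) (q : 'I_n -> nat)
    (E : {set 'I_n}) (phi : 'M[K]_n) : phi *m pr K E = phi ->
  exists k l : 'M[K]_n, [/\ pr K E *m k *m pr K E = k, pr K E *m l *m pr K E = l,
      k *m l = pr K E & l *m k = pr K E] /\
    [/\ forall i j, k i j != 0 -> (q j <= q i)%N,
        forall i j, l i j != 0 -> (q j <= q i)%N &
    exists (S : {set 'I_n}) (th : 'M[K]_n), [/\ S \subset E, phi *m k *m pr K S = 0 &
                     th *m (phi *m k) = pr K (E :\: S)]].
Proof.
have [m] := ubnP #|[set j in E | col j phi != 0]|.
elim: m phi => // m IH phi; rewrite ltnS => hm phiE.
pose S := [set j in E | col j phi == 0].
have SE : S \subset E by apply/subsetP => j; rewrite inE => /andP[].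
have phiS : phi *m pr K S = 0.
  apply/matrixP => i j; rewrite mul_prE [RHS]mxE inE.
  by case: ifP => // /andP[_ /eqP/matrixP/(_ i 0)]; rewrite !mxE.
have phiES : phi *m pr K (E :\: S) = phi.
  by rewrite pr_setD // mulmxBr phiE phiS subr0.
have [[v [v0 vS phiv]]|nex] := pselect (exists v : 'cV[K]_n,
    [/\ v != 0, pr K (E :\: S) *m v = v & phi *m v = 0]); last first.
  exists (pr K E), (pr K E); rewrite !pr_id; split=> //; split.
  - by move=> i j; rewrite prE; case: (i =P j) => [->|]; rewrite ?eqxx.
  - by move=> i j; rewrite prE; case: (i =P j) => [->|]; rewrite ?eqxx.
  rewrite phiE; case: (left_inverse_on (S := E :\: S) (u := phi)) => //.
    move=> v vS phiv; apply/eqP; apply: contra_notT nex => v0; exists v; split=> //.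
  by move=> th thE; exists S, th.
have [i0 vi0] : exists i, v i 0 != 0 by apply/cV0Pn.
(* The relation [v] is solved for its column of least [q]: the column operation then adds to it only
   columns of larger or equal [q], which is the shape demanded of [k]. *)
have [j0 vj0 qmin] : exists2 j0, v j0 0 != 0 & forall j, v j 0 != 0 -> (q j0 <= q j)%N.
  by case: (@arg_minnP _ i0 (fun i => v i 0 != 0) q vi0) => j0; exists j0.
have suppv j : v j 0 != 0 -> j \in E :\: S.
  by rewrite -{1}vS pr_mulE; case: ifP; rewrite ?eqxx.
have j0E : j0 \in E by have := suppv _ vj0; rewrite inE => /andP[].
pose e : 'rV[K]_n := delta_mx 0 j0.
pose a := (v j0 0)^-1 *: v - delta_mx j0 0.
have ea : e *m a = 0.
  rewrite -rowE; apply/matrixP => i j; rewrite !mxE !eqxx ord1 eqxx /=.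
  by rewrite mulVf ?subrr.
have eE : e *m pr K E = e.
  apply: pr_cols => i j; rewrite mxE; case: (j =P j0) => [->|] //.
  by rewrite andbF eqxx.
have suppa j : a j 0 != 0 -> j \in E /\ (q j0 <= q j)%N.
  rewrite !mxE eqxx andbT; case: (j =P j0) => [-> //|_]; rewrite subr0.
  rewrite mulf_eq0 negb_or => /andP[_ vj]; split; last exact: qmin.
  by have := suppv _ vj; rewrite inE => /andP[].
have Ea : pr K E *m a = a.
  by apply: pr_rows => i j; rewrite ord1 => /suppa[].
have phia : phi *m a = - (phi *m delta_mx j0 0).
  by rewrite mulmxBr -scalemxAr phiv scaler0 sub0r.
clearbody a.
(* As [a] has no entry at [j0], the matrix [a *m e] squares to zero, so [k1] and [l1] are inverse to
   each other on [E]. Column [j0] of [phi *m k1] is a multiple of [phi *m v], that is zero, and the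
   other columns are those of [phi]. *)
pose k1 := pr K E + a *m e; pose l1 := pr K E - a *m e.
have aeae : a *m e *m (a *m e) = 0 by rewrite -mulmxA (mulmxA e) ea mul0mx mulmx0.
have Eae : pr K E *m (a *m e) = a *m e by rewrite mulmxA Ea.
have aeE : a *m e *m pr K E = a *m e by rewrite -mulmxA eE.
have k1l1 : k1 *m l1 = pr K E.
  by rewrite /k1 /l1 mulmxBr !mulmxDl pr_id Eae aeE aeae addr0 addrK.
have l1k1 : l1 *m k1 = pr K E.
  by rewrite /k1 /l1 mulmxDr !mulmxBl pr_id Eae aeE aeae subr0 subrK.
have k1E : pr K E *m k1 *m pr K E = k1.
  by rewrite /k1 mulmxDr mulmxDl !pr_id Eae aeE.
have l1E : pr K E *m l1 *m pr K E = l1.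
  by rewrite /l1 mulmxBr mulmxBl !pr_id Eae aeE.
have aeq i j : (a *m e) i j != 0 -> (q j <= q i)%N.
  rewrite mxE big_ord1 mulf_eq0 negb_or => /andP[/suppa[_ qi]].
  by rewrite mxE; case: (j =P j0) => [->|]; rewrite ?andbF ?eqxx.
have k1q i j : k1 i j != 0 -> (q j <= q i)%N.
  rewrite /k1 mxE prE; case: (i =P j) => [-> //|_] /=; rewrite add0r; exact: aeq.
have l1q i j : l1 i j != 0 -> (q j <= q i)%N.
  rewrite /l1 mxE prE; case: (i =P j) => [-> //|_] /=; rewrite add0r mxE oppr_eq0; exact: aeq.
have phik1 : phi *m k1 = phi - phi *m delta_mx j0 0 *m e.
  by rewrite /k1 mulmxDr phiE mulmxA phia mulNmx.
have colk1 j : col j (phi *m k1) = if j == j0 then 0 else col j phi.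
  rewrite phik1 linearB /= !colE -!mulmxA.
  have -> : e *m (delta_mx j 0 : 'cV_n) = (j == j0)%:R%:M.
    by apply/matrixP => i k; rewrite !ord1 -colE !mxE eqxx /= mulr1n.
  rewrite mul_mx_scalar; case: eqP => [->|_]; first by rewrite scale1r subrr.
  by rewrite scale0r mulmx0 subr0.
have trq : transitive [rel i j : 'I_n | (q j <= q i)%N].
  by move=> j i h /= ij jh; apply: leq_trans jh ij.
have k1E' : k1 *m pr K E = k1 by rewrite -k1E -!mulmxA pr_id.
have k1E'' : pr K E *m k1 = k1 by rewrite -k1E !mulmxA pr_id.
have l1E' : pr K E *m l1 = l1 by rewrite -l1E !mulmxA pr_id.
have l1E'' : l1 *m pr K E = l1 by rewrite -l1E -!mulmxA pr_id.
have count_lt : (#|[set j in E | col j (phi *m k1) != 0%R]| < m)%N.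
  apply: leq_trans hm; apply: proper_card; apply/properP; split.
    apply/subsetP => j; rewrite !inE colk1; case: (j =P j0); rewrite ?eqxx ?andbF //.
  exists j0; first by have := suppv _ vj0; rewrite !inE j0E /= andbT.
  by rewrite inE colk1 !eqxx andbF.
have [|k [l [[kE lE kl lk] [kq lq [S' [th [S'E phikS' thk]]]]]]] := IH (phi *m k1) count_lt.
  by rewrite -mulmxA k1E'.
have kE' : pr K E *m k = k by rewrite -kE !mulmxA pr_id.
have lE' : l *m pr K E = l by rewrite -lE -!mulmxA pr_id.
exists (k1 *m k), (l *m l1); split; split.
- by rewrite mulmxA k1E'' -mulmxA -kE -!mulmxA pr_id.
- by rewrite -!mulmxA l1E'' mulmxA -lE !mulmxA pr_id.
- by rewrite -mulmxA (mulmxA k) kl l1E' k1l1.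
- by rewrite -mulmxA (mulmxA l1) l1k1 kE' lk.
- exact: (chain_mul trq k1q kq).
- exact: (chain_mul trq lq l1q).
by exists S', th; rewrite !mulmxA in phikS' thk *; split.
Qed.

(** * Seaweed algebras of sparse matrices *)

Section Seaweed.
Variables (K : fieldType) (n : nat).
Implicit Types (J : {set 'I_n}) (p q : 'I_n -> nat) (f u v x : 'M[K]_n) (z : K).

Definition sw J p q u : Prop := forall i j, u i j != 0 ->
  [/\ i \in J, j \in J, (p i <= p j)%N & (q j <= q i)%N].

(* The index form of [P + P' = sl]. *)
Definition compat J p q : Prop := forall i j, i \in J -> j \in J ->
  (p i < p j)%N -> (q i <= q j)%N.

(* The algebra [sw J p q] contains the scalars [c *: pr K J], which are central:
   nondegeneracy on the trace-zero part means that the radical is reduced to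
   them. *)
Definition frob J p q f : Prop := forall u, sw J p q u ->
  (forall v, sw J p q v -> \tr (f *m lie_br u v) = 0) -> exists c, u = c *: pr K J.

Definition princ J p q f x : Prop := sw J p q x /\
  forall v, sw J p q v -> \tr (f *m lie_br x v) = \tr (f *m v).

Definition swspec J p q x z : Prop :=
  exists u, [/\ sw J p q u, u != 0 & lie_br x u = z *: u].

Lemma swD J p q u v : sw J p q u -> sw J p q v -> sw J p q (u + v).
Proof.
move=> hu hv i j; rewrite mxE; have [->|/hu //] := eqVneq (u i j) 0.
by rewrite add0r => /hv.
Qed.

Lemma swZ J p q c u : sw J p q u -> sw J p q (c *: u).
Proof. by move=> hu i j; rewrite mxE mulf_eq0 negb_or => /andP[_ /hu]. Qed.

Lemma swB J p q u v : sw J p q u -> sw J p q v -> sw J p q (u - v).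
Proof. by move=> hu hv; rewrite -scaleN1r; apply: swD => //; apply: swZ. Qed.

Lemma sw_mul J p q u v : sw J p q u -> sw J p q v -> sw J p q (u *m v).
Proof.
move=> hu hv i j.
have [k /andP[/hu[iJ kJ pik qki] /hv[_ jJ pkj qjk]] _|h] :=
    pickP (fun k => (u i k != 0) && (v k j != 0)).
  by split; rewrite ?(leq_trans pik) // (leq_trans qjk).
rewrite mxE big1 ?eqxx // => k _; apply/eqP; rewrite mulf_eq0.
by have := h k; case: (u i k == 0); case: (v k j == 0).
Qed.

Lemma sw_br J p q u v : sw J p q u -> sw J p q v -> sw J p q (lie_br u v).
Proof. by move=> hu hv; apply: swB; apply: sw_mul. Qed.

Lemma sw_pr J p q (S : {set 'I_n}) : S \subset J -> sw J p q (pr K S).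
Proof.
move=> /subsetP SJ i j; rewrite prE; case: (i =P j) => [<-|_]; last by rewrite eqxx.
by case: (boolP (i \in S)) => [/SJ|_]; rewrite ?eqxx.
Qed.

Lemma sw_corner J p q u : sw J p q u -> pr K J *m u = u /\ u *m pr K J = u.
Proof. by move=> hu; split; [apply: pr_rows|apply: pr_cols] => i j /hu[]. Qed.

Lemma mxtr_br f u v : \tr (f *m lie_br u v) = \tr (f *m u *m v) - \tr (f *m v *m u).
Proof. by rewrite /lie_br mulmxBr linearB /= !mulmxA. Qed.

Lemma mxtr_brl f u v : \tr (f *m lie_br u v) = \tr (lie_br f u *m v).
Proof.
rewrite mxtr_br /lie_br mulmxBl linearB /=; congr (_ - _).
by rewrite mxtrace_mulC mulmxA.
Qed.

Lemma pr_delta (S : {set 'I_n}) i j : i \in S -> pr K S *m (delta_mx i j : 'M_n) = delta_mx i j.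
Proof.
by move=> iS; apply: pr_rows => k l; rewrite mxE; case: (k =P i) => [->|]; rewrite ?eqxx.
Qed.

Lemma delta_pr (S : {set 'I_n}) i j : j \in S -> (delta_mx i j : 'M_n) *m pr K S = delta_mx i j.
Proof.
move=> iS; apply: pr_cols => k l; rewrite mxE.
by case: (l =P j) => [->|]; rewrite ?andbF ?eqxx.
Qed.

Lemma mxtr_delta i j u : \tr (delta_mx i j *m u) = u j i.
Proof.
rewrite /mxtrace (bigD1 i) //= big1 ?addr0; last first.
  move=> k /negPf ki; rewrite mxE big1 // => l _.
  by rewrite mxE ki mul0r.
rewrite mxE (bigD1 j) //= big1 ?addr0; first by rewrite mxE !eqxx mul1r.
by move=> k /negPf kj; rewrite mxE kj andbF mul0r.
Qed.

Lemma lie_brDl u v x : lie_br (u + v) x = lie_br u x + lie_br v x.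
Proof. by rewrite /lie_br mulmxDl mulmxDr opprD addrACA. Qed.

Lemma lie_brZl c u x : lie_br (c *: u) x = c *: lie_br u x.
Proof. by rewrite /lie_br -scalemxAl -scalemxAr scalerBr. Qed.

Lemma lie_jacobi x u v :
  lie_br x (lie_br u v) = lie_br (lie_br x u) v + lie_br u (lie_br x v).
Proof.
rewrite /lie_br !(mulmxBr, mulmxBl) !mulmxA.
move: (x *m u *m v) (x *m v *m u) (u *m v *m x) (v *m u *m x) (u *m x *m v) (v *m x *m u).
by move=> m1 m2 m3 m4 m5 m6; apply/matrixP => i j; rewrite !mxE; ring.
Qed.

Lemma mxtr_brD f u v x :
  \tr (f *m lie_br (u + v) x) = \tr (f *m lie_br u x) + \tr (f *m lie_br v x).
Proof. by rewrite lie_brDl mulmxDr linearD. Qed.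

Lemma mxtr_brC f u v : \tr (f *m lie_br u v) = - \tr (f *m lie_br v u).
Proof. by rewrite lie_brC mulmxN linearN. Qed.

Lemma sw_proj J p q : exists pi : 'End('M[K]_n),
  (forall u, sw J p q u <-> pi u = u) /\ (forall u, pi (pi u) = pi u).
Proof.
pose ok i j := [&& i \in J, j \in J, (p i <= p j)%N & (q j <= q i)%N].
pose h u : 'M[K]_n := \matrix_(i, j) (if ok i j then u i j else 0).
have hl : linear h.
  by move=> c u v; apply/matrixP => i j; rewrite !mxE; case: ifP => // _; rewrite mulr0 addr0.
pose H := GRing.isLinear.Build K 'M[K]_n 'M[K]_n *:%R h hl.
pose h' : {linear 'M[K]_n -> 'M[K]_n} := HB.pack h H.
exists (linfun h'); split=> u; rewrite !lfunE /=; last first.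
  by apply/matrixP => i j; rewrite !mxE; case: (ok i j).
split=> [hu|<- i j]; last by rewrite mxE; case: ifP => [/and4P[]|]; rewrite ?eqxx.
apply/matrixP => i j; rewrite mxE; case: ifPn => // nok.
by case: (eqVneq (u i j) 0) => // /hu[iJ jJ pij qji]; case/negP: nok; apply/and4P.
Qed.

Lemma sw_factor J p q (m : 'M[K]_n) (h : {linear 'M[K]_n -> 'M[K]_n}) :
  (forall u, sw J p q u -> h u = 0 -> \tr (m *m u) = 0) ->
  exists m', forall u, sw J p q u -> \tr (m *m u) = \tr (m' *m h u).
Proof.
move=> mh; have [pi [swpi piK]] := sw_proj J p q.
pose mt (u : 'M[K]_n) : K^o := \tr (m *m u).
have mtl : linear mt by move=> c u v; rewrite /mt mulmxDr -scalemxAr !linearE.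
pose H := GRing.isLinear.Build K 'M[K]_n K^o *:%R mt mtl.
pose mt' : {linear 'M[K]_n -> K^o} := HB.pack mt H.
case: (@fixed_factor _ _ _ pi (linfun mt') (linfun h) piK).
  by move=> v /swpi hv; rewrite !lfunE /=; apply: mh.
move=> l hl; have [|m' hm'] := @mxtr_formP K n l; first exact: linearP.
by exists m' => u /swpi /hl; rewrite !lfunE /= hm'.
Qed.

End Seaweed.

(** If [1 - z] were not an eigenvalue, [ad x - (1 - z)] would be onto, and invariance of the
    Kirillov form would put every [z]-eigenvector into the radical, that is among the scalars. The
    element [m] excludes the algebra of scalars, where 0 is an eigenvalue and 1 is not. *)
Lemma swspec_sym (K : fieldType) (n : nat) (J : {set 'I_n}) p q
    (f x m : 'M[K]_n) z :
  frob J p q f -> princ J p q f x -> sw J p q m -> (forall c, m <> c *: pr K J) ->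
  swspec J p q x z -> swspec J p q x (1 - z).
Proof.
move=> fP [hx xP] hm mns [u [hu u0 xu]].
have prJ v : sw J p q v -> lie_br v (pr K J) = 0.
  by move=> /sw_corner[Jv vJ]; rewrite /lie_br Jv vJ subrr.
(* A nonscalar eigenvector is needed. For [z != 0] any eigenvector will do, since scalars commute
   with the algebra. For [z = 0] take [x]: were it scalar, [f] would vanish on all brackets and [m]
   would lie in the radical. *)
have [v [hv xv vns]] : exists v, [/\ sw J p q v, lie_br x v = z *: v &
    forall c, v <> c *: pr K J].
  have [z0|z0] := eqVneq z 0; last first.
    exists u; split=> // c uc; move: xu; rewrite {1}uc linearZ /= prJ // scaler0.
    by move/eqP; rewrite eq_sym scaler_eq0 (negPf z0) (negPf u0).
  exists x; split=> //; first by rewrite /lie_br subrr z0 scale0r.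
  move=> c xc; have [v hv|d] := fP _ hm; last exact: mns.
  rewrite -xP; last exact: sw_br.
  by rewrite mxtr_brC xc linearZ /= prJ ?scaler0 ?mulmx0 ?linear0 ?oppr0 //; apply: sw_br.
have [pi [swpi piK]] := sw_proj K J p q.
pose h : 'End('M[K]_n) := linfun (lie_br x) - (1 - z) *: \1%VF.
have hE w : h w = lie_br x w - (1 - z) *: w.
  by rewrite add_lfunE opp_lfunE scale_lfunE id_lfunE lfunE.
have [[w [hw w0 xw]]|nex] := pselect (exists w, [/\ sw J p q w, w != 0
    & lie_br x w = (1 - z) *: w]); first by exists w.
have [w hw|c] := fP v hv; last by move/vns.
have [w' /swpi hw'|w' /swpi hw'||w1 /swpi hw1 w1E] := @fixed_surj _ _ pi h piK _ _ w.
- by apply/swpi; rewrite hE; apply: swB; [apply: sw_br|apply: swZ].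
- rewrite hE => /eqP; rewrite subr_eq0 => /eqP xw'; apply/eqP.
  by apply: contra_notT nex => w'0; exists w'.
- exact/swpi.
rewrite -w1E hE mxtr_brC lie_brDl.
have := xP _ (sw_br hv hw1); rewrite lie_jacobi xv lie_brZl mulmxDr linearD /=.
rewrite -scalemxAr linearZ /=.
have -> : lie_br (- ((1 - z) *: w1)) v = (1 - z) *: lie_br v w1.
  by rewrite -scaleNr lie_brZl lie_brC scalerN scaleNr opprK.
have mxtrD g h' : \tr (f *m (g + h')) = \tr (f *m g) + \tr (f *m h').
  by rewrite mulmxDr linearD.
have mxtrZ c g : \tr (f *m (c *: g)) = c * \tr (f *m g).
  by rewrite -scalemxAr linearZ.
rewrite (mxtrD (lie_br (lie_br x w1) v)) mxtrZ.
rewrite [\tr (f *m lie_br (lie_br x w1) v)]mxtr_brC.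
set s := \tr (f *m lie_br v w1); set t := \tr _ => st.
have -> : t = s - z * s by rewrite -[X in _ = X - _]st; ring.
ring.
Qed.

(** * Intervals of integers *)

Definition cvx (P : int -> Prop) : Prop :=
  forall a b c, P a -> P b -> a <= c <= b -> P c.

Lemma cvx_eq (P Q : int -> Prop) : (forall k, P k <-> Q k) -> cvx P -> cvx Q.
Proof. by move=> PQ cP a b c /PQ Pa /PQ Pb /(cP _ _ _ Pa Pb)/PQ. Qed.

Lemma cvx_or (P Q : int -> Prop) s t : cvx P -> cvx Q -> P s -> Q t ->
  s - 1 <= t <= s + 1 -> cvx (fun k => P k \/ Q k).
Proof.
move=> cP cQ Ps Qt st a b c ha hb abc.
have [Pc|nP] := pselect (P c); [by left|right].
have nPs d : P d -> d != c by move=> Pd; apply/eqP => dc; rewrite dc in Pd.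
have nP1 d d' : P d -> P d' -> ~ (d <= c <= d') by move=> Pd Pd' /(cP _ _ _ Pd Pd').
have nPP d : P d -> d < c /\ s < c \/ c < d /\ c < s.
  move=> Pd; have := nPs _ Pd; have := nPs _ Ps; have := nP1 _ _ Pd Ps.
  by have := nP1 _ _ Ps Pd; lia.
case: ha hb => [/nPP Pa|Qa] [/nPP Pb|Qb].
- by exfalso; lia.
- by apply: (cQ t b) => //; have := nPs _ Ps; lia.
- by apply: (cQ a t) => //; have := nPs _ Ps; lia.
- exact: (cQ a b).
Qed.

(** Each intermediate value is reached by moving one of the two arguments while the other stays at
    an end point; which one moves depends on the position of [m] relative to [c2 - d1] and on the
    order of [c1] and [c2]. *)
Lemma cvx_sub (P Q : int -> Prop) : cvx P -> cvx Q ->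
  cvx (fun k => exists c d, [/\ P c, Q d & k = c - d]).
Proof.
move=> cP cQ a b m [c1 [d1 [Pc1 Qd1 ->]]] [c2 [d2 [Pc2 Qd2 ->]]] h.
have [h1|h1] := lerP m (c2 - d1).
  have [h2|h2] := lerP c1 c2.
    by exists (m + d1), d1; split=> //; [apply: (cP c1 c2) => //|]; lia.
  by exists c1, (c1 - m); split=> //; [apply: (cQ d2 d1) => //|]; lia.
have [h2|h2] := lerP c1 c2.
  by exists c2, (c2 - m); split=> //; [apply: (cQ d2 d1) => //|]; lia.
by exists c1, (c1 - m); split=> //; [apply: (cQ d2 d1) => //|]; lia.
Qed.

(** For each fixed [c] the differences form an interval, and it contains 1, reached at [d = c - 1]
    because [P] lies in [Q]. All these intervals meet at 1. *)
Lemma cvx_subset_sub (P Q : int -> Prop) : cvx Q -> (forall k, P k -> Q k) ->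
  cvx (fun k => exists c d, [/\ P c, Q (d + 1) & k = c - d]).
Proof.
move=> cQ PQ a b m [c1 [d1 [Pc1 Qd1 ->]]] [c2 [d2 [Pc2 Qd2 ->]]] h.
have [h1|h1] := lerP m 1.
  exists c1, (c1 - m); split=> //; [|lia].
  by apply: (cQ c1 (d1 + 1)) => //; [exact: PQ|lia].
exists c2, (c2 - m); split=> //; [|lia].
by apply: (cQ (d2 + 1) c2) => //; [exact: PQ|lia].
Qed.

(** At most one element of [P] lies outside the shifted [Q], the greatest element of [Q], and it
    follows the shifted interval immediately. *)
Lemma cvx_shift_or (P Q : int -> Prop) : cvx Q -> (forall k, P k -> Q k) ->
  cvx (fun k => Q (k + 1) \/ P k).
Proof.
move=> cQ PQ k1 k2 c h1 h2 h; have [Qc|nQ] := pselect (Q (c + 1)); [by left|right].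
have [t [Qt tc]] : exists t, Q t /\ t <= c + 1.
  by case: h1 => h1; [exists (k1 + 1)|exists k1]; split=> //; [lia|exact: PQ|lia].
have nQs s : Q s -> s <= c.
  move=> Qs; rewrite leNgt; apply/negP => c_lt; apply: nQ.
  by apply: (cQ t s) => //; lia.
case: h2 => [/nQs|h2]; first by lia.
by have := nQs _ (PQ _ h2) => k2c; have <- : k2 = c by lia.
Qed.

Lemma cvx_succ (P : int -> Prop) s t : cvx P -> P s -> P t -> s < t -> P (s + 1).
Proof. by move=> cP Ps Pt st; apply: (cP s t) => //; lia. Qed.

Lemma cvx_opp (P : int -> Prop) s : cvx P -> cvx (fun k => P (s - k)).
Proof. by move=> cP a b c Pa Pb h; apply: (cP _ _ _ Pb Pa); lia. Qed.

Lemma cvx_shift (P : int -> Prop) s : cvx P -> cvx (fun k => P (k + s)).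
Proof. by move=> cP a b c Pa Pb h; apply: (cP _ _ _ Pa Pb); lia. Qed.

(** * The induction invariant *)

Section Good.
Variables (K : numClosedFieldType) (n : nat).
Implicit Types (J S : {set 'I_n}) (p q : 'I_n -> nat) (f u x : 'M[K]_n).

Definition blk J p i : {set 'I_n} := [set j in J | p j == p i].

(* [D S k] stands for: the diagonal block at [S] has eigenvalue [z0 + k].  The
   last clause compares the two blocks of an index that is minimal for both
   orders. *)
Definition half J p q (D : {set 'I_n} -> int -> Prop) : Prop :=
  [/\ forall i, i \in J -> cvx (D (blk J p i)),
      forall i j, i \in J -> j \in J -> (p i < p j)%N ->
        exists k, D (blk J p i) (k + 1) /\ D (blk J p j) k &
      forall i, i \in J -> (forall j, j \in J -> (p i <= p j)%N /\ (q i <= q j)%N) ->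
        blk J p i :\: blk J q i != set0 -> forall k, D (blk J q i) k ->
        exists k', k < k' /\ D (blk J p i :\: blk J q i) k'].

(** Passing from [x] to [- x^T] exchanges [p] and [q] and negates eigenvalues, hence the sign in the
    second [half]. One base point [z0] serves all blocks, so that differences between eigenvalues of
    different blocks are integers. The fourth clause links [p]-blocks to [q]-blocks, as the second
    clause of [half] links the blocks of one order. *)
Definition good J p q x : Prop := exists z0 : K,
  [/\ forall i z, i \in J -> bspec x (blk J p i) z \/ bspec x (blk J q i) z ->
        exists k : int, z = z0 + k%:~R,
      half J p q (fun S k => bspec x S (z0 + k%:~R)),
      half J q p (fun S k => bspec x S (z0 + (- k)%:~R)),
      forall i j, i \in J -> j \in J -> exists k : int,
        bspec x (blk J p i) (z0 + k%:~R) /\ bspec x (blk J q j) (z0 + k%:~R) &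
      (forall z, swspec J p q x z -> exists k : int, z = k%:~R) /\
      cvx (fun k => swspec J p q x k%:~R)].

Lemma half_ext J p q (D D' : {set 'I_n} -> int -> Prop) :
  (forall i k, i \in J -> D (blk J p i) k <-> D' (blk J p i) k) ->
  (forall i k, i \in J -> (forall j, j \in J -> (p i <= p j)%N /\ (q i <= q j)%N) ->
     D (blk J p i :\: blk J q i) k <-> D' (blk J p i :\: blk J q i) k) ->
  (forall i k, i \in J -> D (blk J q i) k <-> D' (blk J q i) k) ->
  half J p q D -> half J p q D'.
Proof.
move=> hp hd hq [h1 h2 h3]; split.
- by move=> i iJ; apply: cvx_eq (h1 i iJ) => k; apply: hp.
- move=> i j iJ jJ pij; have [k [/hp ki /hp kj]] := h2 i j iJ jJ pij.
  by exists k; split; [apply: ki|apply: kj].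
- move=> i iJ imin ne k /hq kq; have [k' [kk' /hd k'd]] := h3 i iJ imin ne k (kq iJ).
  by exists k'; split=> //; apply: k'd.
Qed.

Lemma sw_tr J p q u : sw J p q u -> sw J q p u^T.
Proof. by move=> hu i j; rewrite mxE => /hu[]. Qed.

Lemma lie_br_tr u x : lie_br (- x^T) u^T = (lie_br x u)^T.
Proof. by rewrite /lie_br linearB /= !trmx_mul mulNmx mulmxN opprK addrC. Qed.

Lemma frob_tr J p q f : frob J p q f -> frob J q p f^T.
Proof.
move=> fP u hu h; have [v hv|c uE] := fP u^T (sw_tr hu).
  have := h _ (sw_tr hv); rewrite -mxtrace_tr trmx_mul trmxK mxtrace_mulC -lie_br_tr.
  by rewrite trmxK -scaleN1r lie_brZl -scalemxAr linearZ /= mulN1r => /eqP; rewrite oppr_eq0 => /eqP.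
by exists c; rewrite -[u]trmxK uE linearZ /= tr_pr.
Qed.

Lemma princ_tr J p q f x : princ J p q f x -> princ J q p f^T (- x^T).
Proof.
move=> [hx xP]; split; first by rewrite -scaleN1r; apply/swZ/sw_tr.
move=> v hv; rewrite -[v]trmxK lie_br_tr -trmx_mul mxtrace_tr mxtrace_mulC.
rewrite xP; last exact: sw_tr.
by rewrite -trmx_mul mxtrace_tr mxtrace_mulC.
Qed.

Lemma swspec_tr J p q x z : swspec J q p (- x^T) z -> swspec J p q x z.
Proof.
move=> [u [hu u0 xu]]; exists u^T; split; [exact: sw_tr|by rewrite trmx_eq0|].
by apply: trmx_inj; rewrite -lie_br_tr trmxK xu linearZ /= trmxK.
Qed.

Lemma good_tr J p q x : good J q p (- x^T) -> good J p q x.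
Proof.
have bE S z : bspec (- x^T) S z = bspec x S (- z) by rewrite bspecN bspec_tr.
move=> [z0 [hZ hq hp hpq [hs cs]]]; exists (- z0).
have xE k : - (z0 + k%:~R) = - z0 + (- k)%:~R :> K by rewrite opprD mulrNz.
split.
- move=> i z iJ h; have [|k zE] := hZ i (- z) iJ.
    by rewrite !bE opprK; case: h; [right|left].
  by exists (- k); rewrite -xE -zE opprK.
- by apply: half_ext hp => i k *; rewrite bE xE opprK.
- by apply: half_ext hq => i k *; rewrite bE xE.
- move=> i j iJ jJ; have [k] := hpq j i jJ iJ; rewrite !bE xE.
  by move=> [h1 h2]; exists (- k).
have sE z : swspec J q p (- x^T) z <-> swspec J p q x z.
  split; first exact: swspec_tr.
  have {1}-> : x = - (- x^T)^T by rewrite linearN /= trmxK opprK.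
  exact: swspec_tr.
split; first by move=> z /sE/hs.
by apply: cvx_eq cs => k; apply: sE.
Qed.

(** Convexity for the preorder behind [sw]. It makes compression to the block at [S] multiplicative
    on the algebra ([interval_closed_mul]), so that conjugation inside the algebra preserves the
    eigenvalues of that block. *)
Definition interval_closed J p q S : Prop := S \subset J /\
  forall i j k, i \in S -> k \in S -> j \in J -> (p i <= p j <= p k)%N ->
    (q k <= q j <= q i)%N -> j \in S.

Lemma interval_closed_mul J p q S u x : interval_closed J p q S ->
  sw J p q u -> sw J p q x ->
  pr K S *m u *m pr K S *m x *m pr K S = pr K S *m u *m x *m pr K S.
Proof.
move=> [/subsetP SJ cS] hu hx; apply/matrixP => i k; rewrite !mul_prE.
case: ifP => // kS; rewrite !mxE.
under [RHS]eq_bigr => j _ do rewrite pr_mulE.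
apply: eq_bigr => j _; rewrite mul_prE pr_mulE.
case: (boolP (j \in S)) => // jS; case: ifP => iS; last by rewrite mul0r.
have [->|/hu[_ jJ pij qji]] := eqVneq (u i j) 0; first by rewrite !mul0r.
have [->|/hx[_ _ pjk qkj]] := eqVneq (x j k) 0; first by rewrite !mulr0.
by case/negP: jS; apply: (cS i j k) => //; apply/andP.
Qed.

Lemma bspec_conj J p q S u v x z : interval_closed J p q S ->
  sw J p q u -> sw J p q v -> sw J p q x -> v *m u = pr K J ->
  bspec x S z -> bspec (u *m x *m v) S z.
Proof.
move=> cS hu hv hx vu; have [SJ _] := cS; have [Jx xJ] := sw_corner hx.
rewrite -{2}[z]addr0.
apply: (bspec_transfer (a := pr K S *m u *m pr K S) (b := pr K S *m v *m pr K S)).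
- rewrite -!mulmxA (mulmxA (pr K S) (pr K S)) pr_id !mulmxA.
  rewrite (interval_closed_mul cS hv hu).
  by rewrite -[pr K S *m v *m u]mulmxA vu pr_sub // pr_id.
- by rewrite !mulmxA pr_id.
rewrite scale0r addr0 !mulmxA -[_ *m pr K S *m pr K S]mulmxA pr_id.
rewrite -[_ *m pr K S *m pr K S]mulmxA pr_id (interval_closed_mul cS hu hx).
have hw : sw J p q (u *m x *m v) by do 2!apply: sw_mul => //.
have := interval_closed_mul cS hw hu; rewrite !mulmxA => ->.
by rewrite -[_ *m v *m u]mulmxA vu -[_ *m x *m pr K J]mulmxA xJ.
Qed.

Lemma blk_closed J p q i : interval_closed J p q (blk J p i).
Proof.
split; first by apply/subsetP => j; rewrite inE => /andP[].
move=> j k l; rewrite !inE => /andP[_ /eqP->] /andP[_ /eqP->] -> h _.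
by rewrite eqn_leq andbC; case/andP: h => -> ->.
Qed.

Lemma blk_closed' J p q i : interval_closed J p q (blk J q i).
Proof.
split; first by apply/subsetP => j; rewrite inE => /andP[].
move=> j k l; rewrite !inE => /andP[_ /eqP->] /andP[_ /eqP->] -> _ h.
by rewrite eqn_leq andbC; case/andP: h => -> ->.
Qed.

Lemma blkD_closed J p q i : (forall j, j \in J -> (p i <= p j)%N /\ (q i <= q j)%N) ->
  interval_closed J p q (blk J p i :\: blk J q i).
Proof.
move=> imin; split.
  by apply/subsetP => j; rewrite !inE => /andP[_ /andP[]].
move=> j k l; rewrite !inE => /and3P[qj jJ /eqP pj] /and3P[ql lJ /eqP pl] kJ.
rewrite pj pl kJ /= andbC => /andP[pk pk'] /andP[qlk _].
rewrite [(p k == _)]eqn_leq pk pk' andbT; move: ql; rewrite lJ /=.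
by rewrite andbT; apply: contraNneq => qk; rewrite eqn_leq -{1}qk qlk; case: (imin _ lJ).
Qed.

Lemma blkD_closed' J p q i : (forall j, j \in J -> (p i <= p j)%N /\ (q i <= q j)%N) ->
  interval_closed J p q (blk J q i :\: blk J p i).
Proof.
move=> imin; split.
  by apply/subsetP => j; rewrite !inE => /andP[_ /andP[]].
move=> j k l; rewrite !inE => /and3P[pj jJ /eqP qj0] /and3P[pl lJ /eqP ql0] kJ.
rewrite qj0 ql0 kJ /= => /andP[pjk pkl] /andP[qk qk'].
rewrite [(q k == _)]eqn_leq qk qk' andbT; move: pj; rewrite jJ /=.
by rewrite andbT; apply: contraNneq => pk; rewrite eqn_leq -{1}pk pjk; case: (imin _ jJ).
Qed.

(** All the index sets whose eigenvalues enter into [good] are closed under intervals, so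
    [bspec_conj] applies to each of them, in both directions. *)
Lemma good_conj J p q u v x : sw J p q u -> sw J p q v -> sw J p q x ->
  u *m v = pr K J -> v *m u = pr K J -> good J p q x -> good J p q (u *m x *m v).
Proof.
move=> hu hv hx uv vu; have hw : sw J p q (u *m x *m v) by do 2!apply: sw_mul => //.
have [Jx xJ] := sw_corner hx.
have xE : v *m (u *m x *m v) *m u = x.
  by rewrite !mulmxA vu Jx -mulmxA vu xJ.
have bE S z : interval_closed J p q S -> bspec x S z <-> bspec (u *m x *m v) S z.
  move=> cS; split; first exact: (bspec_conj cS hu hv hx vu).
  by have := @bspec_conj J p q S v u (u *m x *m v) z cS hv hu hw uv; rewrite xE.
have brE w y : lie_br (u *m w *m v) (u *m y *m v) = u *m (w *m pr K J *m y - y *m pr K J *m w) *m v.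
  by rewrite /lie_br mulmxBr mulmxBl -vu !mulmxA.
have sE z : swspec J p q x z <-> swspec J p q (u *m x *m v) z.
  split=> [[w [hy w0 xw]]|[w [hy w0 xw]]]; have [Jw wJ] := sw_corner hy.
    exists (u *m w *m v); split; first by do 2!apply: sw_mul => //.
    - apply: contraNneq w0 => w0.
      have : v *m (u *m w *m v) *m u = w by rewrite !mulmxA vu Jw -mulmxA vu wJ.
      by rewrite w0 mulmx0 mul0mx => <-.
    by rewrite brE xJ wJ -/(lie_br x w) xw -scalemxAr -scalemxAl.
  have wE : u *m (v *m w *m u) *m v = w by rewrite !mulmxA uv Jw -mulmxA uv wJ.
  exists (v *m w *m u); split; first by do 2!apply: sw_mul => //.
    by apply: contraNneq w0 => w0; rewrite -wE w0 mulmx0 mul0mx.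
  move: xw; rewrite -{1}wE brE xJ.
  have [_ ->] := sw_corner (sw_mul (sw_mul hv hy) hu).
  rewrite -/(lie_br x _) => h; have := congr1 (fun m => v *m m *m u) h.
  rewrite -scalemxAr -scalemxAl !mulmxA vu -[_ *m v *m u]mulmxA vu.
  by have [-> ->] := sw_corner (sw_br hx (sw_mul (sw_mul hv hy) hu)).
move=> [z0 [hZ hp hq hpq [hs cs]]]; exists z0; split.
- move=> i z iJ h; apply: (hZ i z iJ).
  case: h => h; [left|right]; first exact: (bE _ _ (blk_closed J p q i)).2.
  exact: (bE _ _ (blk_closed' J p q i)).2.
- apply: half_ext hp => i k iJ; first exact: (bE _ _ (blk_closed J p q i)).
    by move=> imin; apply: (bE _ _ (blkD_closed imin)).
  exact: (bE _ _ (blk_closed' J p q i)).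
- apply: half_ext hq => i k iJ; first exact: (bE _ _ (blk_closed' J p q i)).
    move=> imin; apply: (bE _ _ (blkD_closed' _)) => j jJ.
    by split; case: (imin j jJ).
  exact: (bE _ _ (blk_closed J p q i)).
- move=> i j iJ jJ; have [k [h1 h2]] := hpq i j iJ jJ; exists k.
  split; first exact: (bE _ _ (blk_closed J p q i)).1.
  exact: (bE _ _ (blk_closed' J p q j)).1.
split; first by move=> z /sE/hs.
by apply: cvx_eq cs => k; apply: sE.
Qed.

End Good.

Opaque bspec pr.

(** * Base case and combinatorics of the inductive step *)

Section Induction.
Variables (K : numClosedFieldType) (n : nat).
Implicit Types (J S : {set 'I_n}) (p q : 'I_n -> nat) (f u x : 'M[K]_n).

Lemma bspec_set1 x i z : bspec x [set i] z <-> z = x i i.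
Proof.
have xi : pr K [set i] *m x *m pr K [set i] = x i i *: pr K [set i].
  apply/matrixP => k l; rewrite mul_prE pr_mulE mxE prE !inE.
  case: (k =P i) => [->|_]; last by rewrite andbF mulr0; case: ifP.
  by rewrite andbT [i == l]eq_sym; case: (l =P i) => [->|]; rewrite ?mulr1 ?mulr0.
split=> [/bspec_left[v [v0 vS vx]]|->].
  have : z *: v = x i i *: v by rewrite -vx -{1}vS -!mulmxA (mulmxA (pr K _)) xi -scalemxAr vS.
  by move/eqP; rewrite -subr_eq0 -scalerBl scaler_eq0 (negPf v0) orbF subr_eq0 => /eqP.
apply/bspec_left; exists (delta_mx 0 i).
have dS : (delta_mx 0 i : 'rV[K]_n) *m pr K [set i] = delta_mx 0 i.
  apply: pr_cols => k l; rewrite mxE inE; case: (l =P i) => // _.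
  by rewrite andbF eqxx.
split=> //; last by rewrite -{1}dS -!mulmxA (mulmxA (pr K _)) xi -scalemxAr dS.
by apply/rV0Pn; exists i; rewrite mxE !eqxx oner_eq0.
Qed.

Let scal_diag c J i : (c *: pr K J) i i = c * (i \in J)%:R.
Proof. by rewrite mxE prE eqxx. Qed.

(** If the two minimal blocks coincide, the projection to this block commutes with the algebra; so
    it is scalar and the block is all of [J]. The algebra is then the full matrix algebra on [J],
    where the corner of [f] lies in the radical: it is scalar, the Kirillov form vanishes,
    everything is scalar and [J] is a singleton. *)
Lemma good_base J p q f x i0 : frob J p q f -> princ J p q f x -> i0 \in J ->
  (forall j, j \in J -> (p i0 <= p j)%N /\ (q i0 <= q j)%N) ->
  blk J p i0 = blk J q i0 -> good J p q x.
Proof.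
move=> fP [hx xP] i0J imin pq.
have AJ : blk J p i0 = J.
  have AJ : blk J p i0 \subset J by apply/subsetP => j; rewrite inE => /andP[].
  have [v hv|c cE] := fP _ (sw_pr p q AJ).
    suff -> : lie_br (pr K (blk J p i0)) v = 0 by rewrite mulmx0 linear0.
    apply/eqP; rewrite subr_eq0; apply/eqP/matrixP => i j; rewrite pr_mulE mul_prE.
    have [->|/hv[iJ jJ pij qji]] := eqVneq (v i j) 0; first by rewrite !if_same.
    congr (if _ then _ else _); apply/idP/idP => [|]; last first.
      rewrite !inE iJ => /andP[_ /eqP pj]; rewrite eqn_leq -{1}pj pij.
      by case: (imin i iJ).
    rewrite pq !inE jJ => /andP[_ /eqP qi]; rewrite eqn_leq -{1}qi qji.
    by case: (imin j jJ).
  apply/setP => j; apply/idP/idP => [/(subsetP AJ)//|jJ].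
  have := congr1 (fun m : 'M_n => m i0 i0) cE; have := congr1 (fun m : 'M_n => m j j) cE.
  rewrite !scal_diag !prE !eqxx jJ i0J /= !inE i0J jJ eqxx /= !mulr1 => + e0; rewrite -e0.
  by case: (p j == _) => // /eqP; rewrite eq_sym oner_eq0.
have pJ j : j \in J -> p j = p i0 by rewrite -{1}AJ inE => /andP[_ /eqP].
have qJ j : j \in J -> q j = q i0 by rewrite -{1}AJ pq inE => /andP[_ /eqP].
have swJ u : pr K J *m u *m pr K J = u -> sw J p q u.
  by move=> uJ i j /(corner_sup uJ)[iJ jJ]; rewrite !pJ ?qJ // qJ.
have [c fc] : exists c, pr K J *m f *m pr K J = c *: pr K J.
  apply: fP => [|v hv]; first by apply: swJ; rewrite !mulmxA pr_id -mulmxA pr_id.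
  have [Jv vJ] := sw_corner hv.
  rewrite mxtr_br !mulmxA -[_ *m pr K J *m v]mulmxA Jv -[f *m v *m pr K J]mulmxA vJ.
  by rewrite -[_ *m f *m pr K J]mulmxA [X in _ - X]mxtrace_mulC !mulmxA subrr.
have hscal u : sw J p q u -> exists d, u = d *: pr K J.
  move=> hu; apply: fP => // v hv; have [Jw wJ] := sw_corner (sw_br hu hv).
  rewrite -{1}wJ mulmxA mxtrace_mulC mulmxA -{1}Jw mulmxA fc -scalemxAl linearZ /= Jw.
  by rewrite linearB /= mxtrace_mulC subrr mulr0.
have J1 : J = [set i0].
  have [|d dE] := hscal (pr K [set i0]); first by apply: sw_pr; rewrite sub1set.
  apply/setP => j; apply/idP/idP => [jJ|]; last by rewrite inE => /eqP->.
  have := congr1 (fun m : 'M_n => m i0 i0) dE; have := congr1 (fun m : 'M_n => m j j) dE.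
  rewrite !scal_diag !prE !eqxx jJ i0J /= !inE eqxx /= !mulr1 => + e0; rewrite -e0.
  by case: (j == i0) => // /eqP; rewrite eq_sym oner_eq0.
have bE k : bspec x [set i0] (x i0 i0 + k%:~R) <-> k = 0.
  rewrite bspec_set1 -{2}[x i0 i0]addr0; split=> [/addrI/eqP|->//].
  by rewrite intr_eq0 => /eqP.
have bpE i : i \in J -> blk J p i = [set i0].
  by rewrite {1}J1 inE => /eqP->; rewrite AJ.
have bqE i : i \in J -> blk J q i = [set i0].
  by rewrite {1}J1 inE => /eqP->; rewrite -pq AJ.
have sE z : swspec J p q x z -> z = 0.
  move=> [u [hu u0 xu]]; have [d ud] := hscal _ hu; have [Jx xJ] := sw_corner hx.
  move/eqP: xu; rewrite {1}ud linearZ /= /lie_br Jx xJ subrr scaler0 eq_sym.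
  by rewrite scaler_eq0 (negPf u0) orbF => /eqP.
have hcv (D : {set 'I_n} -> int -> Prop) : (forall k, D [set i0] k <-> k = 0) ->
    cvx (D [set i0]).
  by move=> DE k l m /DE-> /DE-> h; apply/DE; lia.
exists (x i0 i0); split.
- move=> i z iJ; rewrite bpE // bqE // bspec_set1 => h.
  by exists 0; rewrite addr0; case: h.
- split=> [i iJ|i j iJ jJ|i iJ _]; first by rewrite bpE //; apply: (hcv (fun S k => bspec x S (x i0 i0 + k%:~R))).
    by rewrite (pJ i) // (pJ j) // ltnn.
  by rewrite bpE // bqE // setDv eqxx.
- split=> [i iJ|i j iJ jJ|i iJ _].
  + rewrite bqE //; apply: (hcv (fun S k => bspec x S (x i0 i0 + (- k)%:~R))) => k.
    by rewrite bE; lia.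
  + by rewrite (qJ i) // (qJ j) // ltnn.
  + by rewrite bpE // bqE // setDv eqxx.
- by move=> i j iJ jJ; exists 0; rewrite bpE // bqE // !bE.
split; first by move=> z /sE->; exists 0.
move=> a b c' ha hb; move: (sE _ ha) (sE _ hb) => /eqP + /eqP.
by rewrite !intr_eq0 => /eqP a0 /eqP b0 h; have -> : c' = a by lia.
Qed.

Lemma bspec_nonempty x S z : bspec x S z -> S != set0.
Proof. by apply: contraTneq => ->; rewrite bspec0. Qed.

(* The index sets and the eigenvalue relations are those of the section
   [Reduction] below; here only their combinatorial consequence is drawn. *)
Section Step.
Variables (J J' U E C Z W T : {set 'I_n}) (p p' q : 'I_n -> nat) (a b : nat).
Variables (x y : 'M[K]_n).
Hypothesis pmin : forall i, i \in J -> (a <= p i)%N.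
Hypothesis qmin : forall i, i \in J -> (b <= q i)%N.
Hypothesis memU : forall i, (i \in U) = (i \in J) && (q i == b).
Hypothesis UA : forall i, i \in U -> p i = a.
Hypothesis memE : forall i, (i \in E) = [&& i \in J, p i == a & q i != b].
Hypothesis CU : C \subset U.
Hypothesis ZE : Z \subset E.
Hypothesis WE : W = E :\: Z.
Hypothesis TE : T = C :|: W.
Hypothesis J'E : J' = J :\: (U :\: C).
Hypothesis p'E : forall i, p' i = ((p i).*2 + (i \notin Z))%N.
Hypothesis CZ : C = set0 \/ Z = set0.
Hypothesis W0 : W != set0.
Hypothesis xyU : forall z, bspec x U z = bspec y T (z + 1).
Hypothesis xyD : forall S z, S \subset J :\: U -> bspec x S z = bspec y S z.
Hypothesis xA : forall z, bspec x (U :|: E) z = bspec x U z || bspec x E z.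
Hypothesis yT : forall z, bspec y T z = bspec y C z || bspec y W z.
Hypothesis yE : forall z, bspec y E z = bspec y Z z || bspec y W z.
Hypothesis sp_sub : forall z, swspec J p q x z -> swspec J' p' q y z \/
  exists c w, [/\ bspec x E c, bspec x U w & z = c - w \/ z = 1 - (c - w)].
Hypothesis sp_sup1 : forall c w, bspec x E c -> bspec x U w -> swspec J p q x (c - w).
Hypothesis sp_sup2 : forall z, swspec J' p' q y z -> swspec J p q x z.
Hypothesis sp_sym : forall z, swspec J p q x z -> swspec J p q x (1 - z).
Hypothesis sp0 : swspec J' p' q y 0.

Let memA i : i \in J -> p i = a -> blk J p i = U :|: E.
Proof.
move=> iJ pi; apply/setP => j; rewrite !inE memU memE pi.
case: (boolP (j \in J)) => //= jJ; case: (boolP (q j == b)) => //= [qj|].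
  by rewrite UA ?eqxx // memU jJ.
by rewrite andbT.
Qed.

Let memU' i : i \in J -> q i = b -> blk J q i = U.
Proof. by move=> iJ qi; apply/setP => j; rewrite !inE memU qi. Qed.

Let subJU S : (forall j, j \in S -> j \in J /\ (p j != a \/ q j != b)) -> S \subset J :\: U.
Proof.
move=> h; apply/subsetP => j jS; have [jJ h1] := h j jS; rewrite inE jJ andbT.
apply/negP => jU; have pj := UA jU; move: jU h1; rewrite memU pj => /andP[_ ->].
by rewrite eqxx => -[].
Qed.

Let otherp i : i \in J -> p i != a ->
  [/\ i \in J', blk J' p' i = blk J p i & blk J p i \subset J :\: U].
Proof.
move=> iJ pi; have nU j : p j != a -> j \notin U.
  by apply: contraNN => /UA->.
have nZ j : p j != a -> j \notin Z.
  by apply: contraNN => /(subsetP ZE); rewrite memE => /and3P[].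
split.
- by rewrite J'E !inE (negPf (nU _ pi)) andbF.
- apply/setP => j; rewrite J'E !inE !p'E (nZ _ pi) addn1.
  case: (eqVneq (p j) (p i)) => [pj|pj].
    by rewrite pj (nZ j) ?pj // addn1 eqxx (negPf (nU j _)) ?pj // andbF.
  rewrite !andbF; apply/negbTE; rewrite negb_and; apply/orP; right.
  by move: pj; case: (j \in Z); clear; lia.
by apply: subJU => j; rewrite inE => /andP[jJ /eqP->]; split=> //; left.
Qed.

Let otherq i : i \in J -> q i != b ->
  [/\ i \in J', blk J' q i = blk J q i & blk J q i \subset J :\: U].
Proof.
move=> iJ qi; split.
- by rewrite J'E !inE memU (negPf qi) !andbF.
- apply/setP => j; rewrite J'E !inE memU.
  case: (eqVneq (q j) (q i)) => [->|]; rewrite ?andbF //.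
  by rewrite (negPf qi) !andbF.
by apply: subJU => j; rewrite inE => /andP[jJ /eqP->]; split=> //; right.
Qed.

Let WP i : i \in W -> [/\ i \in J', i \in J, p i = a, q i != b & i \notin Z].
Proof.
rewrite WE inE memE => /andP[iZ /and3P[iJ /eqP pi qi]].
by split=> //; rewrite J'E !inE memU iJ (negPf qi) !andbF.
Qed.

Let CP i : i \in C -> [/\ i \in J', i \in J, p i = a, q i = b & i \notin Z].
Proof.
move=> iC; have iU := subsetP CU _ iC; move: (iU); rewrite memU => /andP[iJ /eqP qi].
split=> //; [by rewrite J'E !inE iC|exact: UA|].
by apply/negP => /(subsetP ZE); rewrite memE qi eqxx !andbF.
Qed.

Let blkT i : i \in T -> blk J' p' i = T.
Proof.
move=> iT; have [iJ iJ' pi iZ] : [/\ i \in J, i \in J', p i = a & i \notin Z].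
  by move: iT; rewrite TE inE => /orP[/CP[]|/WP[]].
apply/setP => j; rewrite TE !inE p'E p'E iZ pi.
apply/andP/orP => [[jJ' /eqP pj]|[/CP[? ? -> _ ->]|/WP[? ? -> _ ->]] //].
have [pja jZ] : p j = a /\ j \notin Z.
  by move: pj; case: (j \in Z) => /= h; split=> //; move: h; clear; lia.
move: jJ'; rewrite J'E !inE => /andP[]; rewrite negb_and negbK => /orP[jC _|jU jJ]; first by left.
by right; rewrite WE inE jZ memE jJ pja eqxx /=; move: jU; rewrite memU jJ.
Qed.

Let blkZ i : i \in Z -> blk J' p' i = Z /\ i \in J'.
Proof.
move=> iZ; have := subsetP ZE _ iZ; rewrite memE => /and3P[iJ /eqP pi qi].
split; last by rewrite J'E !inE iJ memU (negPf qi) !andbF.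
apply/setP => j; rewrite !inE !p'E iZ pi; apply/andP/idP => [[_ /eqP]|jZ].
  by case: (j \in Z) => //=; clear; lia.
have := subsetP ZE _ jZ; rewrite memE => /and3P[jJ /eqP pj qj].
by rewrite jZ pj J'E !inE jJ memU (negPf qj) !andbF.
Qed.

Let blkC i : i \in C -> blk J' q i = C.
Proof.
move=> iC; have [iJ' iJ pi qi iZ] := CP iC; apply/setP => j; rewrite !inE qi.
apply/andP/idP => [[]|jC]; last by have [? ? _ -> _] := CP jC.
by rewrite J'E !inE memU => + qj; rewrite qj andbT; case: (j \in C); case: (j \in J).
Qed.

Lemma good_step_comb : good J' p' q y -> good J p q x.
Proof.
move=> [z0 [hZ [cp AA Mp] [cq BB _] AB [sZ cs]]].
(* The base point of [y] is kept for [x]: blocks outside [U] are unchanged, and the block at [U]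
   moves by an integer. *)
pose P S (k : int) : Prop := bspec y S (z0 + k%:~R).
pose X S (k : int) : Prop := bspec x S (z0 + k%:~R).
have [W0'|[w wW]] := set_0Vmem W; first by case/negP: W0; rewrite W0'.
have [wJ' wJ pw qw wZ] := WP wW.
have wT : w \in T by rewrite TE inE wW orbT.
have subUJ : U \subset J by apply/subsetP => i; rewrite memU => /andP[].
have XU k : X U k <-> P T (k + 1) by rewrite /X /P xyU intrD addrA.
have XE k : X E k <-> P Z k \/ P W k.
  rewrite /X /P xyD; first by rewrite yE; split=> /orP.
  by apply: subJU => j; rewrite memE => /and3P[]; split=> //; right.
have XA k : X (U :|: E) k <-> X U k \/ X E k by rewrite /X xA; split=> /orP.
have PT k : P T k <-> P C k \/ P W k by rewrite /P yT; split=> /orP.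
have XD S k : S \subset J :\: U -> X S k <-> P S k by move=> SJ; rewrite /X /P xyD.
have cT : cvx (P T) by have := cp w wJ'; rewrite blkT.
have cZ : Z != set0 -> cvx (P Z).
  move=> /set0Pn[i iZ]; have [bZ iJ'] := blkZ iZ.
  by have := cp i iJ'; rewrite bZ.
have ABT j : j \in J' -> exists k, P T k /\ P (blk J' q j) k.
  by move=> jJ'; have := AB w j wJ' jJ'; rewrite blkT.
have PZ0 k : P Z k -> Z != set0 by apply: bspec_nonempty.
have PC0 k : P C k -> C != set0 by apply: bspec_nonempty.
(* If [C] is nonempty then [Z] is empty, and an index of [C] is minimal for both orders of the
   smaller seaweed, with blocks [T] and [C]; the last clause of [half] applies there. *)
have MC k : P C k -> exists k', k < k' /\ P W k'.
  move=> PCk; have C0 := PC0 _ PCk; have /set0Pn[i iC] := C0.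
  have Z0 : Z = set0 by case: CZ => // C0'; rewrite C0' eqxx in C0.
  have [iJ' iJ pi qi iZ] := CP iC.
  have iT : i \in T by rewrite TE inE iC.
  have TC : T :\: C = W.
    apply/setP => j; rewrite TE !inE; case: (boolP (j \in C)) => //= jC.
    by apply/esym/negbTE/negP => /WP[_ _ _]; have [_ _ _ -> _] := CP jC; rewrite eqxx.
  have := Mp i iJ'; rewrite blkT // blkC // TC => h; apply: h => // j.
  rewrite J'E !inE => /andP[_ jJ]; rewrite !p'E Z0 !inE !addn1 ltnS leq_double pi qi.
  by rewrite pmin ?qmin.
(* [Z] precedes [T] in [p'], so the linking clause of [half] gives an eigenvalue at [Z] one above an
   eigenvalue at [T]. *)
have AAZ : Z != set0 -> exists k, P Z (k + 1) /\ P T k.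
  move=> /set0Pn[i iZ]; have [bZ iJ'] := blkZ iZ.
  have := AA i w iJ' wJ'; rewrite bZ blkT //; apply; rewrite !p'E iZ wZ pw.
  have := subsetP ZE _ iZ; rewrite memE => /and3P[_ /eqP-> _].
  by rewrite addn0 addn1.
have ZTW : Z != set0 -> forall k, P T k <-> P W k.
  move=> Z0 k; rewrite PT; split; [case=> // /PC0|by right].
  by case: CZ => [-> | Z0']; [rewrite eqxx|rewrite Z0' eqxx in Z0].
(* An eigenvalue [k] at [W] is one at [E]. For [k] at [C] a larger eigenvalue exists at [W], so
   [k + 1] belongs to the interval of [T], and lowered by one it occurs at [U]. *)
have TA k : P T k -> X (U :|: E) k.
  move=> PTk; apply/XA; case/PT: (PTk) => [/MC[k' [kk' PWk']]|PWk].
    by left; apply/XU; apply: (cvx_succ (t := k')) => //; apply/PT; right.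
  by right; apply/XE; right.
(* The shifted interval of [T] together with the values at [W] is an interval; if [Z] is nonempty,
   its interval is adjoined, and [AAZ] shows that the two touch. *)
have UEc : cvx (X (U :|: E)).
  have cTW : cvx (fun k => P T (k + 1) \/ P W k).
    by apply: cvx_shift_or => // k PWk; apply/PT; right.
  have [Z0|Z0] := eqVneq Z set0.
    apply: cvx_eq cTW => k; rewrite XA XU XE; split=> [[]|[|[/PZ0|]]]; try by [left|right|right; right].
    by rewrite Z0 eqxx.
  have [k [PZk PTk]] := AAZ Z0.
  apply: (cvx_eq (P := fun k => P Z k \/ (P T (k + 1) \/ P W k))).
    by move=> l; rewrite XA XU XE; move: (P Z l) (P T _) (P W l); clear; tauto.
  apply: (@cvx_or (P Z) (fun k => P T (k + 1) \/ P W k) (k + 1) k) => //.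
  - exact: cZ.
  - by right; exact: (ZTW Z0 k).1.
  - by clear; lia.
have Xp i k : i \in J -> p i != a -> X (blk J p i) k <-> P (blk J' p' i) k.
  by move=> iJ pi; have [_ -> h] := otherp iJ pi; exact: XD.
have Xq i k : i \in J -> q i != b -> X (blk J q i) k <-> P (blk J' q i) k.
  by move=> iJ qi; have [_ -> h] := otherq iJ qi; exact: XD.
have U0 : exists i, i \in U.
  have [k [PTk _]] := ABT w wJ'; apply/set0Pn; apply: (@bspec_nonempty x U (z0 + (k - 1)%:~R)).
  by apply/(XU (k - 1)); rewrite subrK.
have minE i : i \in J -> (forall j, j \in J -> (p i <= p j)%N /\ (q i <= q j)%N) ->
    p i = a /\ q i = b.
  have [c0 c0U] := U0 => iJ imin; have [_] := imin _ (subsetP subUJ _ c0U).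
  have [+ _] := imin _ wJ; rewrite pw; move: (c0U); rewrite memU => /andP[_ /eqP->].
  by move=> h1 h2; split; apply/eqP; rewrite eqn_leq ?pmin ?qmin // andbT.
have Tint z : bspec y T z -> exists k : int, z = z0 + k%:~R.
  by move=> h; apply: (hZ w) => //; left; rewrite blkT.
have Uint z : bspec x U z -> exists k : int, z = z0 + k%:~R.
  by rewrite xyU => /Tint[k zE]; exists (k - 1); rewrite intrB addrA -zE addrK.
have Eint z : bspec x E z -> exists k : int, z = z0 + k%:~R.
  rewrite xyD; last by apply: subJU => j; rewrite memE => /and3P[]; split=> //; right.
  rewrite yE => /orP[h|h]; last by apply: Tint; rewrite yT h orbT.
  have /set0Pn[j jZ] := bspec_nonempty h; have [bZ jJ'] := blkZ jZ.
  by apply: (hZ j) => //; left; rewrite bZ.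
have Aint z : bspec x (U :|: E) z -> exists k : int, z = z0 + k%:~R.
  by rewrite xA => /orP[/Uint|/Eint].
have XN S k : X S k = bspec x S (z0 + k%:~R) by [].
exists z0; split.
- move=> i z iJ [h|h].
    have [pi|pi] := eqVneq (p i) a; first by apply: Aint; rewrite -(memA iJ pi).
    have [iJ' bE sE] := otherp iJ pi; apply: (hZ i) => //; left.
    by rewrite bE -xyD.
  have [qi|qi] := eqVneq (q i) b.
    have iU : i \in U by rewrite memU iJ qi eqxx.
    apply: Aint; rewrite xA; apply/orP; left.
    by rewrite -(memU' iJ qi).
  have [iJ' bE sE] := otherq iJ qi; apply: (hZ i) => //; right.
  by rewrite bE -xyD.
- split=> [i iJ|i j iJ jJ pij|i iJ imin ne k].
  + have [pi|pi] := eqVneq (p i) a; first by rewrite memA.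
    have [iJ' _ _] := otherp iJ pi.
    by apply: cvx_eq (cp i iJ') => k; symmetry; exact: Xp.
  + have pj : p j != a by apply: contraTneq pij => ->; rewrite -leqNgt pmin.
    have [jJ' bj _] := otherp jJ pj.
    have nZ l : p l != a -> l \notin Z.
      by apply: contraNN => /(subsetP ZE); rewrite memE => /and3P[].
    have [pi|pi] := eqVneq (p i) a.
      have [|k [h1 h2]] := AA w j wJ' jJ'.
        rewrite !p'E wZ nZ // pw; move: pij; rewrite pi; clear; lia.
      rewrite blkT // in h1; exists k; split; first by rewrite memA //; apply: TA.
      exact: (Xp j k jJ pj).2.
    have [iJ' bi _] := otherp iJ pi.
    have [|k [h1 h2]] := AA i j iJ' jJ'.
      by rewrite !p'E !nZ //; move: pij; clear; lia.
    by exists k; split; [exact: (Xp i (k + 1) iJ pi).2|exact: (Xp j k jJ pj).2].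
  have [pi qi] := minE i iJ imin.
  have UEE : (U :|: E) :\: U = E.
    apply/setP => j; rewrite !inE; case: (boolP (j \in U)) => //=.
    by rewrite memU memE => /andP[_ ->]; rewrite !andbF.
  rewrite memA // memU' // UEE => /XU /PT[/MC[k' [kk' PWk']]|PWk].
    by exists k'; split; [move: kk'; clear; lia|apply/XE; right].
  by exists (k + 1); split; [clear; lia|apply/XE; right].
- split=> [i iJ|i j iJ jJ qij|i iJ imin ne].
  + have [qi|qi] := eqVneq (q i) b.
      rewrite memU' //; apply: (@cvx_eq (fun k => P T (1 - k))) => [k|].
        by rewrite -XN XU addrC.
      exact: cvx_opp.
    have [iJ' _ _] := otherq iJ qi.
    by apply: cvx_eq (cq i iJ') => k; rewrite -XN; symmetry; exact: Xq.
  + have qj : q j != b by apply: contraTneq qij => ->; rewrite -leqNgt qmin.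
    have [jJ' bj _] := otherq jJ qj.
    have [qi|qi] := eqVneq (q i) b.
      have [k [h1 h2]] := ABT j jJ'; exists (- k); rewrite -!XN memU' //; split.
        by apply/XU; have -> : - (- k + 1) + 1 = k by clear; lia.
      by rewrite opprK; exact: (Xq j k jJ qj).2.
    have [iJ' bi _] := otherq iJ qi.
    have [k [h1 h2]] := BB i j iJ' jJ' qij; exists k.
    by split; [exact: (Xq i _ iJ qi).2|exact: (Xq j _ jJ qj).2].
  (* With [p] and [q] exchanged the last clause of [half] is void, since the [q]-block [U] lies
     inside the [p]-block. *)
  have [j jJ|pi qi] := minE i iJ; first by have [? ?] := imin j jJ.
  by move: ne; rewrite memA // memU' // setDUr setDv set0I eqxx.
- move=> i j iJ jJ.
  have [pi|pi] := eqVneq (p i) a; have [qj|qj] := eqVneq (q j) b.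
  + have [k [PTk _]] := ABT w wJ'; exists (k - 1); rewrite -!XN memA // memU' //.
    have h : X U (k - 1) by apply/XU; rewrite subrK.
    by split=> //; apply/XA; left.
  + have [jJ' _ _] := otherq jJ qj; have [k [h1 h2]] := ABT j jJ'.
    by exists k; split; [rewrite memA //; exact: TA|exact: (Xq j k jJ qj).2].
  + have [iJ' _ _] := otherp iJ pi.
    have [|k [h1 h2]] := AA w i wJ' iJ'.
      rewrite !p'E wZ pw; have : (a <= p i)%N by exact: pmin.
      by move: pi; clear; case: (i \in Z); lia.
    rewrite blkT // in h1; exists k.
    by split; [exact: (Xp i k iJ pi).2|rewrite memU' //; apply/XU].
  have [iJ' _ _] := otherp iJ pi; have [jJ' _ _] := otherq jJ qj.
  have [k [h1 h2]] := AB i j iJ' jJ'; exists k.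
  by split; [exact: (Xp i k iJ pi).2|exact: (Xq j k jJ qj).2].
(* The differences between eigenvalues at [E] and at [U]: [E] carries the eigenvalues of [W] and of
   [Z], and [U] those of [T] lowered by one, whence [d + 1]. *)
pose N (k : int) := (exists c d, [/\ P W c, P T (d + 1) & k = c - d]) \/
  (exists c d, [/\ P Z c, P T (d + 1) & k = c - d]).
have NP z : (exists c d, [/\ bspec x E c, bspec x U d & z = c - d]) <->
    exists2 k, N k & z = k%:~R.
  split=> [[c [d [cE dU ->]]]|[k Nk ->]].
    have [kc kcE] := Eint _ cE; have [kd kdE] := Uint _ dU; exists (kc - kd).
      rewrite kdE in dU; have /XU PTd := dU.
      rewrite kcE in cE; have /XE[PZc|PWc] := cE; [right|left]; by exists kc, kd.
    by rewrite kcE kdE intrB opprD addrACA subrr add0r.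
  suff [c [d [Ec Ud ->]]] : exists c d, [/\ X E c, X U d & k = c - d].
    exists (z0 + c%:~R), (z0 + d%:~R); split=> //.
    by rewrite intrB opprD addrACA subrr add0r.
  by case: Nk => -[c [d [h1 h2 ->]]]; exists c, d; split=> //;
    [apply/XE; right|apply/XU|apply/XE; left|apply/XU].
have [k0 PWk0] : exists k, P W k.
  have [k [/PT[/MC[k' [_ ?]]|?] _]] := ABT w wJ'; [by exists k'|by exists k].
have WT k : P W k -> P T k by move=> PWk; apply/PT; right.
have NW1 : exists c d, [/\ P W c, P T (d + 1) & 1 = c - d].
  by exists k0, (k0 - 1); split; [|rewrite subrK; exact: WT|clear; lia].
have N1 : N 1 by left.
have cN : cvx N.
  have cW := cvx_subset_sub cT WT.
  have [Z0|Z0] := eqVneq Z set0.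
    apply: cvx_eq cW => k; split=> [?|[//|[c [d [/PZ0 + _ _]]]]]; first by left.
    by rewrite Z0 eqxx.
  have [k [PZk PTk]] := AAZ Z0.
  (* The part from [W] contains 1. The part from [Z] contains 2, as [k + 1] occurs at [Z] and
     [k - 1] at [U]. So the two intervals touch. *)
  apply: (cvx_or (s := 1) (t := 2) cW _ NW1) => //.
    by apply: cvx_sub; [exact: cZ|exact: cvx_shift].
  by exists (k + 1), (k - 1); split; [|rewrite subrK|clear; lia].
split.
  move=> z /sp_sub[/sZ //|[c [d [cE dU zE]]]].
  have /NP[k _ kE] : exists c' d', [/\ bspec x E c', bspec x U d' & c - d = c' - d'].
    by exists c, d.
  by case: zE => ->; rewrite kE; [exists k|exists (1 - k); rewrite intrB].
apply: (@cvx_eq (fun k => (swspec J' p' q y k%:~R \/ N (1 - k)) \/ N k)) => [k|].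
  split=> [[[/sp_sup2 //|Nk]|Nk]|/sp_sub[|[c [d [cE dU zE]]]]]; last 2 first.
  - by left; left.
  - have /NP[k' Nk' kE] : exists c' d', [/\ bspec x E c', bspec x U d' & c - d = c' - d'].
      by exists c, d.
    case: zE; rewrite kE => /eqP; first by rewrite eqr_int => /eqP->; right.
    rewrite -[1]/(1%:~R) -intrB eqr_int => /eqP->; left; right.
    by rewrite opprB addrC subrK.
  - rewrite -[k](subKr 1) intrB; apply: sp_sym.
    have /NP[c [d [cE dU ->]]] : exists2 k', N k' & (1 - k)%:~R = k'%:~R :> K.
      by exists (1 - k).
    exact: sp_sup1.
  have /NP[c [d [cE dU ->]]] : exists2 k', N k' & k%:~R = k'%:~R :> K by exists k.
  exact: sp_sup1.
(* The three intervals are glued at 0 and 1: the spectrum of [ad y] and the reflected differences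
   both contain 0, and the differences contain 1. *)
apply: (@cvx_or _ _ 0 1) => //; [|by left].
apply: (@cvx_or _ _ 0 0) => //.
  exact: cvx_opp.
Qed.
End Step.
End Induction.

(** * Reduction to a smaller seaweed *)

(* [U] is the [q]-minimal block, [U :|: E] the [p]-minimal one.  The corner [phi]
   of [f] is invertible from [V] to [W], with inverse [th], and vanishes on the
   rows [C] and the columns [Z].  The smaller seaweed lives on [J' = J :\: V];
   in [p'] the columns [Z] become a separate block preceding [T = C :|: W]. *)
Section Reduction.
Variables (K : numClosedFieldType) (n : nat).
Variables (J U E C Z : {set 'I_n}) (p q : 'I_n -> nat) (a b : nat).
Variables (f th : 'M[K]_n).
Hypothesis pmin : forall i, i \in J -> (a <= p i)%N.
Hypothesis qmin : forall i, i \in J -> (b <= q i)%N.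
Hypothesis memU : forall i, (i \in U) = (i \in J) && (q i == b).
Hypothesis UA : forall i, i \in U -> p i = a.
Hypothesis memE : forall i, (i \in E) = [&& i \in J, p i == a & q i != b].
Hypothesis CU : C \subset U.
Hypothesis ZE : Z \subset E.

Variables (V W J' T : {set 'I_n}) (p' : 'I_n -> nat) (phi e g g' : 'M[K]_n).
Hypothesis VE : V = U :\: C.
Hypothesis WE : W = E :\: Z.
Hypothesis J'E : J' = J :\: V.
Hypothesis TE : T = C :|: W.
Hypothesis p'E : forall i, p' i = ((p i).*2 + (i \notin Z))%N.
Hypothesis phiE : phi = pr K U *m f *m pr K E.
Hypothesis eE : e = pr K (J :\: U).
Hypothesis gE : g = pr K C + phi.
Hypothesis g'E : g' = pr K C + th.

Hypothesis phiVW : pr K V *m phi *m pr K W = phi.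
Hypothesis thWV : pr K W *m th *m pr K V = th.
Hypothesis phith : phi *m th = pr K V.
Hypothesis thphi : th *m phi = pr K W.
Hypothesis frobf : frob J p q f.

(* [y] itself on [J :\: U], plus its block at [T] transported to [U] by [g]. *)
Definition red_lift y := e *m y *m e + g *m y *m g'.

Let Vphi : pr K V *m phi = phi. Proof. by rewrite -phiVW !mulmxA pr_id. Qed.
Let phiW : phi *m pr K W = phi. Proof. by rewrite -phiVW -!mulmxA pr_id. Qed.
Let Wth : pr K W *m th = th. Proof. by rewrite -thWV !mulmxA pr_id. Qed.
Let thV : th *m pr K V = th. Proof. by rewrite -thWV -!mulmxA pr_id. Qed.

Let memJ' i : (i \in J') = (i \in J) && ((i \in U) ==> (i \in C)).
Proof. by rewrite J'E VE !inE; case: (i \in J); case: (i \in C); case: (i \in U). Qed.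

Let dis (S S' : {set 'I_n}) : (forall i, i \in S -> i \in S' -> false) -> pr K S *m pr K S' = 0.
Proof.
move=> h; apply: pr_disj; apply/pred0P => i /=.
by apply/negbTE/negP => /andP[/h iS /iS].
Qed.

Let memC i : i \in C -> [/\ i \in U, i \in J, p i = a & q i = b].
Proof.
move=> /(subsetP CU) iU; split=> //; last by move: iU; rewrite memU => /andP[_ /eqP].
  by move: iU; rewrite memU => /andP[].
exact: UA.
Qed.

Let memEP i : i \in E -> [/\ i \in J, p i = a, q i != b & i \notin U].
Proof.
rewrite memE => /and3P[iJ /eqP pi qi]; split=> //.
by rewrite memU iJ (negPf qi).
Qed.

Let dUE : [disjoint U & E].
Proof.
apply/pred0P => i /=; apply/negbTE/negP => /andP[iU /memEP[_ _ _]].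
by rewrite iU.
Qed.

Let CZ i : i \in C -> i \notin Z.
Proof.
move=> iC; apply/negP => /(subsetP ZE) /memEP[_ _ _].
by have [-> ] := memC iC.
Qed.

Let WP i : i \in W -> [/\ i \in J, p i = a, i \notin U, q i != b & i \notin Z].
Proof. by rewrite WE inE => /andP[iZ /memEP[]]. Qed.

Let ee : e *m e = e. Proof. by rewrite eE pr_id. Qed.
Let eC : e *m pr K C = 0.
Proof. by rewrite ?eE ?VE; apply: dis => i; rewrite inE => /andP[/negP iU _] /memC[]. Qed.
Let Ce : pr K C *m e = 0.
Proof. by rewrite ?eE ?VE; apply: dis => i /memC[iU]; rewrite inE iU. Qed.
Let eV : e *m pr K V = 0.
Proof. by rewrite ?eE ?VE; apply: dis => i; rewrite !inE => /andP[/negP iU _] /andP[_]. Qed.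
Let Ve : pr K V *m e = 0.
Proof. by rewrite ?eE ?VE; apply: dis => i; rewrite !inE => /andP[_ ->]. Qed.
Let Ue : pr K U *m e = 0.
Proof. by rewrite ?eE ?VE; apply: dis => i; rewrite !inE => ->. Qed.
Let eU : e *m pr K U = 0.
Proof. by rewrite ?eE ?VE; apply: dis => i; rewrite !inE => /andP[/negP]. Qed.
Let subEJU : E \subset J :\: U.
Proof. by apply/subsetP => i /memEP[iJ _ _ iU]; rewrite inE iU. Qed.
Let ePE : e *m pr K E = pr K E. Proof. by rewrite eE pr_sub'. Qed.
Let sWE : W \subset E. Proof. by rewrite WE subsetDl. Qed.
Let eW : e *m pr K W = pr K W.
Proof. by rewrite eE; apply: pr_sub'; apply: subset_trans subEJU. Qed.
Let We : pr K W *m e = pr K W.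
Proof. by rewrite eE; apply: pr_sub; apply: subset_trans subEJU. Qed.
Let CV : pr K C *m pr K V = 0. Proof. by rewrite ?eE ?VE; apply: dis => i iC; rewrite inE iC. Qed.
Let VC : pr K V *m pr K C = 0.
Proof. by rewrite ?eE ?VE; apply: dis => i; rewrite inE => /andP[/negP]. Qed.
Let CW : pr K C *m pr K W = 0.
Proof. by rewrite ?eE ?VE; apply: dis => i /memC[iU _ _ _] /WP[_ _]; rewrite iU. Qed.
Let WC : pr K W *m pr K C = 0.
Proof. by rewrite ?eE ?VE; apply: dis => i /WP[_ _ /negP iU _ _] /memC[]. Qed.
Let ephi : e *m phi = 0. Proof. by rewrite -Vphi mulmxA eV mul0mx. Qed.
Let phie : phi *m e = phi. Proof. by rewrite -phiW -mulmxA We. Qed.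
Let eth : e *m th = th. Proof. by rewrite -Wth mulmxA eW. Qed.
Let the : th *m e = 0. Proof. by rewrite -thV -mulmxA Ve mulmx0. Qed.
Let Cphi : pr K C *m phi = 0. Proof. by rewrite -Vphi mulmxA CV mul0mx. Qed.
Let phiC : phi *m pr K C = 0. Proof. by rewrite -phiW -mulmxA WC mulmx0. Qed.
Let Cth : pr K C *m th = 0. Proof. by rewrite -Wth mulmxA CW mul0mx. Qed.
Let thC : th *m pr K C = 0. Proof. by rewrite -thV -mulmxA VC mulmx0. Qed.
Let eg : e *m g = 0. Proof. by rewrite gE mulmxDr eC ephi addr0. Qed.
Let ge : g *m e = phi. Proof. by rewrite gE mulmxDl Ce phie add0r. Qed.
Let eg' : e *m g' = th. Proof. by rewrite g'E mulmxDr eC eth add0r. Qed.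
Let g'e : g' *m e = 0. Proof. by rewrite g'E mulmxDl Ce the addr0. Qed.
Let PUE : pr K U = pr K C + pr K V.
Proof. by rewrite VE pr_setD // addrC subrK. Qed.
Let gg' : g *m g' = pr K U.
Proof. by rewrite gE g'E mulmxDl !mulmxDr pr_id Cth phiC phith addr0 add0r PUE. Qed.
Let PT : pr K T = pr K C + pr K W.
Proof.
rewrite TE; apply: pr_setU; apply/pred0P => i /=; apply/negbTE/negP.
by move=> /andP[/memC[iU _ _ _] /WP[_ _]]; rewrite iU.
Qed.
Let g'g : g' *m g = pr K T.
Proof. by rewrite gE g'E mulmxDl !mulmxDr pr_id Cphi thC thphi addr0 add0r PT. Qed.
Let gT : g *m pr K T = g.
Proof. by rewrite PT gE mulmxDr !mulmxDl pr_id phiC CW phiW addr0 add0r. Qed.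
Let Tg' : pr K T *m g' = g'.
Proof. by rewrite PT g'E mulmxDl !mulmxDr pr_id WC Cth Wth addr0 add0r. Qed.
Let Ug : pr K U *m g = g.
Proof. by rewrite PUE gE mulmxDl !mulmxDr pr_id VC Cphi Vphi addr0 add0r. Qed.
Let g'U : g' *m pr K U = g'.
Proof. by rewrite PUE g'E mulmxDr !mulmxDl pr_id thC CV thV addr0 add0r. Qed.
Let PJ' : pr K J' = e + pr K C.
Proof.
rewrite eE addrC -pr_setU; last first.
  by apply/pred0P => i /=; apply/negbTE/negP => /andP[/memC[iU]]; rewrite inE iU.
congr pr; apply/setP => i; rewrite memJ' !inE.
by have := @memC i; case: (i \in C) => [[] // -> -> //|_]; case: (i \in U); case: (i \in J).
Qed.
Let PJ : pr K J = e + pr K U.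
Proof.
rewrite eE pr_setD ?subrK //; apply/subsetP => i; by rewrite memU => /andP[].
Qed.

Let Cye y : sw J' p' q y -> pr K C *m y *m e = 0.
Proof.
move=> hy; rewrite eE; apply: pr_block0 => i j /memC[_ _ _ qi]; rewrite inE memU => /andP[jU jJ].
move=> /hy[_ _ _]; rewrite qi leq_eqVlt => /orP[/eqP qj|].
  by move: jU; rewrite jJ qj eqxx.
by rewrite ltnNge qmin.
Qed.

Let p'p i j : (p' i <= p' j)%N -> (p i <= p j)%N.
Proof. rewrite !p'E; case: (i \in Z); case: (j \in Z); clear; lia. Qed.

Let TP i : i \in T -> [/\ i \in J, p i = a & i \notin Z].
Proof. by rewrite TE inE => /orP[/[dup] /CZ ? /memC[]|/WP[]]. Qed.

Let memT i : (i \in T) = (i \in J') && (p' i == a.*2.+1).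
Proof.
rewrite memJ' p'E; apply/idP/idP.
  move=> /[dup] /TP[iJ -> iZ]; rewrite iJ iZ addn1 eqxx andbT TE inE => /orP[->|].
    by rewrite implybT.
  by move=> /WP[_ _ /negPf->].
move=> /andP[/andP[iJ iUC] /eqP pi]; have [iZ pia] : i \notin Z /\ p i = a.
  by move: pi; case: (i \in Z) => /= pi; split=> //; move: pi; clear; lia.
rewrite TE inE; case: (boolP (i \in U)) iUC => /= [_ -> //|iU _].
by rewrite WE inE iZ memE iJ pia eqxx /=; move: iU; rewrite memU iJ /= => ->; rewrite orbT.
Qed.

Let Tmid y w : sw J' p' q y -> sw J' p' q w ->
  pr K T *m y *m pr K T *m w *m pr K T = pr K T *m y *m w *m pr K T.
Proof.
move=> hy hw.
pose Q := [set k in J' | (p' k <= a.*2.+1)%N].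
pose Q' := [set k in J' | (a.*2.+1 <= p' k)%N].
have QQ : pr K Q' *m pr K Q = pr K T.
  rewrite pr_pr; congr pr; apply/setP => k; rewrite memT !inE eqn_leq.
  by case: (k \in J') => //; rewrite !andTb andbC.
have -> : pr K T *m y *m pr K T *m w *m pr K T =
  (pr K T *m y *m pr K Q') *m (pr K Q *m w *m pr K T) by rewrite -{2}QQ !mulmxA.
rewrite pr_row_sub; last first.
  move=> i j; rewrite memT => /andP[iJ /eqP pi] /hy[_ jJ].
  by rewrite pi inE jJ.
rewrite pr_col_sub; last first.
  move=> i j; rewrite memT => /andP[jJ /eqP pj] /hw[iJ _].
  by rewrite pj inE iJ.
by rewrite !mulmxA.
Qed.

(** The transported part is multiplicative because [T] is a single block of [p'] ([Tmid]), and the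
    part outside [U] because an element of the smaller seaweed has no entry with row in [C] and
    column outside [U] ([Cye]). *)
Lemma red_liftM y w : sw J' p' q y -> sw J' p' q w ->
  red_lift (y *m w) = red_lift y *m red_lift w.
Proof.
move=> hy hw; have hyw := sw_mul hy hw.
rewrite /red_lift mulmxDl !mulmxDr.
have -> : g *m (y *m w) *m g' = g *m y *m g' *m (g *m w *m g').
  have := congr1 (fun m => g *m m *m g') (Tmid hy hw).
  rewrite !mulmxA gT -![_ *m pr K T *m g']mulmxA Tg' -g'g => <-.
  by rewrite !mulmxA.
have -> : e *m y *m e *m (g *m w *m g') = 0.
  by rewrite !mulmxA -[_ *m e *m g]mulmxA eg mulmx0 !mul0mx.
have -> : g *m y *m g' *m (e *m w *m e) = 0.
  by rewrite !mulmxA -[_ *m g' *m e]mulmxA g'e mulmx0 !mul0mx.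
rewrite addr0 add0r; congr (_ + _).
have [_ {1}<-] := sw_corner hy.
rewrite PJ' mulmxDr mulmxDl mulmxDr mulmxDl.
have -> : e *m (y *m pr K C *m w) *m e = 0.
  by rewrite -!mulmxA (mulmxA (pr K C)) Cye // !mulmx0.
by rewrite addr0 !mulmxA -[_ *m e *m e]mulmxA ee.
Qed.

Lemma sw_red_lift y : sw J' p' q y -> sw J p q (red_lift y).
Proof.
move=> hy; apply: swD.
  move=> i j eye; have := corner_sup (S := J :\: U) (T := J :\: U) _ eye.
  rewrite eE !mulmxA pr_id -mulmxA pr_id => /(_ erefl).
  rewrite !inE => -[/andP[iU iJ] /andP[jU jJ]].
  move: eye; rewrite eE mul_prE pr_mulE; case: ifP; rewrite ?eqxx // => _.
  by case: ifP; rewrite ?eqxx // => _ /hy[_ _ /p'p].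
move=> i j gyg; have := corner_sup (S := U) (T := U) _ gyg.
rewrite !mulmxA Ug -mulmxA g'U => /(_ erefl).
by rewrite !memU => -[/[dup] iU /andP[-> /eqP->] /[dup] jU /andP[-> /eqP->]]; rewrite !UA ?memU.
Qed.

Lemma red_liftB y w : red_lift (y - w) = red_lift y - red_lift w.
Proof. by rewrite /red_lift !mulmxBr !mulmxBl opprD addrACA. Qed.

Lemma red_lift_br y w : sw J' p' q y -> sw J' p' q w ->
  red_lift (lie_br y w) = lie_br (red_lift y) (red_lift w).
Proof. by move=> hy hw; rewrite red_liftB !red_liftM. Qed.

Let phiZ : phi *m pr K Z = 0.
Proof.
by rewrite -phiW -mulmxA dis ?mulmx0 // => i /WP[_ _ _ _ /negP].
Qed.
Let PUphi : pr K U *m phi = phi. Proof. by rewrite phiE !mulmxA pr_id. Qed.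
Let phiPE : phi *m pr K E = phi. Proof. by rewrite -phiW -mulmxA pr_sub. Qed.
Let Cg' : pr K C *m g' = pr K C. Proof. by rewrite g'E mulmxDr pr_id Cth addr0. Qed.
Let g'C : g' *m pr K C = pr K C. Proof. by rewrite g'E mulmxDl pr_id thC addr0. Qed.
Let PEth : pr K E *m th = th.
Proof. by rewrite -Wth mulmxA pr_sub'. Qed.
Let PUE0 : pr K U *m pr K E = 0. Proof. exact: pr_disj. Qed.
Let PEU0 : pr K E *m pr K U = 0. Proof. by apply: pr_disj; rewrite disjoint_sym. Qed.

Let g'PE : g' *m pr K E = 0. Proof. by rewrite -g'U -mulmxA PUE0 mulmx0. Qed.

Let rowU u : sw J p q u -> pr K U *m u *m pr K U = pr K U *m u.
Proof.
move=> hu; apply: pr_row_sub => i j; rewrite !memU => /andP[iJ /eqP qi].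
by move=> /hu[_ jJ _]; rewrite qi jJ eqn_leq qmin // => ->.
Qed.

Let colE' u : sw J p q u -> pr K E *m u *m pr K E = u *m pr K E.
Proof.
move=> hu; apply: pr_col_sub => i j; rewrite !memE => /and3P[jJ /eqP pj qj].
move=> /hu[iJ _]; rewrite pj iJ eqn_leq pmin // andbT => -> /=.
by move: qj; rewrite !eqn_leq !qmin // !andbT -!ltnNge; apply: leq_trans.
Qed.

Let euU u : sw J p q u -> e *m u *m pr K U = pr K E *m u *m pr K U.
Proof.
move=> hu; apply/eqP; rewrite -subr_eq0 -!mulmxBl eE -pr_setD //.
apply/eqP; apply: pr_block0 => i j; rewrite !inE memE => /and3P[iE iU iJ] jU.
move=> /hu[_ _]; rewrite (UA jU) => pi _.
have pia : p i = a by apply/eqP; rewrite eqn_leq pi pmin.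
by move: iE iU; rewrite memU iJ pia eqxx /=; case: (q i == b).
Qed.

(* [lam u] pairs [u] with the ideal of matrices with rows [E] and columns [U]:
   see [red_lam_br]; its kernel consists of the lifts modulo that ideal. *)
Let lam u := phi *m u *m pr K E - pr K U *m u *m phi.

Fact red_lam_is_linear : linear lam.
Proof.
move=> c u v; rewrite /lam !mulmxDr !mulmxDl -!scalemxAr -!scalemxAl opprD addrACA.
by rewrite scalerBr.
Qed.

Let lamUE u : pr K U *m lam u *m pr K E = lam u.
Proof.
rewrite /lam mulmxBr mulmxBl !mulmxA PUphi pr_id -!mulmxA phiPE pr_id //.
Qed.

Lemma red_lam_br u m : sw J p q u ->
  \tr (f *m lie_br u (pr K E *m m *m pr K U)) = \tr (m *m lam u).
Proof.
move=> hu; rewrite mxtr_br mulmxBr linearB /=; congr (_ - _).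
  have -> : \tr (f *m u *m (pr K E *m m *m pr K U)) =
      \tr (pr K U *m f *m (u *m pr K E) *m m).
    by rewrite !mulmxA mxtrace_mulC !mulmxA.
  by rewrite -colE' // !mulmxA -phiE mxtrace_mulC !mulmxA.
have -> : \tr (f *m (pr K E *m m *m pr K U) *m u) =
    \tr (pr K U *m f *m pr K E *m m *m (pr K U *m u)).
  rewrite -[in LHS]mulmxA -[in LHS](mulmxA _ (pr K U)) -[in LHS]rowU // !mulmxA.
  by rewrite mxtrace_mulC !mulmxA.
by rewrite -phiE -mulmxA mxtrace_mulC !mulmxA.
Qed.

(** The two terms of [lam] cancel except for the entries of [y] with row in [W] and column in [Z],
    and [p'] forbids exactly these: this is why [Z] is split off as a block of its own, placed
    before [T]. *)
Lemma red_lam_lift y : sw J' p' q y -> lam (red_lift y) = 0.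
Proof.
move=> hy; rewrite /lam /red_lift !mulmxDr !mulmxDl !mulmxA phie.
rewrite -[_ *m e *m pr K E]mulmxA ePE Ue !mul0mx add0r Ug.
rewrite -[_ *m g' *m pr K E]mulmxA g'PE !mulmx0 addr0.
have -> : g *m y *m g' *m phi = g *m y *m pr K W.
  by rewrite -mulmxA g'E mulmxDl Cphi thphi add0r.
have -> : g *m y *m pr K W = phi *m y *m pr K W.
  by rewrite gE !mulmxDl -eW !mulmxA Cye // mul0mx add0r.
rewrite -{1}(subrK (pr K Z) (pr K E)) -pr_setD // -WE mulmxDr addrAC subrr add0r.
rewrite -phiW -!mulmxA (mulmxA (pr K W)) pr_block0 ?mulmx0 //.
move=> i j /WP[_ pi _ _ iZ] jZ /hy[_ _]; rewrite !p'E iZ jZ pi.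
by have [_ -> _ _] := memEP (subsetP ZE _ jZ); rewrite addn0 addn1 ltnn.
Qed.

Lemma red_lam_fiber u : sw J p q u -> lam u = 0 -> exists2 y, sw J' p' q y &
  u = red_lift y + pr K E *m u *m pr K U.
Proof.
move=> hu /eqP; rewrite subr_eq0 => /eqP lamu.
(* Multiply the equation by [th] on the left and by [pr K Z] on the right. This vanishing is what
   [p'] demands beyond [p]. *)
have uWZ : pr K W *m u *m pr K Z = 0.
  rewrite -thphi -!mulmxA -(pr_sub' _ ZE) !mulmxA -(mulmxA th) -(mulmxA th) lamu.
  by rewrite -!mulmxA phiZ !mulmx0.
(* The candidate inverts [red_lift]: the part outside [U] is kept, and of the block at [U] only the
   columns [C] survive the deletion of [V], their rows being moved back to [T] by [g']. *)
exists (e *m u *m e + g' *m u *m pr K C).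
  apply: swD => i j.
    rewrite eE mul_prE pr_mulE; case: ifP; rewrite ?eqxx // => jJU.
    case: ifP; rewrite ?eqxx // => iJU uij; have [iJ jJ pij qji] := hu _ _ uij.
    move: iJU jJU; rewrite !memJ' iJ jJ !inE iJ jJ !andbT => iU jU.
    rewrite (negPf iU) (negPf jU); split=> //; rewrite !p'E.
    case: (boolP (j \in Z)) => jZ; last by case: (i \in Z); move: pij; clear; lia.
    case: (boolP (i \in Z)) => iZ; first by move: pij; clear; lia.
    rewrite addn1 addn0; suff : p i != p j by move: pij; clear; lia.
    apply/eqP => pipj; have [_ pj _ _] := memEP (subsetP ZE _ jZ).
    have iW : i \in W by rewrite WE inE iZ memE iJ pipj pj eqxx /=; move: iU; rewrite memU iJ.
    move/matrixP/(_ i j): uWZ; rewrite mul_prE pr_mulE mxE iW jZ => u0.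
    by rewrite u0 eqxx in uij.
  move=> gu; have [] := corner_sup (S := T) (T := C) _ gu.
    by rewrite !mulmxA Tg' -mulmxA pr_id.
  rewrite memT => /andP[iJ' /eqP pi] jC; have [jU jJ pj qj] := memC jC.
  have iJ : i \in J by move: iJ'; rewrite memJ' => /andP[].
  split=> //; first by rewrite memJ' jJ jC implybT.
    by rewrite pi p'E CZ // pj addn1.
  by rewrite qj qmin.
have [uJ Ju] := sw_corner hu.
rewrite /red_lift !mulmxDr !mulmxDl !mulmxA.
rewrite ee eg' -[_ *m e *m e]mulmxA ee.
rewrite -[th *m u *m _ *m e]mulmxA Ce mulmx0 addr0.
rewrite ge -[phi *m u *m e *m g']mulmxA eg' gg' -[pr K U *m u *m _ *m g']mulmxA Cg'.
have -> : phi *m u *m th = pr K U *m u *m pr K V.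
  by rewrite -{1}PEth mulmxA lamu -[_ *m phi *m th]mulmxA phith.
rewrite -mulmxDr addrC [pr K V + _]addrC -PUE rowU // -euU //.
have -> : e *m u *m pr K U = e *m u - e *m u *m e.
  by rewrite -{2}Ju PJ !mulmxDr !mulmxA [in RHS]addrC addKr.
by rewrite addrA subrK -mulmxDl -PJ uJ.
Qed.

Let sw_ideal m : sw J p q (pr K E *m m *m pr K U).
Proof.
move=> i j h; have [] := corner_sup (S := E) (T := U) _ h.
  by rewrite !mulmxA pr_id -mulmxA pr_id.
move=> /memEP[iJ pi _ _] jU; have jJ : j \in J by move: jU; rewrite memU => /andP[].
by rewrite pi UA //; split=> //; move: jU; rewrite memU => /andP[_ /eqP->]; apply: qmin.
Qed.

(** The element of the ideal attached to [m] lies in the radical of [f], so it is scalar; a scalar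
    matrix with rows in [E] and columns in [U] is zero. All consequences of nondegeneracy for the
    shape of [phi] come from here. *)
Lemma red_radical m : (forall u, sw J p q u -> \tr (m *m lam u) = 0) ->
  pr K E *m m *m pr K U = 0.
Proof.
move=> hm; have [u hu|c nE] := frobf (@sw_ideal m).
  by rewrite lie_brC mulmxN linearN /= red_lam_br // hm // oppr0.
have <- : pr K E *m (pr K E *m m *m pr K U) *m pr K U = pr K E *m m *m pr K U.
  by rewrite !mulmxA pr_id -mulmxA pr_id.
rewrite nE -scalemxAr -scalemxAl PJ mulmxDr mulmxDl -!mulmxA eU pr_id PEU0.
by rewrite mulmx0 addr0 scaler0.
Qed.

Let radicalZ m : pr K Z *m m = m ->
  (forall u, sw J p q u -> \tr (m *m phi *m u *m pr K E) = 0) ->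
  pr K E *m m *m pr K U = 0.
Proof.
move=> Zm hm; apply: red_radical => u hu; rewrite mulmxBr linearB /= !mulmxA hm //.
rewrite mxtrace_mulC !mulmxA.
have -> : phi *m m = 0 by rewrite -Zm mulmxA phiZ mul0mx.
by rewrite !mul0mx linear0 subrr.
Qed.

(** As [phi] kills the rows [C] and the columns [Z], a matrix unit with row in [Z] and column in [C]
    would be orthogonal to the whole algebra. *)
Lemma red_CZ i j : i \in C -> j \in Z -> False.
Proof.
move=> iC jZ; have iU := subsetP CU _ iC; have jE := subsetP ZE _ jZ.
have /matrixP/(_ j i) : pr K E *m delta_mx j i *m pr K U = 0.
  apply: radicalZ; first exact: pr_delta.
  move=> u hu; rewrite -(@delta_pr K n C j i iC) -[_ *m pr K C *m phi]mulmxA Cphi.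
  by rewrite mulmx0 !mul0mx linear0.
by rewrite pr_delta // delta_pr // !mxE !eqxx => /eqP; rewrite oner_eq0.
Qed.

(** The only new comparison is between [i] in [Z] and [j] in [T], and [j] is in [W] by [red_CZ].
    Were [q j < q i], no element of the algebra would have an entry at [(j, i)], and
    [delta_mx i j *m th] would be a nonzero element of the radical. *)
Lemma red_compat : compat J p q -> compat J' p' q.
Proof.
move=> hc i j; rewrite !memJ' => /andP[iJ iU] /andP[jJ jU] pij.
have [pij'|pij'] := ltnP (p i) (p j); first exact: hc.
have [iZ jZ pji] : [/\ i \in Z, j \notin Z & p j = p i].
  move: pij pij'; rewrite !p'E; case: (i \in Z); case: (j \in Z) => /= h h'; split=> //;
  by move: h h'; clear; lia.
have [_ pia qib iU'] := memEP (subsetP ZE _ iZ).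
have jT : j \in T by rewrite memT memJ' jJ jU /= p'E jZ pji pia addn1.
move: jT; rewrite TE inE => /orP[jC|jW]; first by case: (red_CZ jC iZ).
rewrite leqNgt; apply/negP => qji.
have /(congr1 (mulmx^~ phi)) : pr K E *m (delta_mx i j *m th) *m pr K U = 0.
  apply: radicalZ => [|u hu]; first by rewrite mulmxA pr_delta.
  rewrite -[_ *m th *m phi]mulmxA thphi delta_pr // -mulmxA mxtr_delta mul_prE.
  case: ifP => // _; case: (eqVneq (u j i) 0) => // /hu[_ _ _].
  by rewrite leqNgt qji.
rewrite mul0mx -[_ *m pr K U *m phi]mulmxA PUphi -!mulmxA thphi delta_pr //.
rewrite pr_delta ?(subsetP ZE) // => /matrixP/(_ i j); rewrite !mxE !eqxx => /eqP.
by rewrite oner_eq0.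
Qed.

(** The pullback of [f] along [red_lift], by [tr_lift]. *)
Let f' := e *m f *m e + g' *m f *m g.

Let tr_lift w : \tr (f' *m w) = \tr (f *m red_lift w).
Proof.
rewrite /f' /red_lift mulmxDl mulmxDr !linearD /=; congr (_ + _).
  by rewrite -!mulmxA mxtrace_mulC !mulmxA.
by rewrite -!mulmxA mxtrace_mulC !mulmxA.
Qed.

Let TyC y : sw J' p' q y -> pr K T *m y *m pr K C = y *m pr K C.
Proof.
move=> hy; apply: pr_col_sub => i j jC hij; have [iJ jJ pij qji] := hy _ _ hij.
have [jU _ pj _] := memC jC; rewrite memT iJ.
move: pij; rewrite !p'E (CZ jC) pj; case: (boolP (i \in Z)) => [iZ|iZ pij].
  by case: (red_CZ jC iZ).
suff : (a <= p i)%N by move: pij; clear; lia.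
by apply: pmin; move: iJ; rewrite memJ' => /andP[].
Qed.

Lemma red_lift_inv y : sw J' p' q y ->
  e *m red_lift y *m e + g' *m red_lift y *m pr K C = y.
Proof.
move=> hy; rewrite /red_lift !(mulmxDr, mulmxDl) !mulmxA ee -[_ *m e *m e]mulmxA ee.
rewrite eg !mul0mx addr0 g'e !mul0mx add0r g'g -[_ *m g' *m pr K C]mulmxA g'C TyC //.
have [yJ Jy] := sw_corner hy; rewrite -[RHS]Jy PJ' mulmxDr -[in RHS]yJ PJ'.
rewrite !mulmxDl Cye // addr0; congr (_ + _).
by rewrite -!mulmxDl -PJ' yJ.
Qed.

(** For [y] in the radical of [f'], the functional [v |-> f [red_lift y, v]] vanishes on the kernel
    of [lam], so it is the pairing with an element of the ideal. Correcting [red_lift y] by this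
    element gives a member of the radical of [f], that is a scalar; hence the correction is zero and
    [y] is scalar. *)
Lemma red_frob : frob J' p' q f'.
Proof.
move=> y hy h; have hly := sw_red_lift hy.
pose H := GRing.isLinear.Build K 'M[K]_n 'M[K]_n *:%R lam red_lam_is_linear.
pose lam' : {linear 'M[K]_n -> 'M[K]_n} := HB.pack lam H.
have [v hv lv|m hm] := @sw_factor _ _ J p q (lie_br f (red_lift y)) lam'.
  have [w hw ->] := red_lam_fiber hv lv.
  rewrite mulmxDr linearD /= -!mxtr_brl -red_lift_br // red_lam_br // red_lam_lift //.
  by rewrite mulmx0 linear0 addr0 -tr_lift h.
have [v hv|c hc] := frobf (swD hly (@sw_ideal m)).
  rewrite lie_brDl mulmxDr linearD /= [lie_br (_ *m _) v]lie_brC mulmxN linearN /=.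
  by rewrite red_lam_br // mxtr_brl hm // subrr.
have /eqP : pr K E *m (c *: pr K J) *m pr K U = 0.
  rewrite -scalemxAr -scalemxAl PJ mulmxDr mulmxDl -!mulmxA eU pr_id PEU0.
  by rewrite mulmx0 addr0 scaler0.
have -> : pr K E *m (c *: pr K J) *m pr K U = pr K E *m m *m pr K U.
  rewrite -hc mulmxDr mulmxDl !mulmxA pr_id -[_ *m pr K U *m _]mulmxA pr_id.
  rewrite /red_lift mulmxDr !mulmxDl -!mulmxA eU !mulmx0 add0r -Ug !mulmxA PEU0.
  by rewrite !mul0mx add0r.
move=> /eqP m0; move: hc; rewrite m0 addr0 => hc; exists c.
rewrite -[LHS]red_lift_inv // hc -!scalemxAr -!scalemxAl -scalerDr; congr (_ *: _).
rewrite PJ !(mulmxDr, mulmxDl) !ee eU mul0mx addr0 g'e mul0mx add0r g'U g'C.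
by rewrite PJ'.
Qed.

(** [x + pr K U] is orthogonal to the ideal, so [red_lam_fiber] provides [y]. It is principal
    because [pr K U] commutes with lifts and the ideal is orthogonal to them. *)
Lemma red_princ x : princ J p q f x -> exists2 y, princ J' p' q f' y &
  x = red_lift y - pr K U + pr K E *m x *m pr K U.
Proof.
move=> [hx xP]; have UJ : U \subset J by apply/subsetP => i; rewrite memU => /andP[].
have hxU := swD hx (sw_pr p q UJ).
have [|y hy xE] := red_lam_fiber hxU.
  apply/eqP; rewrite -[_ == 0]negbK; apply/negP => /matrix0Pn[i [j lij]].
  case/eqP: lij; rewrite -mxtr_delta.
  have -> : \tr (delta_mx j i *m lam (x + pr K U)) =
      \tr (f *m lie_br x (pr K E *m delta_mx j i *m pr K U)) +
      \tr (f *m lie_br (pr K U) (pr K E *m delta_mx j i *m pr K U)).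
    by rewrite -red_lam_br // lie_brDl mulmxDr linearD.
  rewrite xP; last exact: sw_ideal.
  rewrite -linearD -mulmxDr /lie_br !mulmxA PUE0 !mul0mx -[_ *m pr K U *m pr K U]mulmxA.
  by rewrite pr_id sub0r subrr mulmx0 linear0.
have {}xE : x = red_lift y - pr K U + pr K E *m x *m pr K U.
  rewrite -[LHS](addrK (pr K U)) {1}xE mulmxDr mulmxDl PEU0 mul0mx addr0.
  by rewrite addrAC.
exists y => //; split=> // w hw.
rewrite !tr_lift red_lift_br // -(xP (red_lift w)); last exact: sw_red_lift.
rewrite {1}xE (mxtr_brD f (red_lift y - _)) (mxtr_brD f (red_lift y)).
have -> : lie_br (- pr K U) (red_lift w) = 0.
  rewrite /lie_br /red_lift !mulNmx !mulmxN !(mulmxDl, mulmxDr) !mulmxA Ue !mul0mx add0r Ug.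
  by rewrite -!mulmxA eU g'U !mulmx0 add0r opprK addNr.
rewrite mulmx0 linear0 addr0 [X in _ + X]mxtr_brC red_lam_br ?red_lam_lift //.
  by rewrite mulmx0 linear0 oppr0 addr0.
exact: sw_red_lift.
Qed.

(** * Eigenvalues of the blocks of [x] and of [ad x] in terms of [y] *)

Section Spectrum.
Variables x y : 'M[K]_n.
Hypothesis xP : princ J p q f x.
Hypothesis hy : sw J' p' q y.
Hypothesis xE : x = red_lift y - pr K U + pr K E *m x *m pr K U.

Let hx : sw J p q x. Proof. by case: xP. Qed.

Let xUU : pr K U *m x *m pr K U = g *m y *m g' - pr K U.
Proof.
rewrite xE !(mulmxN, mulNmx, mulmxDr, mulmxDl) !mulmxA Ue PUE0 !mul0mx add0r.
by rewrite addr0 Ug -[_ *m g' *m pr K U]mulmxA g'U !pr_id.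
Qed.

Lemma red_bspecU z : bspec x U z = bspec y T (z + 1).
Proof.
apply/idP/idP.
  apply: (bspec_transfer (a := g') (b := g)).
  - by rewrite gg' pr_id.
  - by rewrite Tg'.
  - rewrite -!mulmxA (mulmxA (pr K U)) xUU mulmxBr !mulmxA g'U g'g scale1r subrK.
    by rewrite -[_ *m pr K U]mulmxA g'U.
rewrite -[in X in _ -> X](addrK 1 z) -[1]opprK opprK.
apply: (bspec_transfer (a := g) (b := g')).
- by rewrite g'g pr_id.
- by rewrite Ug.
rewrite gT -[_ *m g *m pr K T]mulmxA gT -{1}Ug mulmxA xUU mulmxBl -[_ *m g' *m g]mulmxA g'g Ug.
by rewrite scaleN1r.
Qed.

Lemma red_bspecD (S : {set 'I_n}) z : S \subset J :\: U -> bspec x S z = bspec y S z.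
Proof.
move=> SJU; have Se : pr K S *m e = pr K S by rewrite eE pr_sub.
have eS : e *m pr K S = pr K S by rewrite eE pr_sub'.
have SU : pr K S *m pr K U = 0 by rewrite -Se -mulmxA eU mulmx0.
have US : pr K U *m pr K S = 0 by rewrite -eS mulmxA Ue mul0mx.
apply: bspecE; rewrite xE /red_lift.
rewrite !(mulmxN, mulNmx, mulmxDr, mulmxDl) !mulmxA Se SU !mul0mx subr0.
rewrite -[_ *m e *m pr K S]mulmxA eS -Ug !mulmxA SU !mul0mx addr0.
by rewrite -[_ *m pr K U *m pr K S]mulmxA US mulmx0 addr0.
Qed.

Lemma red_bspecA z : bspec x (U :|: E) z = bspec x U z || bspec x E z.
Proof.
rewrite setUC bspec_setU 1?orbC //; first by rewrite disjoint_sym.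
by rewrite -rowU // -mulmxA PUE0 mulmx0.
Qed.

Lemma red_bspecT z : bspec y T z = bspec y C z || bspec y W z.
Proof.
rewrite TE setUC bspec_setU 1?orbC //; last first.
  by rewrite -eW mulmxA Cye // mul0mx.
by apply/pred0P => i /=; apply/negbTE/negP => /andP[/WP[_ _ /negP iU _ _] /memC[]].
Qed.

Lemma red_bspecE z : bspec y E z = bspec y Z z || bspec y W z.
Proof.
have -> : E = Z :|: W by rewrite WE -{1}(setID E Z) (setIidPr ZE).
rewrite bspec_setU //.
  by rewrite WE -setI_eq0 setIDA setDIl setDv set0I.
apply: pr_block0 => i j /WP[_ pi _ _ iZ] jZ /hy[_ _]; rewrite !p'E iZ jZ pi.
by have [_ -> _ _] := memEP (subsetP ZE _ jZ); rewrite addn0 addn1 ltnn.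
Qed.

(** Left inverse of [red_lift] that vanishes on the ideal: the projection from the kernel of [lam]
    to the smaller seaweed. *)
Let inv v := e *m v *m e + g' *m v *m pr K C.

Let invD v w : inv (v + w) = inv v + inv w.
Proof. by rewrite /inv !mulmxDr !mulmxDl addrACA. Qed.

Let invN m : inv (pr K E *m m *m pr K U) = 0.
Proof.
by rewrite /inv !mulmxA g'PE !mul0mx -[_ *m pr K U *m e]mulmxA Ue mulmx0 addr0.
Qed.

Let br_ideal v m : sw J p q v ->
  lie_br v (pr K E *m m *m pr K U) =
  pr K E *m (v *m pr K E *m m - m *m pr K U *m v) *m pr K U.
Proof.
move=> hv; rewrite /lie_br mulmxBr mulmxBl !mulmxA colE' //.
by rewrite -[_ *m pr K U *m v]mulmxA -(rowU hv) !mulmxA -[_ *m pr K U *m pr K U]mulmxA pr_id.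
Qed.

Let br_lift w : sw J' p' q w -> exists m,
  lie_br x (red_lift w) = red_lift (lie_br y w) + pr K E *m m *m pr K U.
Proof.
move=> hw; rewrite {1}xE (lie_brDl (red_lift y - _)) (lie_brDl (red_lift y)).
have -> : lie_br (- pr K U) (red_lift w) = 0.
  rewrite /lie_br /red_lift !mulNmx !mulmxN !(mulmxDl, mulmxDr) !mulmxA Ue !mul0mx add0r Ug.
  by rewrite -!mulmxA eU g'U !mulmx0 add0r opprK addNr.
rewrite addr0 -red_lift_br // [lie_br (_ *m _) _]lie_brC br_ideal; last exact: sw_red_lift.
by rewrite -mulNmx -mulmxN; eexists.
Qed.

Let inv_br w : sw J' p' q w -> inv (lie_br x (red_lift w)) = lie_br y w.
Proof.
move=> hw; have [m ->] := br_lift hw.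
by rewrite invD invN addr0 [LHS]red_lift_inv //; apply: sw_br.
Qed.

Let ideal_mul u : pr K E *m u *m pr K U = u ->
  pr K E *m x *m u = x *m u /\ u *m x *m pr K U = u *m x.
Proof.
move=> uEU; have Eu : pr K E *m u = u by rewrite -uEU !mulmxA pr_id.
have uU : u *m pr K U = u by rewrite -uEU -!mulmxA pr_id.
split; first by rewrite -[in LHS]Eu mulmxA colE' // -mulmxA Eu.
by rewrite -[in LHS]uU -!mulmxA (mulmxA (pr K U)) rowU // mulmxA uU.
Qed.

(** Invariance of the Kirillov form makes [lam u], if nonzero, an eigenvector of a Sylvester
    operator for [z - 1]. If [lam u] is zero, [u] is a lift plus an element of the ideal: either the
    lifted matrix is an eigenvector of [ad y], or it is zero and [u] itself lies in the ideal. *)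
Lemma red_swspec_sub z : swspec J p q x z -> swspec J' p' q y z \/
  exists c w, [/\ bspec x E c, bspec x U w & z = c - w \/ z = 1 - (c - w)].
Proof.
move=> [u [hu u0 ux]]; have [lu0|lu0] := eqVneq (lam u) 0; last first.
  right; suff [c [w [cU wE zE]]] : exists c w,
      [/\ bspec x U c, bspec x E w & z - 1 = c - w].
    exists w, c; split=> //; right.
    by rewrite -[LHS](subrK 1) zE opprB addrC.
  apply: (sylvester_spec lu0 (lamUE u)).
  apply/matrixP => i j; rewrite -[LHS]mxtr_delta -[RHS]mxtr_delta.
  set m := delta_mx j i.
  have h1 := red_lam_br m hu.
  have hn := @sw_ideal m; have [_ /(_ _ (sw_br hu hn))] := xP.
  set nn := pr K E *m m *m pr K U in h1 hn *.
  rewrite lie_jacobi ux lie_brZl (mulmxDr f (z *: _)) linearD /= -scalemxAr linearZ /=.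
  rewrite h1 [lie_br x nn]br_ideal // red_lam_br //.
  set t1 := \tr (m *m lam u).
  rewrite mulmxBl [\tr (_ - _)]linearB /=.
  have -> : \tr (x *m pr K E *m m *m lam u) = \tr (m *m (lam u *m x *m pr K E)).
    by rewrite -mulmxA mxtrace_mulC !mulmxA.
  have -> : \tr (m *m pr K U *m x *m lam u) = \tr (m *m (pr K U *m x *m lam u)).
    by rewrite !mulmxA.
  rewrite (mulmxBr m (pr K U *m x *m lam u)) linearB /= -scalemxAr linearZ /= -/t1 => h2.
  by rewrite mulrBl mul1r -[X in _ = _ - X]h2; ring.
have [w hw uE] := red_lam_fiber hu lu0.
have [w0|w0] := eqVneq w 0.
  right; have Eu : pr K E *m u *m pr K U = u.
    rewrite {2}uE w0 /red_lift !(mulmx0, mul0mx) !add0r //.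
  have [c [v [cE vU zE]]] : exists c w,
      [/\ bspec x E c, bspec x U w & z = c - w].
    by apply: (sylvester_spec u0 Eu); have [-> ->] := ideal_mul Eu; rewrite -ux.
  by exists c, v; split=> //; left.
left; exists w; split=> //.
rewrite -inv_br // -[in RHS](red_lift_inv hw) -/(inv _).
have -> : red_lift w = u - pr K E *m u *m pr K U by rewrite {1}uE addrK.
have invB v1 v2 : inv (v1 - v2) = inv v1 - inv v2.
  by rewrite invD /inv !(mulmxN, mulNmx) -opprD.
have -> : lie_br x (u - pr K E *m u *m pr K U) =
  lie_br x u - lie_br x (pr K E *m u *m pr K U) by rewrite linearB.
rewrite (invB (lie_br x u)) ux br_ideal // (invB u) !invN !subr0.
by rewrite /inv -!scalemxAr -!scalemxAl scalerDr.
Qed.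

Lemma red_swspec_sup1 c w : bspec x E c -> bspec x U w -> swspec J p q x (c - w).
Proof.
move=> /bspec_rank1 h /h[u [u0 uEU xu ux]]; exists u; split=> //.
  by rewrite -uEU; apply: sw_ideal.
by rewrite scalerBl -xu -ux; have [-> ->] := ideal_mul uEU.
Qed.

(** The lift of an eigenvector is one modulo the ideal. If [ad x - z] is injective on the ideal, it
    is onto there and the lift can be corrected; otherwise the ideal itself contains an eigenvector
    for [z]. *)
Lemma red_swspec_sup2 z : swspec J' p' q y z -> swspec J p q x z.
Proof.
move=> [w [hw w0 yw]].
pose pi : 'End('M[K]_n) := (linfun (mulmx (pr K E)) \o linfun (mulmxr (pr K U)))%VF.
pose h : 'End('M[K]_n) := linfun (lie_br x) - z *: \1%VF.
have piE v : pi v = pr K E *m v *m pr K U by rewrite comp_lfunE !lfunE /= mulmxA.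
have hE v : h v = lie_br x v - z *: v.
  by rewrite add_lfunE opp_lfunE scale_lfunE id_lfunE lfunE.
have [[v [v0 vE xv]]|nex] := pselect (exists v, [/\ v != 0, pr K E *m v *m pr K U = v
    & lie_br x v = z *: v]).
  by exists v; split=> //; rewrite -vE; apply: sw_ideal.
have hpi v : pi v = v -> pi (h v) = h v.
  rewrite piE => pv.
  have -> : h v = pr K E *m (x *m pr K E *m v - v *m pr K U *m x - z *: v) *m pr K U.
    by rewrite hE mulmxBr mulmxBl -br_ideal // -scalemxAr -scalemxAl pv.
  by rewrite piE !mulmxA pr_id -mulmxA pr_id.
have [m mE] := br_lift hw.
have {}mE : lie_br x (red_lift w) - z *: red_lift w = pr K E *m m *m pr K U.
  rewrite mE yw addrAC; suff -> : red_lift (z *: w) = z *: red_lift w.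
    by rewrite subrr add0r.
  by rewrite /red_lift -!scalemxAr -!scalemxAl scalerDr.
have [||||v piv hv] := @fixed_surj _ _ pi h _ _ _ (lie_br x (red_lift w) - z *: red_lift w).
- by move=> v; rewrite !piE !mulmxA pr_id -mulmxA pr_id.
- exact: hpi.
- move=> v; rewrite piE hE => pv /eqP; rewrite subr_eq0 => /eqP xv.
  by apply/eqP; apply: contra_notT nex => v0; exists v.
- by rewrite piE mE !mulmxA pr_id -mulmxA pr_id.
exists (red_lift w - v); split.
- apply: swB; first exact: sw_red_lift.
  by rewrite -piv piE; apply: sw_ideal.
- apply: contraNneq w0 => uv; have := red_lift_inv hw; rewrite -/(inv _).
  have -> : red_lift w = v by apply/eqP; rewrite -subr_eq0 uv.
  by rewrite -piv piE invN => <-.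
have -> : lie_br x (red_lift w - v) = lie_br x (red_lift w) - lie_br x v by rewrite linearB.
move: hv; rewrite hE => /eqP; rewrite -subr_eq0 => /eqP hv.
apply/eqP; rewrite -subr_eq0 scalerBr -[X in _ == X]oppr0 -hv.
move: (lie_br x v) (lie_br x (red_lift w)) (z *: v) (z *: red_lift w) => m1 m2 m3 m4.
by apply/eqP/matrixP => i j; rewrite !mxE; ring.
Qed.

End Spectrum.

Lemma red_good x : compat J p q -> princ J p q f x -> U != set0 -> E != set0 ->
  (forall y, (#|J'| < #|J|)%N -> J' != set0 -> compat J' p' q ->
     frob J' p' q f' -> princ J' p' q f' y -> good J' p' q y) -> good J p q x.
Proof.
move=> cJ xP /set0Pn[i iU] /set0Pn[j jE] IH.
have [y yP xE] := red_princ xP; have [hy _] := yP; have [hx _] := xP.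
have CZ0 : C = set0 \/ Z = set0.
  have [->|[k kC]] := set_0Vmem C; first by left.
  have [->|[l lZ]] := set_0Vmem Z; first by right.
  by case: (red_CZ kC lZ).
(* If [W] were empty, [phi] would vanish, so that [C = U] and [Z = E], both nonempty, against
   [red_CZ]. *)
have W0 : W != set0.
  apply/eqP => W0; have phi0 : phi = 0 by rewrite -phiW W0 pr0 mulmx0.
  have V0 : V = set0 by apply/eqP; rewrite -(pr_eq0 K) -phith phi0 mul0mx.
  have iC : i \in C.
    by move/setP/(_ i): V0; rewrite VE !inE iU andbT => /negbFE.
  have jZ : j \in Z.
    by move/setP/(_ j): W0; rewrite WE !inE jE andbT => /negbFE.
  exact: (red_CZ iC jZ).
have [w wW] := set0Pn _ W0; have [wJ _ wU _ _] := WP wW.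
apply: (good_step_comb (J' := J') (U := U) (E := E) (C := C) (Z := Z) (W := W)
  (T := T) (p' := p') (a := a) (b := b) (y := y)) => //.
- by rewrite J'E VE.
- exact: red_bspecU.
- exact: red_bspecD.
- exact: red_bspecA.
- exact: red_bspecT.
- exact: red_bspecE.
- exact: red_swspec_sub.
- exact: red_swspec_sup1.
- exact: red_swspec_sup2.
(* A matrix unit of the ideal is the required nonscalar element. *)
- move=> z; apply: (swspec_sym frobf xP (@sw_ideal (delta_mx j i))) => c nE.
  have /matrixP/(_ j i) : pr K E *m (delta_mx j i : 'M[K]_n) *m pr K U = 0.
    have <- : pr K E *m (pr K E *m delta_mx j i *m pr K U) *m pr K U =
        pr K E *m delta_mx j i *m pr K U.
      by rewrite !mulmxA pr_id -mulmxA pr_id.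
    rewrite nE -scalemxAr -scalemxAl PJ mulmxDr mulmxDl -!mulmxA eU pr_id PEU0.
    by rewrite mulmx0 addr0 scaler0.
  by rewrite pr_delta // delta_pr // !mxE !eqxx => /eqP; rewrite oner_eq0.
(* The identity of the smaller algebra is central, which gives the eigenvalue 0. *)
- exists (pr K J'); split; first exact: sw_pr.
    by rewrite pr_eq0; apply/set0Pn; exists w; rewrite memJ' wJ (negPf wU).
  by have [J'y yJ'] := sw_corner hy; rewrite /lie_br J'y yJ' subrr scale0r.
have V0 : V != set0.
  apply: contraNneq W0 => V0; rewrite -(pr_eq0 K) -thphi -Vphi V0 pr0 mul0mx mulmx0.
  by rewrite eqxx.
apply: IH => //; [|by apply/set0Pn; exists w; rewrite memJ' wJ (negPf wU)|exact: red_compat|exact: red_frob].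
have /set0Pn[v vV] := V0; apply: proper_card; apply/properP; rewrite J'E.
split; first exact: subsetDl.
exists v; last by rewrite !inE vV.
by move: vV; rewrite VE inE => /andP[_]; rewrite memU => /andP[].
Qed.

End Reduction.

(** * Principal elements satisfy the invariant *)

Section Main.
Variables (K : numClosedFieldType) (n : nat).
Implicit Types (J : {set 'I_n}) (p q : 'I_n -> nat) (f u v x k l : 'M[K]_n).

Lemma br_conj J p q k l u v : sw J p q u -> sw J p q v -> l *m k = pr K J ->
  lie_br (k *m u *m l) (k *m v *m l) = k *m lie_br u v *m l.
Proof.
move=> hu hv lk; have [_ uJ] := sw_corner hu; have [_ vJ] := sw_corner hv.
rewrite /lie_br mulmxBr mulmxBl !mulmxA -[_ *m l *m k]mulmxA lk.
rewrite -[k *m u *m pr K J]mulmxA uJ -[k *m v *m l *m k]mulmxA lk.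
by rewrite -[k *m v *m pr K J]mulmxA vJ.
Qed.

Lemma mxtr_conj f k l u : \tr (l *m f *m k *m u) = \tr (f *m (k *m u *m l)).
Proof. by rewrite -!mulmxA mxtrace_mulC !mulmxA. Qed.

Lemma conjK J p q k l u : sw J p q u -> k *m l = pr K J ->
  k *m (l *m u *m k) *m l = u.
Proof.
move=> hu kl; have [Ju uJ] := sw_corner hu.
by rewrite !mulmxA kl Ju -mulmxA kl uJ.
Qed.

Lemma frob_conj J p q f k l : sw J p q k -> sw J p q l -> k *m l = pr K J ->
  l *m k = pr K J -> frob J p q f -> frob J p q (l *m f *m k).
Proof.
move=> hk hl kl lk fP u hu h.
have [v hv|c uE] := fP _ (sw_mul (sw_mul hk hu) hl).
  have hv' := sw_mul (sw_mul hl hv) hk.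
  rewrite -(conjK hv kl) (br_conj hu hv' lk) -mxtr_conj; exact: h.
exists c; rewrite -(conjK hu lk) uE -scalemxAr -scalemxAl.
by have [_ ->] := sw_corner hl; rewrite lk.
Qed.

Lemma princ_conj J p q f x k l : sw J p q k -> sw J p q l -> k *m l = pr K J ->
  l *m k = pr K J -> princ J p q f x ->
  princ J p q (l *m f *m k) (l *m x *m k).
Proof.
move=> hk hl kl lk [hx xP]; have hy := sw_mul (sw_mul hl hx) hk.
split=> // v hv; rewrite !mxtr_conj -(br_conj hy hv lk) (conjK hx kl).
by apply: xP; apply: (sw_mul (sw_mul hk hv) hl).
Qed.

Lemma good_step J p q f x i0 : compat J p q -> frob J p q f -> princ J p q f x ->
  i0 \in J -> (forall j, j \in J -> (p i0 <= p j)%N /\ (q i0 <= q j)%N) ->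
  blk J q i0 \proper blk J p i0 ->
  (forall J' p' q' f' y, (#|J'| < #|J|)%N -> J' != set0 -> compat J' p' q' ->
     frob J' p' q' f' -> princ J' p' q' f' y -> good J' p' q' y) ->
  good J p q x.
Proof.
move=> cJ fP xP i0J imin pr_qp IH.
set U := blk J q i0; set E := blk J p i0 :\: U.
have UA : U \subset blk J p i0 by apply: proper_sub.
have UJ : U \subset J by apply/subsetP => i; rewrite inE => /andP[].
have EJ : E \subset J by apply/subsetP => i; rewrite !inE => /andP[_ /andP[]].
have dUE : [disjoint U & E] by rewrite -setI_eq0 setIDA setDIl setDv set0I.
pose phi0 := pr K U *m f *m pr K E.
have phi0E : phi0 *m pr K E = phi0 by rewrite /phi0 -mulmxA pr_id.
have Uphi0 : pr K U *m phi0 = phi0 by rewrite /phi0 !mulmxA pr_id.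
have phi0d : phi0 = pr K U *m f *m pr K E by [].
clearbody phi0.
have [k1 [l1 [[k1E l1E k1l1 l1k1] [k1q l1q [Z [th1 [ZE phiZ th1phi]]]]]]] :=
  column_reduction q phi0E.
(* The set [U] lies in one block of [p] and in one block of [q], so all row operations on it stay in
   the algebra: hence the constant order, applied to the transpose. *)
have [|k2 [l2 [[k2U l2U k2l2 l2k2] [_ _ [C [th2 [CU phiC th2phi]]]]]]] :=
  @column_reduction K n (fun=> 0%N) U (phi0 *m k1)^T.
  by rewrite -{1}[pr K U]tr_pr -trmx_mul mulmxA Uphi0.
pose R := J :\: (U :|: E).
have dRU : [disjoint R & U].
  by apply/pred0P => i /=; rewrite /R in_setD in_setU; case: (i \in U); rewrite ?andbF.
pose k := l2^T + k1 + pr K R; pose l := k2^T + l1 + pr K R.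
have UT (m : 'M[K]_n) : pr K U *m m *m pr K U = m -> pr K U *m m^T *m pr K U = m^T.
  by move=> mU; rewrite -{2}mU !trmx_mul tr_pr mulmxA.
have k2T := UT _ k2U; have l2T := UT _ l2U.
have swU (m : 'M[K]_n) : pr K U *m m *m pr K U = m -> sw J p q m.
  move=> mU i j /(corner_sup mU)[]; rewrite !inE => /andP[iJ /eqP qi] /andP[jJ /eqP qj].
  have [iU jU] : i \in U /\ j \in U by rewrite !inE iJ jJ qi qj !eqxx.
  have := subsetP UA _ jU; have := subsetP UA _ iU; rewrite !inE.
  by move=> /andP[_ /eqP->] /andP[_ /eqP->]; rewrite iJ jJ qi qj.
have swE (m : 'M[K]_n) : pr K E *m m *m pr K E = m ->
    (forall i j, m i j != 0 -> (q j <= q i)%N) -> sw J p q m.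
  move=> mE mq i j mij; have [] := corner_sup mE mij; rewrite !inE.
  by move=> /and3P[_ iJ /eqP->] /and3P[_ jJ /eqP->]; split=> //; apply: mq.
have RJ : R \subset J by apply: subsetDl.
have hk : sw J p q k by do 2?apply: swD; [exact: swU|exact: swE|exact: sw_pr].
have hl : sw J p q l by do 2?apply: swD; [exact: swU|exact: swE|exact: sw_pr].
have PR : pr K R = pr K J - (pr K U + pr K E).
  by rewrite /R pr_setD ?subUset ?UJ // pr_setU.
have UE0 : pr K U *m pr K E = 0 by apply: pr_disj.
have EU0 : pr K E *m pr K U = 0 by apply: pr_disj; rewrite disjoint_sym.
have PRU : pr K R *m pr K U = 0 by apply: pr_disj.
have PUR : pr K U *m pr K R = 0 by apply: pr_disj; rewrite disjoint_sym.
have dRE : [disjoint R & E].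
  by apply/pred0P => i /=; rewrite /R in_setD in_setU; case: (i \in E); rewrite ?orbT ?andbF.
have PRE : pr K R *m pr K E = 0 by apply: pr_disj.
have PER : pr K E *m pr K R = 0 by apply: pr_disj; rewrite disjoint_sym.
have inv m1 m2 m3 m4 : pr K U *m m1 *m pr K U = m1 -> pr K U *m m2 *m pr K U = m2 ->
    pr K E *m m3 *m pr K E = m3 -> pr K E *m m4 *m pr K E = m4 ->
    m1 *m m2 = pr K U -> m3 *m m4 = pr K E ->
    (m1 + m3 + pr K R) *m (m2 + m4 + pr K R) = pr K J.
  have zz (m m' : 'M[K]_n) S T : m *m pr K S = m -> pr K T *m m' = m' ->
      pr K S *m pr K T = 0 -> m *m m' = 0.
    by move=> <- <- h; rewrite -mulmxA (mulmxA (pr K S)) h mul0mx mulmx0.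
  have lc S (m : 'M[K]_n) : pr K S *m m *m pr K S = m -> pr K S *m m = m.
    by move=> <-; rewrite !mulmxA pr_id.
  have rc S (m : 'M[K]_n) : pr K S *m m *m pr K S = m -> m *m pr K S = m.
    by move=> <-; rewrite -!mulmxA pr_id.
  move=> h1 h2 h3 h4 h12 h34; rewrite !(mulmxDl, mulmxDr) h12 h34 pr_id.
  rewrite (zz m1 m4 _ _ (rc _ _ h1) (lc _ _ h4)) // (zz m3 m2 _ _ (rc _ _ h3) (lc _ _ h2)) //.
  rewrite (zz m1 _ _ _ (rc _ _ h1) (pr_id _ _) PUR) (zz m3 _ _ _ (rc _ _ h3) (pr_id _ _) PER).
  rewrite (zz _ m2 _ _ (pr_id _ _) (lc _ _ h2) PRU) (zz _ m4 _ _ (pr_id _ _) (lc _ _ h4) PRE).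
  by rewrite !addr0 !add0r PR addrC subrK.
have kl : k *m l = pr K J.
  by apply: inv => //; rewrite -trmx_mul k2l2 tr_pr.
have lk : l *m k = pr K J.
  by apply: inv => //; rewrite -trmx_mul l2k2 tr_pr.
have Ul : pr K U *m l = k2^T.
  rewrite /l !mulmxDr PUR addr0 -k2T -l1E !mulmxA pr_id UE0 !mul0mx addr0 //.
have kE : k *m pr K E = k1.
  rewrite /k !mulmxDl PRE addr0 -l2T -k1E -!mulmxA pr_id UE0 !mulmx0 add0r //.
have hx : sw J p q x by case: xP.
rewrite -(conjK hx kl); apply: (good_conj hk hl _ kl lk).
  exact: (sw_mul (sw_mul hl hx) hk).
pose f1 := l *m f *m k; pose phi := pr K U *m f1 *m pr K E.
have phiEq : phi = k2^T *m phi0 *m k1.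
  have k2U' : k2^T *m pr K U = k2^T by rewrite -k2T -!mulmxA pr_id.
  have Ek1 : pr K E *m k1 = k1 by rewrite -k1E !mulmxA pr_id.
  rewrite /phi /f1 phi0d !mulmxA Ul -mulmxA kE k2U'.
  by rewrite -[_ *m pr K E *m k1]mulmxA Ek1.
have phid : phi = pr K U *m f1 *m pr K E by [].
have Uphi : pr K U *m phi = phi by rewrite phid !mulmxA pr_id.
have phiE : phi *m pr K E = phi by rewrite phid -mulmxA pr_id.
clearbody phi; pose W := E :\: Z; pose V := U :\: C.
pose th := pr K W *m th1 *m l2^T *m pr K V.
have phiZ0 : phi *m pr K Z = 0 by rewrite phiEq -!mulmxA (mulmxA phi0) phiZ mulmx0.
have phiC0 : pr K C *m phi = 0.
  apply: trmx_inj; rewrite trmx_mul tr_pr trmx0 phiEq -mulmxA trmx_mul trmxK.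
  exact: phiC.
have phiVW : pr K V *m phi *m pr K W = phi.
  rewrite /V /W (pr_setD _ CU) (pr_setD _ ZE) mulmxBl Uphi phiC0 subr0 mulmxBr.
  by rewrite phiE phiZ0 subr0.
have thWV : pr K W *m th *m pr K V = th by rewrite /th !mulmxA pr_id -mulmxA pr_id.
have thphi : th *m phi = pr K W.
  have Vphi : pr K V *m phi = phi by rewrite -phiVW !mulmxA pr_id.
  rewrite /th -mulmxA Vphi phiEq !mulmxA -[_ *m l2^T *m k2^T]mulmxA -trmx_mul k2l2 tr_pr.
  rewrite -[_ *m pr K U *m phi0]mulmxA Uphi0 -!mulmxA th1phi pr_id //.
(* The column reduction gives a left inverse of [phi], the row reduction a right inverse; the two
   sides together make [th] two-sided. *)
clearbody th; have phith : phi *m th = pr K V.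
  have phiW : phi *m pr K W = phi by rewrite -phiVW -!mulmxA pr_id.
  have th2E : phi *m th2^T = pr K V.
    by rewrite -[RHS]tr_pr -th2phi trmx_mul (trmx_mul _ k2) trmxK phiEq !mulmxA.
  have thV : th *m pr K V = th by rewrite -thWV -!mulmxA pr_id.
  by rewrite -thV -{1}th2E (mulmxA th) thphi mulmxA phiW.
have f1P : frob J p q f1 by exact: frob_conj.
have x1P : princ J p q f1 (l *m x *m k) by exact: princ_conj.
have [A0 pE] := properP pr_qp; case: pE => j jp jq.
apply: (@red_good K n J U E C Z p q (p i0) (q i0) f1 th _ _ _ _ _ CU ZE V W
  (J :\: V) (C :|: W) (fun i => ((p i).*2 + (i \notin Z))%N) phi (pr K (J :\: U))
  (pr K C + phi) (pr K C + th)) => //.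
- by move=> i /imin[].
- by move=> i /imin[].
- by move=> i; rewrite inE.
- by move=> i /(subsetP UA); rewrite inE => /andP[_ /eqP].
- by move=> i; rewrite !inE; case: (i \in J) => //=; rewrite andbC.
- by apply/set0Pn; exists i0; rewrite inE i0J eqxx.
- by apply/set0Pn; exists j; rewrite inE jp andbT.
by move=> y; apply: IH.
Qed.

Lemma good_principal J p q f x : J != set0 -> compat J p q -> frob J p q f ->
  princ J p q f x -> good J p q x.
Proof.
have [m] := ubnP #|J|; elim: m J p q f x => // m IH J p q f x hm J0 cJ fP xP.
have IH' J' p' q' f' y : (#|J'| < #|J|)%N -> J' != set0 -> compat J' p' q' ->
    frob J' p' q' f' -> princ J' p' q' f' y -> good J' p' q' y.
  by move=> hJ'; apply: IH; apply: leq_trans hJ' _.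
have /set0Pn[j0 j0J] := J0.
have [i1 i1J i1min] : exists2 i, i \in J & forall j, j \in J -> (p i <= p j)%N.
  by case: (@arg_minnP _ j0 (mem J) p j0J) => i; exists i.
have [i2 i2J i2min] : exists2 i, i \in J & forall j, j \in J -> (q i <= q j)%N.
  by case: (@arg_minnP _ j0 (mem J) q j0J) => i; exists i.
(* If [p i1 < p i2], then [compat] bounds [q i1] by the minimum [q i2]; otherwise [i2] is minimal
   for [p] too. *)
have [i0 i0J imin] : exists2 i, i \in J &
    forall j, j \in J -> (p i <= p j)%N /\ (q i <= q j)%N.
  have [h|h] := ltnP (p i1) (p i2).
    exists i1 => // j jJ; split; first exact: i1min.
    by apply: leq_trans (cJ _ _ i1J i2J h) _; apply: i2min.
  exists i2 => // j jJ; split; last exact: i2min.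
  by apply: leq_trans h _; apply: i1min.
have [pq|npq] := eqVneq (blk J p i0) (blk J q i0); first exact: (good_base fP xP i0J imin pq).
have [qp|nqp] := boolP (blk J q i0 \subset blk J p i0).
  apply: (good_step cJ fP xP i0J imin) => //.
  by rewrite properEneq qp eq_sym npq.
(* An index of the [q]-block with larger [p] is compared by [compat] with every index of the
   [p]-block, which forces these to be [q]-minimal. The inclusion is thus reversed, and
   transposition leads back to the case treated. *)
have pqs : blk J p i0 \subset blk J q i0.
  apply/subsetP => j; rewrite !inE => /andP[jJ /eqP pj]; rewrite jJ /=.
  have /subsetPn[l] := nqp; rewrite !inE => /andP[lJ /eqP ql]; rewrite lJ /= => pl.
  have /cJ h : (p j < p l)%N by rewrite pj ltn_neqAle eq_sym pl; case: (imin l lJ).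
  by rewrite eqn_leq -{1}ql h //; case: (imin j jJ).
apply: good_tr.
apply: (@good_step J q p f^T (- x^T) i0) => //.
- move=> i j iJ jJ qij; rewrite leqNgt; apply/negP => /(cJ _ _ jJ iJ).
  by rewrite leqNgt qij.
- exact: frob_tr.
- exact: princ_tr.
- by move=> j jJ; split; case: (imin j jJ).
by rewrite properEneq npq.
Qed.
End Main.

(** * Lie's theorem *)

Section LieTheorem.
Variable K : numClosedFieldType.

Lemma lie_brv_sub n (U V U' V' : {vspace 'M[K]_n}) : (U <= U')%VS -> (V <= V')%VS ->
  (lie_brv U V <= lie_brv U' V')%VS.
Proof.
move=> /subvP UU' /subvP VV'; apply/lie_brv_subP => A B /UU' AU' /VV' BV'.
by apply: (lie_brv_subP _ _ _).2 AU' BV'.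
Qed.

Lemma mem_lie_brv n (U V : {vspace 'M[K]_n}) A B : A \in U -> B \in V ->
  lie_br A B \in lie_brv U V.
Proof. by move=> AU BV; apply: (lie_brv_subP _ _ _).2 AU BV. Qed.

Lemma lie_derived_sub n (U V : {vspace 'M[K]_n}) k : (U <= V)%VS ->
  (iter k (fun W => lie_brv W W) U <= iter k (fun W => lie_brv W W) V)%VS.
Proof. by move=> UV; elim: k => //= k IH; apply: lie_brv_sub. Qed.

Lemma lie_solvable_sub n (U V : {vspace 'M[K]_n}) : (U <= V)%VS ->
  lie_solvable V -> lie_solvable U.
Proof.
move=> UV [k Vk]; exists k; apply/eqP; rewrite -subv0 -Vk; exact: lie_derived_sub.
Qed.

Lemma lie_solvable_derived n (U : {vspace 'M[K]_n}) : lie_solvable U ->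
  (U <= lie_brv U U)%VS -> U = 0%VS.
Proof.
move=> [k Uk] UU; apply/eqP; rewrite -subv0 -Uk {Uk}.
elim: k => //= k IH; apply: subv_trans UU _; exact: lie_brv_sub.
Qed.

Section Krylov.
Variables (n : nat) (H : {vspace 'M[K]_n}) (z : 'M[K]_n) (la : 'M[K]_n -> K) (w : 'rV[K]_n).
Hypothesis Hz : forall u, u \in H -> lie_br u z \in H.
Hypothesis wla : forall u, u \in H -> w *m u = la u *: w.

Let zw k := iter k (fun v => v *m z) w.
Let kry k : {vspace 'rV[K]_n} := <<mkseq zw k>>%VS.

Let kry_mem k j : (j < k)%N -> zw j \in kry k.
Proof. by move=> jk; apply: memv_span; apply/mapP; exists j; rewrite ?mem_iota. Qed.

Let krySP k (V : {vspace 'rV[K]_n}) :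
  (forall j, (j < k)%N -> zw j \in V) -> (kry k <= V)%VS.
Proof.
by move=> h; apply/span_subvP => v /mapP[j]; rewrite mem_iota => /andP[_ jk] ->; apply: h.
Qed.

Let kry_le k l : (k <= l)%N -> (kry k <= kry l)%VS.
Proof. by move=> kl; apply: krySP => j jk; apply: kry_mem; apply: leq_trans jk kl. Qed.

Let kry_mul k (y : 'M[K]_n) (V : {vspace 'rV[K]_n}) :
  (forall j, (j < k)%N -> zw j *m y \in V) -> forall v, v \in kry k -> v *m y \in V.
Proof.
move=> h v vk; pose f : 'Hom('rV[K]_n, 'rV[K]_n) := linfun (mulmxr y).
have : (f @: kry k <= V)%VS.
  rewrite limg_span; apply/span_subvP => v' /mapP[v'' /mapP[j jk ->] ->].
  by rewrite lfunE /=; apply: h; move: jk; rewrite mem_iota => /andP[].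
by move/subvP/(_ (f v)); rewrite lfunE /=; apply; rewrite -[v *m y](lfunE (mulmxr y)) memv_img.
Qed.

Let kry_z k v : v \in kry k -> v *m z \in kry k.+1.
Proof. by apply: kry_mul => j jk; exact: (@kry_mem k.+1 j.+1). Qed.

(* On the vectors [w *m z ^+ k], each [u] in [H] acts triangularly with diagonal
   [la u] and next coefficient [- k * la [u, z]]; if [la [u, z]] were nonzero, all
   these vectors would be independent. *)
Lemma krylov_tri k u : u \in H -> zw k *m u - la u *: zw k \in kry k.
Proof.
elim: k u => [|k IH] u uH; first by rewrite /= wla // subrr mem0v.
have -> : zw k.+1 *m u = zw k *m u *m z - zw k *m lie_br u z.
  by rewrite /= /lie_br mulmxBr !mulmxA opprB addrC subrK.
have uzH := Hz uH.
have -> : zw k *m u *m z - zw k *m lie_br u z - la u *: zw k.+1 =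
  (zw k *m u - la u *: zw k) *m z - (zw k *m lie_br u z - la (lie_br u z) *: zw k)
   - la (lie_br u z) *: zw k.
  rewrite [zw k.+1]/= mulmxBl -scalemxAl.
  move: (zw k *m u *m z) (zw k *m lie_br u z) (zw k *m z) => v1 v2 v3.
  by apply/rowP => i; rewrite !mxE; ring.
apply: rpredB; last by apply: memvZ; apply: kry_mem.
apply: rpredB; first by apply: kry_z; apply: IH.
by apply: (subvP (kry_le (leqnSn k))); apply: IH.
Qed.

Lemma krylov_step k u : u \in H ->
  zw k.+1 *m u - la u *: zw k.+1 + (k.+1%:R * la (lie_br u z)) *: zw k \in kry k.
Proof.
move=> uH; have uzH := Hz uH; have zuE k' : zw k'.+1 *m u = zw k' *m u *m z - zw k' *m lie_br u z.
  by rewrite /= /lie_br mulmxBr !mulmxA opprB addrC subrK.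
elim: k => [|k IH].
  rewrite zuE /zw /= (wla uH) (wla uzH) -scalemxAl mul1r addrAC subrK subrr; exact: mem0v.
have -> : zw k.+2 *m u - la u *: zw k.+2 + (k.+2%:R * la (lie_br u z)) *: zw k.+1 =
  (zw k.+1 *m u - la u *: zw k.+1 + (k.+1%:R * la (lie_br u z)) *: zw k) *m z
  - (zw k.+1 *m lie_br u z - la (lie_br u z) *: zw k.+1).
  rewrite zuE mulmxDl mulmxBl -!scalemxAl -[zw k *m z]/(zw k.+1) -[zw k.+1 *m z]/(zw k.+2).
  move: (zw k.+1 *m u *m z) (zw k.+1 *m lie_br u z) (zw k.+1) (zw k.+2) => v1 v2 v3 v4.
  by apply/rowP => i; rewrite !mxE -[k.+2%:R]natr1; ring.
by apply: rpredB; [apply: kry_z|apply: krylov_tri].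
Qed.

Lemma krylov_weight u : w != 0 -> u \in H -> la (lie_br u z) = 0.
Proof.
move=> w0 uH; apply/eqP; apply/idPn => mu0.
(* If [zw k.+1] were in [kry k.+1], applying [u - la u] would put a multiple of [zw k] into [kry k];
   its coefficient is nonzero in characteristic zero. *)
have nk k : zw k \notin kry k.
  elim: k => [|k]; first by rewrite /kry span_nil memv0.
  apply: contra => zk; have zD : zw k.+1 *m (u - (la u)%:M) \in kry k.
    apply: (kry_mul _ zk) => j jk; rewrite mulmxBr mul_mx_scalar.
    by apply: (subvP (kry_le (ltnSE jk))); apply: krylov_tri.
  have := krylov_step k uH; rewrite -mul_mx_scalar -mulmxBr => h.
  have := rpredB h zD; rewrite addrAC subrr add0r rpredZeq mulf_eq0 (negPf mu0).
  by rewrite pnatr_eq0.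
have dk k : \dim (kry k) = k.
  elim: k => [|k IH]; first by rewrite /kry span_nil dimv0.
  have -> : kry k.+1 = (kry k + <[zw k]>)%VS.
    by rewrite /kry mkseqS -cats1 span_cat span_seq1.
  rewrite dimv_disjoint_sum ?IH ?dim_vline.
    have -> : zw k != 0 by apply: contraNneq (nk k) => ->; rewrite mem0v.
    by rewrite addn1.
  apply/eqP; rewrite -subv0; apply/subvP => v; rewrite memv_cap memv0 => /andP[vk /vlineP[c vE]].
  move: vk; rewrite vE rpredZeq (negPf (nk k)) orbF => /eqP->.
  by rewrite scale0r.
have := dimvS (subvf (kry n.+1)); rewrite dk dimvf /dim /= mul1n ltnn //.
Qed.

End Krylov.

(** Meant for [D] the derived algebra of [U]: every subspace between them is then an ideal, so [H]
    is an ideal to which induction applies, with [z] the missing direction. *)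
Lemma hyperplane_above (V : vectType K) (D U : {vspace V}) : (D <= U)%VS -> D != U ->
  exists H z, [/\ (D <= H)%VS, (H <= U)%VS, (\dim H < \dim U)%N, z \in U &
                  (U <= H + <[z]>)%VS].
Proof.
move=> DU nDU; have [z zU zD] : exists2 z, z \in U & z \notin D.
  apply/subvPn; apply: contra nDU => UD.
  by rewrite eqEsubv DU UD.
pose X := (D + <[z]>)%VS; have XU : (X <= U)%VS.
  by rewrite subv_add DU -memvE.
exists (D + (U :\: X))%VS, z; split=> //.
- exact: addvSl.
- by rewrite subv_add DU diffvSl.
- have dX : \dim X = (\dim D).+1.
    rewrite dimv_disjoint_sum ?dim_vline.
      have -> : z != 0 by apply: contraNneq zD => ->; rewrite mem0v.
      by rewrite addn1.
    apply/eqP; rewrite -subv0; apply/subvP => v.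
    rewrite memv_cap memv0 => /andP[vD /vlineP[c vE]].
    by move: vD; rewrite vE rpredZeq (negPf zD) orbF => /eqP->; rewrite scale0r.
  have := dimv_cap_compl U X; rewrite (capv_idPr XU) dX => <-.
  apply: leq_ltn_trans (dimv_add_leqif _ _) _.
  by rewrite addSn ltnS.
have := addv_diff_cap U X; rewrite (capv_idPr XU) => {1}<-.
rewrite subv_add; apply/andP; split.
  by apply: subv_trans (addvSr D _) (addvSl _ _).
by rewrite subv_add addvSr andbT; apply: subv_trans (addvSl D _) (addvSl _ _).
Qed.

(** The vectors of weight [la] for the ideal [H] are stable under [z], because [la] vanishes on the
    brackets with [z] ([krylov_weight]); an eigenvector of [z] among them is common to [U]. *)
Lemma lie_common_eigenvector n (U : {vspace 'M[K]_n.+1}) :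
  lie_closed U -> lie_solvable U ->
  exists2 v : 'rV[K]_n.+1, v != 0 & forall u, u \in U -> exists c, v *m u = c *: v.
Proof.
have [m] := ubnP (\dim U); elim: m U => // m IH U hm cU sU.
have [->|U0] := eqVneq U 0%VS.
  exists (delta_mx 0 0); first by apply/rV0Pn; exists 0; rewrite mxE !eqxx oner_eq0.
  by move=> u; rewrite memv0 => /eqP->; exists 0; rewrite mulmx0 scale0r.
have DU : (lie_brv U U <= U)%VS by apply/lie_brv_subP.
have nDU : lie_brv U U != U.
  by apply: contraNneq U0 => UU; rewrite (lie_solvable_derived sU) // UU subvv.
have [H [z [DH HU dH zU UE]]] := hyperplane_above DU nDU.
have ideal u v : u \in U -> v \in U -> lie_br u v \in H.
  by move=> uU vU; apply: (subvP DH); apply: mem_lie_brv.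
have [|||v v0 vH] := IH H.
- by apply: leq_trans dH _; rewrite -ltnS.
- by move=> u1 u2 u1H u2H; apply: ideal; apply: (subvP HU).
- exact: lie_solvable_sub sU.
have [i vi] := rV0Pn _ v0.
pose la (u : 'M[K]_n.+1) := (v *m u) 0 i / v 0 i.
have vla u : u \in H -> v *m u = la u *: v.
  by move=> /vH[c vu]; rewrite /la vu mxE mulfK.
pose P (w : 'rV[K]_n.+1) := forall u, u \in H -> w *m u = la u *: w.
have Pstep w r : P w -> P (w *m (z - r%:M)).
  move=> Pw; have [->|w0] := eqVneq w 0; first by move=> u _; rewrite !mul0mx scaler0.
  move=> u uH; have uzH : lie_br u z \in H by apply: ideal => //; apply: (subvP HU).
  have mu0 : la (lie_br u z) = 0.
    apply: (@krylov_weight _ H z la w _ Pw u w0 uH) => u' u'H.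
    by apply: ideal => //; apply: (subvP HU).
  have := Pw _ uzH; rewrite mu0 scale0r /lie_br mulmxBr => /eqP.
  rewrite subr_eq0 !mulmxA => /eqP wuz.
  rewrite mulmxBr mul_mx_scalar mulmxBl -wuz (Pw _ uH) -!scalemxAl (Pw _ uH) scalerBr.
  by rewrite !scalerA [r * _]mulrC.
have [w [r [Pw w0 wz]]] := stable_eigen (P := P) vla v0 Pstep.
exists w => // u /(subvP UE) /memv_addP[u1 u1H [_ /vlineP[c ->] ->]].
by exists (la u1 + c * r); rewrite mulmxDr Pw // -scalemxAr wz scalerA scalerDl.
Qed.

(** Restricted to [U] because the map in view, extraction of the lower right block, is
    multiplicative only on matrices that stabilise a given line. *)
Definition lie_hom m n (f : 'M[K]_m -> 'M[K]_n) (U : {vspace 'M[K]_m}) :=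
  forall A B, A \in U -> B \in U -> f (lie_br A B) = lie_br (f A) (f B).

Lemma lie_closed_img m n (f : 'Hom('M[K]_m, 'M[K]_n)) (U : {vspace 'M[K]_m}) :
  lie_closed U -> lie_hom f U -> lie_closed (f @: U).
Proof.
move=> cU hf _ _ /memv_imgP[A AU ->] /memv_imgP[B BU ->].
by rewrite -hf // memv_img // cU.
Qed.

Lemma lie_solvable_img m n (f : 'Hom('M[K]_m, 'M[K]_n)) (U : {vspace 'M[K]_m}) :
  lie_closed U -> lie_hom f U -> lie_solvable U -> lie_solvable (f @: U).
Proof.
move=> cU hf [k Uk]; exists k; apply/eqP; rewrite -subv0 -(limg0 f) -Uk {Uk}.
have dU j : (iter j (fun V => lie_brv V V) U <= U)%VS.
  by elim: j => //= j IH; apply/lie_brv_subP => A B /(subvP IH) AU /(subvP IH); apply: cU.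
elim: k => //= k IH; apply: subv_trans (lie_brv_sub IH IH) _.
apply/lie_brv_subP => _ _ /memv_imgP[A AU ->] /memv_imgP[B BU ->].
rewrite -hf; [|exact: (subvP (dU k))|exact: (subvP (dU k))].
by rewrite memv_img // mem_lie_brv.
Qed.

(** The common eigenvector becomes, up to a factor, the first row of the base change, and the
    induction continues in the lower right block. The form is lower triangular because eigenvectors
    are rows. *)
Lemma lie_triangular n (U : {vspace 'M[K]_n}) : lie_closed U -> lie_solvable U ->
  exists2 h, h \in unitmx & forall u, u \in U ->
    forall i j : 'I_n, (i < j)%N -> (h *m u *m invmx h) i j = 0.
Proof.
elim: n U => [|n IH] U cU sU.
  by exists 1%:M; [exact: unitmx1|move=> u _ []].
have [v v0 vU] := lie_common_eigenvector cU sU.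
pose h1 := row_ebase v; have h1u : h1 \in unitmx by exact: row_ebase_unit.
have h1U u : u \in U -> exists c, row 0 h1 *m u = c *: row 0 h1.
  move=> /vU[c vu]; exists c.
  have vE : v = (col_ebase v) 0 0 *: row 0 h1.
    have := mulmx_ebase v; rewrite rank_rV v0 => {1}<-; rewrite -mulmxA.
    have -> : (pid_mx true : 'M[K]_(1, n.+1)) *m row_ebase v = row 0 h1.
      rewrite rowE; congr (_ *m _); apply/matrixP => i j; rewrite !mxE !ord1 eqxx /=.
      by case: j => -[|j] hj //=.
    by rewrite [col_ebase v]mx11_scalar mul_scalar_mx mxE mulr1n.
  have c0 : (col_ebase v) 0 0 != 0.
    by apply: contraNneq v0 => c0; rewrite vE c0 scale0r.
  apply: (scalerI c0); rewrite scalemxAl -vE vu scalerA mulrC -scalerA -vE //.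
pose b (u : 'M[K]_n.+1) : 'M[K]_(1 + n) := h1 *m u *m invmx h1.
have b0 u j : u \in U -> j != 0 -> b u 0 j = 0.
  move=> /h1U[c hc] j0; have -> : b u 0 j = (row 0 (h1 *m u *m invmx h1)) 0 j by rewrite [RHS]mxE.
  rewrite !row_mul hc -scalemxAl -row_mul mulmxV // !mxE eq_sym (negPf j0) mulr0 //.
have bM u1 u2 : b u1 *m b u2 = b (u1 *m u2).
  by rewrite /b !mulmxA -[_ *m invmx h1 *m h1]mulmxA mulVmx // mulmx1.
have bl : linear b.
  by move=> c u1 u2; rewrite /b mulmxDr mulmxDl -scalemxAr -scalemxAl.
have blockE u : u \in U -> b u = block_mx (ulsubmx (b u)) 0 (dlsubmx (b u)) (drsubmx (b u)).
  move=> uU; rewrite -[LHS]submxK; congr block_mx.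
  apply/matrixP => i j; rewrite [LHS]mxE [LHS]mxE ord1 [RHS]mxE.
  have -> : lshift n (0 : 'I_1) = 0 :> 'I_(1 + n) by apply: val_inj.
  by apply: b0.
pose f0 (u : 'M[K]_n.+1) : 'M[K]_n := drsubmx (b u).
have f0l : linear f0.
  move=> c u1 u2; rewrite /f0 bl; move: (b u1) (b u2) => m1 m2.
  by apply/matrixP => i j; rewrite !mxE.
pose H0 := GRing.isLinear.Build K 'M[K]_n.+1 'M[K]_n *:%R f0 f0l.
pose f1 : {linear 'M[K]_n.+1 -> 'M[K]_n} := HB.pack f0 H0.
have hom : lie_hom (linfun f1) U.
  have f0M u1 u2 : u1 \in U -> u2 \in U -> f0 (u1 *m u2) = f0 u1 *m f0 u2.
    move=> u1U u2U; rewrite /f0 -bM (blockE _ u1U) (blockE _ u2U) mulmx_block.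
    by rewrite !block_mxKdr mulmx0 add0r.
  by move=> u1 u2 u1U u2U; rewrite !lfunE /lie_br linearB /= !f0M.
have [h2 h2u h2U] := IH _ (lie_closed_img cU hom) (lie_solvable_img cU hom sU).
pose l2 : 'M[K]_(1 + n) := block_mx 1%:M 0 0 h2.
pose l2' : 'M[K]_(1 + n) := block_mx 1%:M 0 0 (invmx h2).
have l2K : l2 *m l2' = 1%:M.
  rewrite /l2 /l2' mulmx_block !mulmx1 !mul1mx !mulmx0 !mul0mx !addr0 add0r mulmxV //.
  by rewrite -scalar_mx_block.
have [l2u l2'E] : l2 \in unitmx /\ invmx l2 = l2'.
  have [l2u _] := mulmx1_unit l2K; split=> //.
  by rewrite -[RHS]mul1mx -(mulVmx l2u) -mulmxA l2K mulmx1.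
exists (l2 *m h1); first by rewrite unitmx_mul l2u.
move=> u uU i j ij; have -> : invmx (l2 *m h1) = invmx h1 *m l2'.
  by rewrite -l2'E; apply: invrM.
have -> : l2 *m h1 *m u *m (invmx h1 *m l2') = l2 *m b u *m l2' by rewrite /b !mulmxA.
rewrite (blockE _ uU) /l2 /l2' !mulmx_block !mulmx1 !mul1mx !mulmx0 !mul0mx !addr0 !add0r.
have hu : f0 u \in (linfun f1 @: U)%VS by rewrite -[f0 u](lfunE f1) memv_img.
case: (@split_ordP 1 n i) ij => i' ->; case: (@split_ordP 1 n j) => j' -> /=.
- by rewrite !ord1.
- by move=> _; apply: etrans (block_mxEur _ _ _ _ _ _) _; rewrite mul0mx mxE.
- by rewrite ord1.
by rewrite !add1n ltnS => ij; apply: etrans (block_mxEdr _ _ _ _ _ _) _; apply: h2U.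
Qed.

End LieTheorem.

(** * Normal form of a seaweed subalgebra *)

Section Parabolic.
Variables (K : numClosedFieldType) (n : nat).
Implicit Types (h u v m : 'M[K]_n) (U V P : {vspace 'M[K]_n}).

Definition cj h u : 'M[K]_n := h *m u *m invmx h.

Lemma cjM h u v : h \in unitmx -> cj h u *m cj h v = cj h (u *m v).
Proof. by move=> hu; rewrite /cj !mulmxA -[_ *m invmx h *m h]mulmxA mulVmx // mulmx1. Qed.

Lemma cj_br h u v : h \in unitmx -> cj h (lie_br u v) = lie_br (cj h u) (cj h v).
Proof. by move=> hu; rewrite /lie_br !cjM // /cj mulmxBr mulmxBl. Qed.

Lemma cj_tr h u : h \in unitmx -> \tr (cj h u) = \tr u.
Proof. by move=> hu; rewrite /cj mxtrace_mulC mulmxA mulVmx // mul1mx. Qed.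

Lemma cjK h u : h \in unitmx -> invmx h *m cj h u *m h = u.
Proof. by move=> hu; rewrite /cj !mulmxA mulVmx // mul1mx -mulmxA mulVmx // mulmx1. Qed.

Lemma cjVK h u : h \in unitmx -> cj h (invmx h *m u *m h) = u.
Proof. by move=> hu; rewrite /cj !mulmxA mulmxV // mul1mx -mulmxA mulmxV // mulmx1. Qed.

Lemma cjD h u v : cj h (u + v) = cj h u + cj h v.
Proof. by rewrite /cj mulmxDr mulmxDl. Qed.

Lemma cjZ h c u : cj h (c *: u) = c *: cj h u.
Proof. by rewrite /cj -scalemxAr -scalemxAl. Qed.

Lemma sparse_space h (R : rel 'I_n) : exists V : {vspace 'M[K]_n}, forall u,
  u \in V <-> (forall i j, cj h u i j != 0 -> R i j).
Proof.
pose g u : 'M[K]_n := \matrix_(i, j) (if R i j then 0 else cj h u i j).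
have gl : linear g.
  have gE u i j : g u i j = if R i j then 0 else cj h u i j by rewrite mxE.
  have lE c (A B : 'M[K]_n) i j : (c *: A + B) i j = c * A i j + B i j by rewrite !mxE.
  move=> c u v; apply/matrixP => i j; rewrite lE !gE cjD cjZ lE.
  by case: ifP => // _; rewrite mulr0 addr0.
pose H := GRing.isLinear.Build K 'M[K]_n 'M[K]_n *:%R g gl.
pose g' : {linear 'M[K]_n -> 'M[K]_n} := HB.pack g H.
exists (lker (linfun g')) => u; rewrite memv_ker lfunE /=; split=> [/eqP gu i j|hu].
  apply: contraNT => nR; move/matrixP/(_ i j): gu.
  by rewrite [RHS]mxE mxE (negPf nR) => ->.
apply/eqP/matrixP => i j; rewrite mxE [RHS]mxE; case: ifPn => // nR.
by apply/eqP; apply: contraNT nR => /hu.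
Qed.

Lemma mxtr_lie_br u v : \tr (lie_br u v) = 0.
Proof. by rewrite /lie_br linearB /= mxtrace_mulC subrr. Qed.

(** Lie's theorem places [V] inside the traceless lower triangular matrices. These are solvable, as
    each derived step moves the support at least one diagonal down, so maximality gives equality. *)
Lemma borel_triangular V : sl_borel V -> exists2 h, h \in unitmx &
  forall u, u \in V <-> \tr u = 0 /\ forall i j, cj h u i j != 0 -> (j <= i)%N.
Proof.
move=> [[cV slV] sV maxV]; have [h hu hV] := lie_triangular cV sV; exists h => //.
have [T TP] := sparse_space h (fun i j => (j <= i)%N).
have memT u : u \in (T :&: sl K n)%VS <->
    \tr u = 0 /\ forall i j, cj h u i j != 0 -> (j <= i)%N.
  rewrite memv_cap mem_sl; split=> [/andP[/TP uT /eqP]//|[/eqP -> /TP->]//].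
suff -> : V = (T :&: sl K n)%VS by [].
have subE (A B : 'M[K]_n) i j : (A - B) i j = A i j - B i j by rewrite !mxE.
have lower_br u v : (forall i j, cj h u i j != 0 -> (j <= i)%N) ->
    (forall i j, cj h v i j != 0 -> (j <= i)%N) ->
    forall i j, cj h (lie_br u v) i j != 0 -> (j < i)%N.
  move=> hu' hv i j; rewrite cj_br // => nz.
  have tr : transitive [rel i j : 'I_n | (j <= i)%N].
    by move=> l k l' /= kl ll'; apply: leq_trans ll' kl.
  have dE u' v' : (forall i j, u' i j != 0 -> (j <= i)%N) ->
      (forall i j, v' i j != 0 -> (j <= i)%N) -> (u' *m v') i i = u' i i * v' i i.
    move=> h1 h2; rewrite mxE (bigD1 i) //= big1 ?addr0 // => k ki.
    have [->|/h1 k_le] := eqVneq (u' i k) 0; first by rewrite mul0r.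
    have [->|/h2 i_le] := eqVneq (v' k i) 0; first by rewrite mulr0.
    by case/eqP: ki; apply: val_inj; apply/eqP; rewrite eqn_leq k_le.
  rewrite ltn_neqAle; apply/andP; split.
    apply: contraNneq nz => /val_inj ->.
    by rewrite /lie_br subE (dE (cj h u)) // (dE (cj h v)) // mulrC subrr.
  have [nz1|nz1] := eqVneq ((cj h u *m cj h v) i j) 0.
    by move: nz; rewrite /lie_br subE nz1 add0r oppr_eq0; apply: (chain_mul tr hv hu').
  exact: (chain_mul tr hu' hv nz1).
apply/esym/maxV.
- split; last exact: capvSr.
  move=> u v /memT[tu hu'] /memT[tv hv]; apply/memT; split; first exact: mxtr_lie_br.
  by move=> i j /lower_br h'; apply/ltnW/h'.
- exists n.
  suff it k : forall u, u \in iter k (fun W => lie_brv W W) (T :&: sl K n)%VS ->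
      forall i j, cj h u i j != 0 -> (j + k <= i)%N.
    apply/eqP; rewrite -subv0; apply/subvP => u /it un; rewrite memv0.
    rewrite -(cjK u hu); suff -> : cj h u = 0 by rewrite mulmx0 mul0mx.
    apply/matrixP => i j; rewrite [RHS]mxE; apply/eqP; apply: contraT => /un.
    by rewrite leqNgt (leq_trans (ltn_ord i)) // leq_addl.
  elim: k => [|k IH] u.
    by move=> /memT[_ hu'] i j; rewrite addn0; apply: hu'.
  have [Tk TkP] := sparse_space h (fun i j => (j + k.+1 <= i)%N).
  move=> uk; apply/TkP; move: u uk; apply/subvP/lie_brv_subP => u v /IH hu' /IH hv.
  apply/TkP; case: k {IH Tk TkP} hu' hv => [|k] hu' hv i j.
    by rewrite addn1; apply: lower_br => i' j'; rewrite -[X in (X <= _)%N]addn0; [apply: hu'|apply: hv].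
  have big u' v' : (forall i j, u' i j != 0 -> (j + k.+1 <= i)%N) ->
      (forall i j, v' i j != 0 -> (j + k.+1 <= i)%N) ->
      (u' *m v') i j != 0 -> (j + k.+2 <= i)%N.
    move=> h1 h2; apply: contraR => ij; rewrite mxE big1 // => l _; apply/eqP.
    rewrite mulf_eq0; apply: contraT; rewrite negb_or => /andP[/h1 il /h2 lj].
    by case/negP: ij; move: il lj; clear; lia.
  rewrite cj_br // => nz; have [nz1|nz1] := eqVneq ((cj h u *m cj h v) i j) 0.
    by move: nz; rewrite /lie_br subE nz1 add0r oppr_eq0; apply: big.
  exact: big nz1.
apply/subvP => u uV; apply/memT; split.
  by move/subvP/(_ u uV): slV; rewrite mem_sl => /eqP.
move=> i j; apply: contraNT; rewrite -ltnNge => ij; apply/eqP; exact: hV.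
Qed.

(** Containing the traceless lower triangular matrices, the algebra contains the matrix unit at
    every off-diagonal position where one of its elements is nonzero. With the diagonal these
    positions form a total preorder, and [p] counts predecessors. *)
Lemma parabolic_flag P : (0 < n)%N -> sl_parabolic P ->
  exists h (p : 'I_n -> nat), [/\ h \in unitmx,
    forall i j : 'I_n, (j <= i)%N -> (p i <= p j)%N &
    forall u, u \in P <-> \tr u = 0 /\ forall i j, cj h u i j != 0 -> (p i <= p j)%N].
Proof.
move=> n0 [[cP slP] [V /borel_triangular[h hu VP] /subvP VsubP]].
pose inQ m := invmx h *m m *m h \in P.
have cjP u : inQ (cj h u) = (u \in P) by rewrite /inQ cjK.
have inQD u v : inQ u -> inQ v -> inQ (u + v).
  by rewrite /inQ mulmxDr mulmxDl; apply: memvD.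
have inQZ c u : inQ u -> inQ (c *: u).
  by rewrite /inQ -scalemxAr -scalemxAl; apply: memvZ.
have inQbr u v : inQ u -> inQ v -> inQ (lie_br u v).
  move=> uQ vQ; have := cP _ _ uQ vQ; rewrite -cjP cj_br // !cjVK //.
have inQlow m : \tr m = 0 -> (forall i j, m i j != 0 -> (j <= i)%N) -> inQ m.
  move=> tm ml; apply/VsubP/VP; rewrite cjVK //; split=> //.
  by rewrite -(cj_tr _ hu) cjVK.
pose e i : 'M[K]_n := pr K [set i].
have eii i : e i *m e i = e i by exact: pr_id.
have eij i j : i != j -> e i *m e j = 0.
  by move=> ij; apply: pr_disj; rewrite disjoints1 inE.
(* Subtracting a scalar makes [e i] traceless, hence an element of the algebra, without changing the
   bracket. *)
have inQe i m : inQ m -> inQ (lie_br (e i) m).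
  move=> mQ; have -> : lie_br (e i) m = lie_br (e i - (n%:R^-1)%:M) m.
    rewrite /lie_br mulmxBl mulmxBr mul_scalar_mx mul_mx_scalar.
    by rewrite opprB addrA subrK.
  apply: inQbr => //; apply: inQlow.
    rewrite linearB /= mxtrace_scalar -[e i]mulmx1.
    have -> : \tr (e i *m 1%:M) = 1.
      rewrite /mxtrace (bigD1 i) //= big1 => [|j ji]; rewrite pr_mulE !inE.
        by rewrite eqxx mxE eqxx addr0.
      by rewrite (negPf ji).
    by rewrite -[_ *+ n]mulr_natl mulfV ?subrr // pnatr_eq0 -lt0n.
  move=> k l; have [->|kl] := eqVneq k l; first by rewrite leqnn.
  by rewrite /e !mxE (negPf kl) !mulr0n subr0 eqxx.
have emeE i j m : e i *m m *m e j = m i j *: delta_mx i j.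
  apply/matrixP => k l; rewrite mul_prE pr_mulE !mxE !inE.
  by have [ki|_] := eqVneq k i; have [lj|_] := eqVneq l j;
    rewrite ?ki ?lj ?mulr1 ?mulr0.
(* [[e i, [e j, m]]] is minus the sum of the entries of [m] at [(i, j)] and [(j, i)]. A further
   bracket with [e i] flips the sign of the second one only, so adding the two isolates [(i, j)]. *)
have inQd i j m : i != j -> inQ m -> m i j != 0 -> inQ (delta_mx i j).
  move=> ij mQ mij; have h1 := inQe i _ (inQe j _ mQ); have h2 := inQe i _ h1.
  have := inQZ ((- 2 * m i j)^-1) _ (inQD _ _ h1 h2).
  have -> : lie_br (e i) (lie_br (e j) m) = - (e i *m m *m e j) - e j *m m *m e i.
    rewrite /lie_br mulmxBr mulmxBl !mulmxA eij // mul0mx sub0r -[m *m e j *m e i]mulmxA.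
    by rewrite eij ?mulmx0 ?subr0 // eq_sym.
  have -> : lie_br (e i) (- (e i *m m *m e j) - e j *m m *m e i) =
      - (e i *m m *m e j) + e j *m m *m e i.
    rewrite /lie_br mulmxBr mulmxBl !mulmxN !mulNmx !mulmxA eii eij //.
    rewrite -[_ *m e j *m e i]mulmxA eij 1?eq_sym // -[_ *m e i *m e i]mulmxA eii.
    by rewrite !mul0mx mulmx0 subr0 oppr0 sub0r opprK.
  have -> : - (e i *m m *m e j) - e j *m m *m e i +
      (- (e i *m m *m e j) + e j *m m *m e i) = (- 2 * m i j) *: delta_mx i j.
    rewrite addrACA addNr addr0 emeE -scalerA -scaleNr -mulr2n.
    by rewrite !scaleNr scaler_nat mulNrn.
  by rewrite scalerA mulVf ?scale1r // mulf_neq0 // oppr_eq0 pnatr_eq0.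
pose R (i j : 'I_n) := (i == j) || `[< exists2 m, inQ m & m i j != 0 >].
have Rd i j : i != j -> R i j -> inQ (delta_mx i j).
  by move=> ij; rewrite /R (negPf ij) => /asboolP[m mQ mij]; apply: inQd mQ mij.
have dR i j : inQ (delta_mx i j) -> R i j.
  move=> dQ; apply/orP; right; apply/asboolP; exists (delta_mx i j) => //.
  by rewrite mxE !eqxx oner_eq0.
have Rlow (i j : 'I_n) : (j <= i)%N -> R i j.
  move=> ji; have [->|ij] := eqVneq i j; first by rewrite /R eqxx.
  apply: dR; apply: inQlow => [|k l].
    by rewrite -[delta_mx i j]mulmx1 mxtr_delta mxE eq_sym (negPf ij).
  by rewrite mxE; case: (k =P i) => [->|]; case: (l =P j) => [->|]; rewrite ?eqxx.
have Rtr i j k : R i j -> R j k -> R i k.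
  have [<-//|ij] := eqVneq i j; have [->//|jk] := eqVneq j k.
  have [->|ik] := eqVneq i k; first by rewrite {3}/R eqxx.
  move=> /(Rd _ _ ij) h1 /(Rd _ _ jk) h2; apply: dR; have := inQbr _ _ h1 h2.
  rewrite /lie_br mul_delta_mx mul_delta_mx_0 ?subr0 //.
  by rewrite eq_sym.
pose p j := #|[set k | R k j]|.
have Rp i j : R i j = (p i <= p j)%N.
  apply/idP/idP => [Rij|]; last apply: contraTT => nR.
    by apply: subset_leq_card; apply/subsetP => k; rewrite !inE => /Rtr; apply.
  have Rji : R j i.
    by apply: (Rlow j i); apply: contraNT nR; rewrite -ltnNge => /ltnW/Rlow.
  rewrite -ltnNge; apply: proper_card; apply/properP; split.
    by apply/subsetP => k; rewrite !inE => /Rtr; apply.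
  by exists i; rewrite !inE ?nR // /R eqxx.
exists h, p; split=> // [i j /Rlow|u]; first by rewrite Rp.
split=> [uP|[tu hup]].
  split; first by move/subvP/(_ u uP): slP; rewrite mem_sl => /eqP.
  move=> i j nz; rewrite -Rp; apply/orP; right; apply/asboolP.
  by exists (cj h u) => //; rewrite cjP.
rewrite -cjP; pose d := \matrix_(i, j) (if i == j then cj h u i j else 0).
rewrite -(subrK d (cj h u)); apply: (inQD (_ - d)); last first.
  apply: inQlow; last by move=> i j; rewrite mxE; case: (i =P j) => [->|_ /eqP].
  by rewrite -tu -(cj_tr u hu); apply: eq_bigr => i _; rewrite mxE eqxx.
move: (cj h u) hup @d => m hm d.
have : forall i j, (m - d) i j != 0 -> i != j /\ m i j != 0.
  move=> i j; rewrite !mxE; case: (eqVneq i j) => [->|_]; first by rewrite subrr eqxx.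
  by rewrite subr0.
move: (m - d) => m' hm'; rewrite (matrix_sum_delta m').
apply: (big_ind inQ) => [||i _]; [by rewrite /inQ mulmx0 mul0mx mem0v|exact: inQD|].
apply: (big_ind inQ) => [||j _]; [by rewrite /inQ mulmx0 mul0mx mem0v|exact: inQD|].
have [->|/hm'[ij mij]] := eqVneq (m' i j) 0.
  by rewrite scale0r /inQ mulmx0 mul0mx mem0v.
by apply/inQZ/Rd => //; rewrite Rp hm.
Qed.

End Parabolic.

(** * Bruhat decomposition *)

Section Bruhat.
Variables (K : fieldType) (n : nat).
Implicit Types (g l b : 'M[K]_n).

Lemma lower_inv l : (forall i j, l i j != 0 -> (j <= i)%N) ->
  (forall i, l i i != 0) ->
  l \in unitmx /\ forall i j, invmx l i j != 0 -> (j <= i)%N.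
Proof.
move=> hl dl; have lu : l \in unitmx.
  rewrite unitmxE unitfE det_trig; first by apply/prodf_neq0 => i _.
  apply/is_trig_mxP => i j ij; apply/eqP; apply: contraTT ij => /hl.
  by rewrite -leqNgt.
split=> // i j; apply: contraNT; rewrite -ltnNge.
have [k] := ubnP (val i); elim: k i => // k IH i; rewrite ltnS => ik ij.
have : (l *m invmx l) i j = 0.
  by rewrite mulmxV // mxE -val_eqE /= (ltn_eqF ij).
rewrite mxE (bigD1 i) //= big1 ?addr0 => [/eqP|m mi].
  by rewrite mulf_eq0 (negPf (dl i)).
have [->|/hl m_le] := eqVneq (l i m) 0; first by rewrite mul0r.
have m_lt : (m < i)%N by rewrite ltn_neqAle m_le andbT.
suff /eqP-> : invmx l m j == 0 by rewrite mulr0.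
by apply: IH; [apply: leq_trans ik|apply: ltn_trans ij].
Qed.

(* Column [j] of [l] is chosen to maximise the number of leading zeros of
   [g *m col j l]; two columns then never have the same number. *)
Lemma bruhat g : g \in unitmx -> exists l (s : {perm 'I_n}),
  [/\ forall i j, l i j != 0 -> (j <= i)%N, forall i, l i i != 0,
      forall i j, (g *m l) i j != 0 -> (s j <= i)%N & forall j, (g *m l) (s j) j != 0].
Proof.
move=> gu.
pose ok j (v : 'cV[K]_n) t := [/\ v j 0 = 1, forall k : 'I_n, (k < j)%N -> v k 0 = 0
  & forall i : 'I_n, (i < t)%N -> (g *m v) i 0 = 0].
have ok_lt j v t : ok j v t -> (t < n)%N.
  move=> [vj _ gv]; rewrite ltnNge; apply/negP => nt.
  have : g *m v = 0.
    by apply/matrixP => i k; rewrite ord1 gv ?mxE // (leq_trans (ltn_ord i)).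
  move/(congr1 (mulmx (invmx g))); rewrite mulmx0 mulKmx // => v0.
  by move: vj; rewrite v0 mxE => /eqP; rewrite eq_sym oner_eq0.
have colP j : exists (v : 'cV[K]_n) (t : 'I_n), [/\ ok j v t, (g *m v) t 0 != 0 &
    forall v' t', ok j v' t' -> (t' <= t)%N].
  pose T t := `[< exists v, ok j v t >].
  have ex0 : exists t, T t.
    exists 0%N; apply/asboolP; exists (delta_mx j 0); split=> //.
      by rewrite mxE !eqxx.
    by move=> k kj; rewrite mxE -val_eqE /= (ltn_eqF kj).
  have ub t : T t -> (t <= n)%N by move=> /asboolP[v /ok_lt/ltnW].
  case: (ex_maxnP ex0 ub) => t /asboolP[v vt] tmax.
  exists v, (Ordinal (ok_lt _ _ _ vt)); split=> //; last first.
    by move=> v' t' ok'; apply: tmax; apply/asboolP; exists v'.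
  apply/negP => /eqP gt0; suff : T t.+1 by move/tmax; rewrite ltnn.
  apply/asboolP; exists v; have [h1 h2 h3] := vt; split=> // i; rewrite ltnS leq_eqVlt.
  case/orP => [/eqP it|/h3 //].
  have -> : i = Ordinal (ok_lt _ _ _ vt) by apply: val_inj.
  exact: gt0.
have [v vP] := choice colP; have {vP} [t tP] := choice vP.
pose l : 'M[K]_n := \matrix_(i, j) v j i 0.
have glE i j : (g *m l) i j = (g *m v j) i 0.
  by rewrite !mxE; apply: eq_bigr => k _; rewrite mxE.
have t_inj : injective t.
  suff lt_neq (j j' : 'I_n) : (j < j')%N -> t j <> t j'.
    move=> j j' tt; have [/lt_neq/(_ tt)//|/lt_neq/(_ (esym tt))//|] := ltngtP j j'.
    exact: val_inj.
  move=> jj' tt; have [[vj vk gv] gv0 tmax] := tP j.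
  have [[vj' vk' gv'] gv0' _] := tP j'.
  (* Subtracting a multiple of the later column keeps column [j] normalised and would create one
     more leading zero, against maximality. *)
  pose c := (g *m v j) (t j) 0 / (g *m v j') (t j) 0.
  suff : ok j (v j - c *: v j') (t j).+1 by move/tmax; rewrite ltnn.
  have subE (a b : 'cV[K]_n) i : (a - c *: b) i 0 = a i 0 - c * b i 0 by rewrite !mxE.
  split=> [|k kj|i].
  - by rewrite subE vj vk' // mulr0 subr0.
  - by rewrite subE vk // vk' ?mulr0 ?subr0 // (ltn_trans kj).
  rewrite ltnS leq_eqVlt mulmxBr -scalemxAr subE => /orP[/eqP/val_inj ->|it].
    by rewrite /c divfK ?subrr // tt.
  by rewrite gv // gv' -?tt // mulr0 subr0.
exists l, (perm t_inj); split=> [i j|i|i j|j].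
- by rewrite mxE leqNgt; case: (tP j) => [[_ vk _] _ _]; apply: contraNN => /vk/eqP.
- by rewrite mxE; case: (tP i) => [[-> _ _] _ _]; rewrite oner_eq0.
- by rewrite glE permE leqNgt; case: (tP j) => [[_ _ gv] _ _]; apply: contraNN => /gv/eqP.
- by rewrite glE permE; case: (tP j).
Qed.

End Bruhat.

Section SeaweedForm.
Variables (K : numClosedFieldType) (n : nat).
Implicit Types (h u v m : 'M[K]_n) (P g : {vspace 'M[K]_n}).

Lemma cj_mul a h u : a \in unitmx -> h \in unitmx -> cj (a *m h) u = cj a (cj h u).
Proof.
move=> au hu; suff hE : invmx (a *m h) = invmx h *m invmx a by rewrite /cj hE !mulmxA.
have ahu : a *m h \in unitmx by rewrite unitmx_mul au.
by apply: (can_inj (mulKmx ahu)); rewrite mulmxV // mulmxA mulmxK // mulmxV.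
Qed.

Lemma cj_sparse (r : rel 'I_n) a u : transitive r -> a \in unitmx ->
  (forall i j, a i j != 0 -> r i j) -> (forall i j, invmx a i j != 0 -> r i j) ->
  (forall i j, cj a u i j != 0 -> r i j) <-> (forall i j, u i j != 0 -> r i j).
Proof.
move=> tr au ha hV; split=> hu; last by apply: (chain_mul tr) => //; apply: (chain_mul tr).
rewrite -(cjK u au); apply: (chain_mul tr) => //; exact: (chain_mul tr).
Qed.

Lemma seaweed_form g : (0 < n)%N -> sl_seaweed g ->
  exists h (p q : 'I_n -> nat), [/\ h \in unitmx, compat [set: 'I_n] p q &
    forall u, u \in g <-> \tr u = 0 /\ sw [set: 'I_n] p q (cj h u)].
Proof.
move=> n0 [P [P' [/(parabolic_flag n0)[h1 [p [h1u pm PP]]]]]].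
move=> /(parabolic_flag n0)[h2 [p' [h2u p'm PP']]] PPsl ->.
have [|l [s [ll ld bl bd]]] := @bruhat K n (h1 *m invmx h2).
  by rewrite unitmx_mul h1u unitmx_inv.
have [lu lV] := lower_inv ll ld.
(* By the Bruhat decomposition [h1 *m invmx h2 *m l] is [b] up to a permutation of columns, with [b]
   lower triangular. So [h] differs from [h1] by a triangular factor and from [h2] by a triangular
   factor and a permutation: it is adapted to both flags. *)
pose b := col_perm s^-1%g (h1 *m invmx h2 *m l).
have [||bu bV] := @lower_inv K n b.
- by move=> i j; rewrite mxE => /bl; rewrite permKV.
- by move=> i; rewrite mxE; have := bd (s^-1%g i); rewrite permKV.
have bl' : forall i j, b i j != 0 -> (j <= i)%N.
  by move=> i j; rewrite mxE => /bl; rewrite permKV.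
pose h := invmx b *m h1.
have hu : h \in unitmx by rewrite unitmx_mul unitmx_inv bu.
have hE : h = perm_mx s^-1%g *m (invmx l *m h2).
  apply: (can_inj (mulKmx bu)); rewrite mulKVmx //.
  rewrite /b col_permE !mulmxA -[_ *m perm_mx _ *m perm_mx _]mulmxA -perm_mxM invgK mulgV perm_mx1.
  by rewrite mulmx1 mulmxK // mulmxKV.
have lower_tr (r : 'I_n -> nat) : (forall i j : 'I_n, (j <= i)%N -> (r i <= r j)%N) ->
    forall a u, a \in unitmx -> (forall i j, a i j != 0 -> (j <= i)%N) ->
    (forall i j, invmx a i j != 0 -> (j <= i)%N) ->
    (forall i j, cj a u i j != 0 -> (r i <= r j)%N) <->
    (forall i j, u i j != 0 -> (r i <= r j)%N).
  move=> rm a u au ha hV.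
  apply: (@cj_sparse (fun i j => r i <= r j)%N) => // [j i k|i j|i j].
  - exact: leq_trans.
  - by move=> /ha/rm.
  - by move=> /hV/rm.
(* Subtraction from the maximum reverses the order, since [sw] asks for [q j <= q i]. *)
pose M := \max_i p' i; pose p2 i := p' (s^-1%g i); pose q i := (M - p2 i)%N.
have qE i j : (q j <= q i)%N = (p2 i <= p2 j)%N.
  rewrite leq_sub2lE //; exact: leq_bigmax.
have PE u : u \in P <-> \tr u = 0 /\ forall i j, cj h u i j != 0 -> (p i <= p j)%N.
  rewrite PP /h cj_mul ?unitmx_inv // (lower_tr p pm (invmx b)) ?unitmx_inv ?invmxK //.
have P'E u : u \in P' <-> \tr u = 0 /\ forall i j, cj h u i j != 0 -> (q j <= q i)%N.
  have cjE i j : cj h u i j = cj (invmx l) (cj h2 u) (s^-1%g i) (s^-1%g j).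
    rewrite hE cj_mul ?unitmx_perm ?unitmx_mul ?unitmx_inv ?lu // cj_mul ?unitmx_inv //.
    have sV : (perm_mx s^-1%g : 'M[K]_n) \in unitmx by exact: unitmx_perm.
    have invE : invmx (perm_mx s^-1%g) = perm_mx (s^-1)^-1%g :> 'M[K]_n.
      by apply: (can_inj (mulKmx sV)); rewrite mulmxV // -perm_mxM mulgV perm_mx1.
    by rewrite {1}/cj invE -row_permE -col_permE 2!mxE.
  rewrite PP' -(lower_tr p' p'm (invmx l)) ?unitmx_inv ?invmxK //.
  split=> -[tu hs]; split=> // i j.
    by rewrite cjE qE; apply: hs.
  by have := hs (s i) (s j); rewrite cjE qE /p2 !permK.
exists h, p, q; split=> // [i j _ _ pij|u]; last first.
  rewrite memv_cap; split=> [/andP[/PE[tu h1p] /P'E[_ h2q]]|[tu hs]].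
    split=> // i j nz; rewrite !inE; split=> //; [exact: h1p|exact: h2q].
  by apply/andP; split; [apply/PE|apply/P'E]; split=> // i j /hs[].
(* The matrix unit at [(j, i)] is traceless, so it splits along [P + P']. Its part in [P] has no
   entry there, as [p i < p j]; hence its part in [P'] has one. *)
have ij : i != j by apply: contraTneq pij => ->; rewrite ltnn.
pose d : 'M[K]_n := delta_mx j i.
have : invmx h *m d *m h \in (P + P')%VS.
  rewrite PPsl mem_sl -(cj_tr _ hu) cjVK // -[d]mulmx1 mxtr_delta mxE.
  by rewrite (negPf ij).
case/memv_addP => u /PE[_ hp] [u' /P'E[_ hq]] /(congr1 (cj h)).
rewrite cjVK // cjD => /matrixP/(_ j i); rewrite mxE [RHS]mxE !eqxx /= => e1.
apply: hq; apply: contraTneq pij => u0; rewrite -leqNgt; apply: hp.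
by apply/negP => /eqP u1; move/eqP: e1; rewrite u0 u1 addr0 oner_eq0.
Qed.

End SeaweedForm.

(** * From the normal form to the theorem *)

Section Duality.
Variables (K : fieldType) (V : vectType K).
Implicit Types (B : 'Hom(V, 'Hom(V, K^o))) (D : 'End(V)) (U W : {vspace V}).

(** Restricting [B u] to [W] maps the whole space onto the dual of [W], and [U] lies in the kernel
    of this map. *)
Lemma orthogonal_dim B U W : lker B = 0%VS ->
  (forall u w, u \in U -> w \in W -> B u w = 0) -> (\dim U + \dim W <= \dim {:V})%N.
Proof.
move=> B0 UW; pose r u : 'Hom(subvs_of W, K^o) := (B u \o linfun vsval)%VF.
have rl : linear r.
  move=> c u v; apply/lfunP => w.
  by rewrite /r !(comp_lfunE, add_lfunE, scale_lfunE) linearP add_lfunE scale_lfunE.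
pose H := GRing.isLinear.Build K V 'Hom(subvs_of W, K^o) *:%R r rl.
pose r' : {linear V -> 'Hom(subvs_of W, K^o)} := HB.pack r H.
have dV : (\dim (limg B) = \dim {: 'Hom(V, K^o)})%N.
  by rewrite limg_dim_eq ?B0 ?capv0 // !dimvf /dim /= muln1.
have Bsurj : limg B = fullv.
  by apply/eqP; rewrite eqEdim subvf dV leqnn.
have r_surj : limg (linfun r') = fullv.
  apply/eqP; rewrite eqEsubv subvf; apply/subvP => t _.
  have : (t \o linfun (vsproj W))%VF \in limg B by rewrite Bsurj memvf.
  case/memv_imgP => u _ uE; apply/memv_imgP; exists u; rewrite ?memvf // lfunE /=.
  by apply/lfunP => w; rewrite /r -uE !comp_lfunE !lfunE /= vsvalK.
have Uker : (U <= lker (linfun r'))%VS.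
  apply/subvP => u uU; rewrite memv_ker lfunE /=; apply/eqP/lfunP => w.
  by rewrite /r comp_lfunE !lfunE /= UW // subvsP.
have := limg_ker_dim (linfun r') fullv.
rewrite capfv r_surj [\dim {: 'Hom(_, _)}]dimvf /dim /= muln1 => <-.
by rewrite leq_add2r dimvS.
Qed.

(** The eigenspace for [a] is orthogonal to the image of [D - (c - a)], whose codimension is the
    dimension of the eigenspace for [c - a]. *)
Lemma dim_leigenspace_le B D c a : lker B = 0%VS ->
  (forall u v, B (D u) v + B u (D v) = c *: B u v) ->
  (\dim (leigenspace D a) <= \dim (leigenspace D (c - a)))%N.
Proof.
move=> B0 BD; pose E := D - (c - a) *: \1%VF.
have := limg_ker_dim E fullv; rewrite capfv => dE.
have := @orthogonal_dim B (leigenspace D a) (limg E) B0.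
rewrite -dE leq_add2r; apply=> u _ uD /memv_imgP[w _ ->].
move: uD; rewrite memv_ker add_lfunE opp_lfunE scale_lfunE id_lfunE subr_eq0 => /eqP uD.
have := BD u w; rewrite uD linearZ /= scale_lfunE.
rewrite /E add_lfunE opp_lfunE scale_lfunE id_lfunE linearB linearZ /= => /(canRL (addKr _)) ->.
rewrite -scaleNr -scalerDl -scalerBl; have -> : - a + c - (c - a) = 0 by ring.
by rewrite scale0r.
Qed.

Lemma leigenspace_dimB B D c a : lker B = 0%VS ->
  (forall u v, B (D u) v + B u (D v) = c *: B u v) ->
  \dim (leigenspace D a) = \dim (leigenspace D (c - a)).
Proof.
move=> B0 BD; apply/eqP; rewrite eqn_leq (dim_leigenspace_le a B0 BD) /=.
by have := dim_leigenspace_le (c - a) B0 BD; rewrite subKr.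
Qed.

Lemma leigenvalueP D a :
  reflect (exists2 u, u != 0 & D u = a *: u) (leigenvalue D a).
Proof.
apply: (iffP idP) => [|[u u0 uD]].
  rewrite /leigenvalue -vpick0 => u0; exists (vpick (leigenspace D a)) => //.
  have := memv_pick (leigenspace D a).
  by rewrite memv_ker add_lfunE opp_lfunE scale_lfunE id_lfunE subr_eq0 => /eqP.
apply: contraNneq u0 => D0; rewrite -memv0 -D0 memv_ker.
by rewrite add_lfunE opp_lfunE scale_lfunE id_lfunE uD subrr.
Qed.

Lemma leigenvalue_uniq_size D (s : seq K) :
  uniq s -> all (leigenvalue D) s -> (size s <= \dim {:V})%N.
Proof.
move=> us /allP sD; have bV := vbasisP (fullv : {vspace V}).
rewrite -ltnS -(size_char_poly (mxof (vbasis fullv) (vbasis fullv) D)).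
apply: max_poly_roots => //; first by rewrite -size_poly_eq0 size_char_poly.
apply/allP => a /sD; rewrite /leigenvalue (leigenspaceE bV) vsof_eq0 //.
by rewrite -eigenvalue_root_char.
Qed.

End Duality.

(** * Functionals and eigenvectors carried over to matrices *)

Section Transport.
Variables (K : numClosedFieldType) (n : nat) (g : {vspace 'M[K]_n}).
Variables (h : 'M[K]_n) (p q : 'I_n -> nat).
Hypotheses (n0 : (0 < n)%N) (hu : h \in unitmx) (cg : lie_closed g).
Hypothesis gE : forall u, u \in g <-> \tr u = 0 /\ sw [set: 'I_n] p q (cj h u).
Local Notation A := (@sw K n setT p q).
Implicit Types (u v : 'M[K]_n) (a c : K) (x y z : subvs_of g).

Let traceless (u : 'M[K]_n) : 'M[K]_n := u - (\tr u / n%:R)%:M.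

(** Thanks to the projection onto [g], [pull] is linear on all matrices; on the traceless elements
    of [A] it inverts conjugation by [h] ([pullK]). *)
Let pull (u : 'M[K]_n) : subvs_of g := vsproj g (invmx h *m u *m h).

Let n_neq0 : n%:R != 0 :> K. Proof. by rewrite pnatr_eq0 -lt0n. Qed.

Let sw_scalar (c : K) : A (c%:M : 'M[K]_n).
Proof. by rewrite -scalemx1 -[1%:M](@prT K n); apply: swZ; apply: sw_pr. Qed.

Let tracelessP u : \tr (traceless u) = 0.
Proof. by rewrite /traceless linearB /= mxtrace_scalar -[_ *+ n]mulr_natr divfK // subrr. Qed.

Let sw_traceless (u : 'M[K]_n) : A u -> A (traceless u).
Proof. by move=> Au; apply: swB => //; apply: sw_scalar. Qed.

Let br_scalarB u v c : lie_br u (v - c%:M) = lie_br u v.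
Proof.
by rewrite /lie_br mulmxBr mulmxBl mul_mx_scalar mul_scalar_mx opprB addrA subrK.
Qed.

Let br_traceless u v : lie_br (traceless u) (traceless v) = lie_br u v.
Proof. by rewrite br_scalarB lie_brC br_scalarB -lie_brC. Qed.

Let pullK (u : 'M[K]_n) : A u -> \tr u = 0 -> cj h (vsval (pull u)) = u.
Proof. by move=> Au tu; rewrite vsprojK ?cjVK //; apply/gE; rewrite -(cj_tr _ hu) cjVK. Qed.

Let val_sw y : A (cj h (vsval y)).
Proof. by have /gE[] := subvsP y. Qed.

Let val_tr y : \tr (cj h (vsval y)) = 0.
Proof. by rewrite cj_tr //; have /gE[] := subvsP y. Qed.

Let cj_inj y z : cj h (vsval y) = cj h (vsval z) -> y = z.
Proof. by move=> e; apply: val_inj; rewrite /= -(cjK (vsval y) hu) e cjK. Qed.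

Let cj_val0 : cj h (vsval (0 : subvs_of g)) = 0.
Proof. by rewrite [vsval 0]linear0 /cj mulmx0 mul0mx. Qed.

Lemma cj_sub_br y z :
  cj h (vsval (sub_br y z)) = lie_br (cj h (vsval y)) (cj h (vsval z)).
Proof. by rewrite val_sub_br // cj_br. Qed.

(** The matrix representing [F] is made traceless, so that its functional vanishes on scalars;
    radical and principal identity then extend from the traceless elements to all of [A]. *)
Lemma functional_matrix (F : 'Hom(subvs_of g, K^o)) x :
  frobenius_functional F -> kirillov_map F x = F ->
  exists f, frob [set: 'I_n] p q f /\ princ [set: 'I_n] p q f (cj h (vsval x)).
Proof.
move=> kF xF; have [|m mE] := @mxtr_formP K n (fun u => F (pull u)).
  move=> c u v; rewrite /pull mulmxDr mulmxDl -scalemxAr -scalemxAl.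
  by rewrite !linearP.
pose f := traceless m.
have fE u : \tr u = 0 -> \tr (f *m u) = F (pull u).
  move=> tu; rewrite mE /f /traceless mulmxBl linearB /= mul_scalar_mx linearZ /=.
  by rewrite tu mulr0 subr0.
have Fval y : F y = \tr (f *m cj h (vsval y)).
  by rewrite fE ?val_tr //; congr (F _); apply: cj_inj; rewrite pullK.
have f1 c : \tr (f *m c%:M) = 0 by rewrite mul_mx_scalar linearZ /= tracelessP mulr0.
have Fbr y z : kirillov F y z = \tr (f *m lie_br (cj h (vsval y)) (cj h (vsval z))).
  by rewrite /kirillov Fval cj_sub_br.
exists f; split=> [u Au fu|].
  exists (\tr u / n%:R); rewrite prT scalemx1; apply/eqP; rewrite -subr_eq0.
  have Au0 := sw_traceless Au.
  have y0 : pull (traceless u) \in kirillov_ker F.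
    apply/kirillov_kerP => z; rewrite Fbr pullK //.
    have -> : cj h (vsval z) = traceless (cj h (vsval z)).
      by rewrite /traceless val_tr mul0r raddf0 subr0.
    by rewrite br_traceless; apply: fu.
  apply/eqP; rewrite -[LHS](pullK Au0) //; move: y0; rewrite kF memv0 => /eqP ->.
  exact: cj_val0.
split=> // v Av; have Av0 := sw_traceless Av.
have : kirillov F x (pull (traceless v)) = F (pull (traceless v)).
  by rewrite -kirillov_mapE xF.
rewrite Fbr Fval pullK // => xv.
rewrite -br_traceless; have -> : traceless (cj h (vsval x)) = cj h (vsval x).
  by rewrite /traceless val_tr mul0r raddf0 subr0.
by rewrite xv {1}/traceless mulmxBr linearB /= f1 subr0.
Qed.

(** Scalar eigenvectors count for [swspec] but do not come from [g]. They contribute only the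
    eigenvalue 0, which [g] has through [x] itself. For [a != 0] an eigenvector is proportional to a
    bracket, hence traceless. *)
Lemma leigenvalue_swspec x a : x != 0 ->
  leigenvalue (ad x) a <-> swspec [set: 'I_n] p q (cj h (vsval x)) a.
Proof.
move=> x0; split=> [/leigenvalueP[y y0]|[u [Au u0 ux]]].
  rewrite adE => xy; exists (cj h (vsval y)); split=> //.
    apply: contraNneq y0 => y0; apply/eqP/cj_inj.
    by rewrite y0 cj_val0.
  by rewrite -cj_sub_br xy linearZ /= cjZ.
apply/leigenvalueP; have [a0|a0] := eqVneq a 0.
  exists x => //; rewrite adE a0 scale0r; apply: cj_inj.
  by rewrite cj_sub_br /lie_br subrr cj_val0.
have tu : \tr u = 0.
  have /eqP := congr1 mxtrace ux; rewrite mxtr_lie_br linearZ /= eq_sym mulf_eq0.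
  by rewrite (negPf a0) => /eqP.
exists (pull u); first by apply: contraNneq u0 => y0; rewrite -(pullK Au tu) y0 cj_val0.
rewrite adE; apply: cj_inj; rewrite cj_sub_br pullK // ux.
by rewrite linearZ /= cjZ pullK.
Qed.

Lemma seaweed_neq0 : (1 < n)%N -> exists y : subvs_of g, y != 0.
Proof.
move=> n1; pose i : 'I_n := Ordinal n0; pose j : 'I_n := Ordinal n1.
pose d : 'M[K]_n := pr K [set i] - pr K [set j].
have Ad : A d by apply: swB; apply: sw_pr; apply: subsetT.
have tr1 (k : 'I_n) : \tr (pr K [set k]) = 1.
  rewrite -[pr K _]mulmx1 /mxtrace (bigD1 k) //= big1 => [|l lk]; rewrite pr_mulE inE.
    by rewrite eqxx mxE eqxx addr0.
  by rewrite (negPf lk).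
have td : \tr d = 0 by rewrite linearB /= !tr1 subrr.
exists (pull d); apply/eqP => d0; have := pullK Ad td.
rewrite d0 cj_val0 => /matrixP/(_ i i).
rewrite mxE [RHS]mxE prE [X in _ + X]mxE prE eqxx !inE /= subr0.
by move/eqP; rewrite eq_sym oner_eq0.
Qed.

End Transport.

Lemma seaweed_closed (K : numClosedFieldType) n (g : {vspace 'M[K]_n}) :
  sl_seaweed g -> lie_closed g.
Proof.
move=> [P [P' [[[cP _] _] [[cP' _] _] _ ->]]] A B; rewrite !memv_cap.
by move=> /andP[AP AP'] /andP[BP BP']; rewrite cP ?cP'.
Qed.

Lemma kirillov_invariance (K : fieldType) n (g : {vspace 'M[K]_n})
    (F : 'Hom(subvs_of g, K^o)) x u v : lie_closed g -> kirillov_map F x = F ->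
  kirillov_map F (ad x u) v + kirillov_map F u (ad x v) = 1 *: kirillov_map F u v.
Proof.
move=> cg xF; rewrite scale1r !kirillov_mapE /kirillov !adE -linearD /=.
have -> : sub_br (sub_br x u) v + sub_br u (sub_br x v) = sub_br x (sub_br u v).
  by apply: val_inj; rewrite linearD /= !val_sub_br // -lie_jacobi.
by rewrite -[LHS]/(kirillov F x _) -kirillov_mapE xF.
Qed.

Lemma cvx_spectrum (W : int -> Prop) (N : nat) : cvx W -> W 0 ->
  (forall k, W k -> W (1 - k)) -> (forall m : nat, W m -> (m <= N)%N) ->
  exists2 lam : int, 0 < lam & forall k, W k <-> 1 - lam <= k <= lam.
Proof.
move=> cW W0 Ws WN; have W1 : W 1 by rewrite -[1]subr0; apply: Ws.
have ex1 : exists m : nat, `[< W m >] by exists 1%N; apply/asboolP.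
have ub m : `[< W m%:Z >] -> (m <= N)%N by move/asboolP; apply: WN.
case: (ex_maxnP ex1 ub) => lam /asboolP Wlam lam_max; exists lam%:Z.
  by have := lam_max 1%N; move/(_ (introT (asboolP _) W1)).
have le_lam k : W k -> k <= lam%:Z.
  by case: k => m // Wm; rewrite lez_nat lam_max //; apply/asboolP.
move=> k; split=> [Wk|]; last by apply: cW => //; apply: Ws.
by rewrite le_lam // andbT lerBlDl -lerBlDr le_lam //; apply: Ws.
Qed.

Lemma seaweed_spectrum (K : numClosedFieldType) (n : nat) (g : {vspace 'M[K]_n})
    (x : subvs_of g) : (2 <= n)%N -> sl_seaweed g -> principal x ->
  (exists2 lam : int, 0 < lam &
     forall z : K, leigenvalue (ad x) z <->
       (exists2 l : int, 1 - lam <= l <= lam & z = l%:~R)) /\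
  (forall l : int,
     \dim (leigenspace (ad x) l%:~R) = \dim (leigenspace (ad x) (1 - l)%:~R)).
Proof.
move=> hn hg hx.
have n0 : (0 < n)%N by apply: leq_trans hn.
have [F kF xF] := hx; have cg := seaweed_closed hg.
have [h [p [q [hu cpq gE]]]] := seaweed_form n0 hg.
have dimE a : \dim (leigenspace (ad x) a) = \dim (leigenspace (ad x) (1 - a)).
  by apply: leigenspace_dimB kF _ => u v; apply: kirillov_invariance.
have intE (l : int) : (1 - l)%:~R = 1 - l%:~R :> K by exact: intrB.
split=> [|l]; last by rewrite intE; apply: dimE.
have x0 : x != 0.
  have [y] := seaweed_neq0 n0 hu gE hn; apply: contraNneq => x0.
  by rewrite -memv0 -kF; apply/kirillov_kerP => z; rewrite /kirillov -xF x0 linear0 lfunE.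
have swE a := leigenvalue_swspec hu cg gE a x0.
have [f [fP xP]] := functional_matrix n0 hu cg gE kF xF.
have J0 : [set: 'I_n] != set0 by apply/set0Pn; exists (Ordinal n0); rewrite inE.
have [_ [_ _ _ _ [Wint cW]]] := good_principal J0 cpq fP xP.
pose W (k : int) := is_true (leigenvalue (ad x) (k%:~R : K)).
have {}cW : cvx W by apply: cvx_eq cW => k; rewrite /W swE.
have W0 : W 0.
  apply/leigenvalueP; exists x => //; rewrite adE scale0r.
  by apply: val_inj; rewrite /= val_sub_br // /lie_br subrr.
have Ws k : W k -> W (1 - k).
  by rewrite /W intE /leigenvalue -!dimv_eq0 => Wk; rewrite -(dimE k%:~R).
(* By convexity an eigenvalue [m] brings all of [0, ..., m] with it, and the number of eigenvalues
   is at most the dimension. *)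
have WN m : W m%:Z -> (m <= \dim {: subvs_of g})%N.
  move=> Wm; pose s := [seq k%:R : K | k <- iota 0 m.+1].
  have us : uniq s.
    by rewrite map_inj_uniq ?iota_uniq // => k l /eqP; rewrite eqr_nat => /eqP.
  suff sx : all (leigenvalue (ad x)) s.
    by have := leigenvalue_uniq_size us sx; rewrite size_map size_iota => /ltnW.
  apply/allP => a /mapP[k]; rewrite mem_iota add0n ltnS => km ->.
  by apply: (cW 0 m%:Z k%:Z) => //; rewrite lez_nat km.
have [lam lam0 WE] := cvx_spectrum cW W0 Ws WN.
exists lam; first exact: lam0.
move=> z; split=> [zx|[l /WE Wl zl]]; last by rewrite zl; exact: Wl.
have [k zk] := Wint z ((swE z).1 zx); exists k; last exact: zk.
by apply/WE; rewrite /W -zk.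
Qed.

Theorem theorem3 (R : realType) (n : nat) (hn : (2 <= n)%N)
    (g : {vspace 'M[R[i]]_n}) (hg : sl_seaweed g) (hF : frobenius g)
    (x : subvs_of g) (hx : principal x) :
  (exists2 lam : int, 0 < lam &
     forall z : R[i], leigenvalue (ad x) z <->
       (exists2 l : int, 1 - lam <= l <= lam & z = l%:~R)) /\
  (forall l : int,
     \dim (leigenspace (ad x) l%:~R) = \dim (leigenspace (ad x) (1 - l)%:~R)).
Proof. exact: seaweed_spectrum. Qed.
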